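(* Let $X$ be an integral scheme, let $E$ be a vector bundle (locally free sheaf of finite rank) on $X$, and let $\chi=(E^\bullet,\delta_\bullet,D_\bullet)$ be an echelon datum of length $m$ on $X$ with $E^0=E$. Let $\mathrm{Mod}(\chi,E)$ be its echelon modification. (i) $\mathrm{Mod}(\chi,E)$ is a locally free sheaf containing and generically equal to $E$, and it depends functorially on $(\chi,E)$. (ii) If $f:Y\to X$ is a dominant morphism from another integral scheme $Y$, then $$f^*\mathrm{Mod}_X(\chi,E)=\mathrm{Mod}_Y(f^*(\chi),f^*(E)).$$ (iii) If $\phi:E\to L$ is a map to a line bundle $L$ such that $\phi(E^i)\subset L(-D_i)$ for each $i$, then $\phi$ extends to a map $$\mathrm{Mod}(\chi,\phi):\mathrm{Mod}(\chi,E)\to L.$$ If $E'$ is any locally free sheaf containing and generically equal to $E$ such that $\phi$ extends to $E'$, then $E'$ is contained in $\mathrm{Mod}(\chi,E)$.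
   Context: **Echelon data.** A pre-echelon datum of length $m$, $(E^\bullet,\delta_\bullet)$, on a scheme $X$ consists of - a descending chain of locally free sheaves of the same (finite) rank $E=E^0\supset E^1\supset\dots\supset E^m$; - Cartier divisors $\delta_0=0,\delta_1,\dots,\delta_m$ such that each $d\delta_i:=\delta_i-\delta_{i-1}$ is effective; satisfying the persistence condition: for all $i\ge1$ one has $E^i\supset E^{i-1}(-d\delta_i)$, and for all $j<i$ the quotient $E^i/E^{i-1}(-d\delta_i)$ maps isomorphically (via the map induced by $E^i\subset E^{i-1}\subset E^j$) to a locally free, locally split $\mathcal O_{d\delta_i}$-submodule of $E^j\otimes\mathcal O_{d\delta_i}$. An echelon datum $\chi=(E^\bullet,\delta_\bullet,D_\bullet)$ is a pre-echelon datum together with Cartier sub-divisors $D_i\le\delta_i$ ($D_0=0$) such that $dD_i:=D_i-D_{i-1}$ is effective and $D_i$ has no components in common with $D_i^\dagger:=\delta_i-D_i$. Moreover $dD_i\le d\delta_i$, i.e. a local equation $t_i$ of $d\delta_i$ factors as $t_i=x_iy_i$ with $y_i$ a local equation of $dD_i$. **Echelon modification.** Put $E_0=E$ and $E_0^i=E^i$ for $0\le i\le m$. Define inductively, with sums and intersections taken inside $E(\delta_m)$, $$E_{j+1}=E_j^1(dD_{j+1})+E_j\subset E_j(dD_{j+1}),\qquad 0\le j\le m-1,$$ $$E_j^i=E_{j-1}^{i+1}(d\delta_j)\cap E_j,\qquad j\ge1,\ 1\le i\le m-j.$$ Thus $E_1=E^1(D_1)+E$ and $E_1^i=E^{i+1}(\delta_1)\cap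 E_1$. This gives an ascending chain $E=E_0\subset E_1\subset\dots\subset E_m$, and the echelon modification is $\mathrm{Mod}(\chi,E):=E_m$, also written $\mathrm{Mod}_X(\chi,E)$ to indicate the base scheme. **Conventions.** A sheaf $E'\supset E$ is generically equal to $E$ if the two agree on a dense open subset; such sheaves are compared as subsheaves of the sheaf of rational sections of $E$. A map $\phi:E\to L$ extends to $E'\supset E$ if there is a map $E'\to L$ whose restriction to $E$ is $\phi$. The pullback is $f^*(\chi)=(f^*E^\bullet,f^*\delta_\bullet,f^*D_\bullet)$.
   Formalization: ''No components in common'' includes embedded components; (ii) also assumes f^*D_i and f^*D_i^† have no common component; in (iii), last sentence, every such φ over every open set and to every line bundle L, not just one φ, is required to extend to E'. *)

(* Defs.v *)
From HB Require Import structures.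
From mathcomp Require Import all_boot all_algebra.
From mathcomp Require Import generic_quotient.
From mathcomp Require Import all_classical.
From mathcomp Require Import topology_structure.

Set Implicit Arguments.
Unset Strict Implicit.
Unset Printing Implicit Defensive.

Import GRing.Theory.
Local Open Scope classical_set_scope.
Local Open Scope ring_scope.
Local Open Scope quotient_scope.

Record opens (X : topologicalType) := Opens {
  oset :> set X;
  osetP : open oset }.

Definition opensT (X : topologicalType) : opens X := Opens (@openT X).
Definition opensI (X : topologicalType) (U V : opens X) : opens X :=
  Opens (openI (osetP U) (osetP V)).
Definition opensU (X : topologicalType) (U V : opens X) : opens X :=
  Opens (openU (osetP U) (osetP V)).

Lemma opensIl (X : topologicalType) (U V : opens X) : opensI U V `<=` U.
Proof. by move=> x []. Qed.
Lemma opensIr (X : topologicalType) (U V : opens X) : opensI U V `<=` V.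
Proof. by move=> x []. Qed.

Record is_sheaf (X : topologicalType) (S : opens X -> Type)
    (res : forall U V : opens X, V `<=` U -> S U -> S V) : Prop := IsSheaf {
  sheaf_id : forall (U : opens X) (h : U `<=` U) s, res U U h s = s;
  sheaf_comp : forall (U V W : opens X) (h : V `<=` U) (h' : W `<=` V) (h'' : W `<=` U) s,
    res V W h' (res U V h s) = res U W h'' s;
  sheaf_sep : forall (U : opens X) (I : Type) (V : I -> opens X) (h : forall i, V i `<=` U),
    (forall x, oset U x -> exists i, oset (V i) x) ->
    forall s t, (forall i, res _ _ (h i) s = res _ _ (h i) t) -> s = t;
  sheaf_glue : forall (U : opens X) (I : Type) (V : I -> opens X) (h : forall i, V i `<=` U),
    (forall x, oset U x -> exists i, oset (V i) x) ->
    forall s : forall i, S (V i),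
      (forall i j (W : opens X) (hi : W `<=` V i) (hj : W `<=` V j),
        res _ _ hi (s i) = res _ _ hj (s j)) ->
      exists t, forall i, res _ _ (h i) t = s i }.

(* Sections over the empty set form the zero ring, hence comPzRingType. *)
Record ringedSpace := RingedSpace {
  rspace :> topologicalType;
  rO : opens rspace -> comPzRingType;
  rres : forall U V : opens rspace, V `<=` U -> {rmorphism rO U -> rO V};
  rO_sheaf : is_sheaf (fun (U V : opens rspace) (h : V `<=` U) (s : rO U) => rres h s) }.

Definition unit_at (X : ringedSpace) (U : opens X) (f : rO U) (x : X) : Prop :=
  exists (V : opens X) (h : V `<=` U) (g : rO V), oset V x /\ rres h f * g = 1.

Record prime_ideal (A : comPzRingType) (P : set A) : Prop := PrimeIdeal {
  prime0 : P 0;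
  primeD : forall a b, P a -> P b -> P (a + b);
  primeM : forall a b, P b -> P (a * b);
  prime1 : ~ P 1;
  primeMP : forall a b, P (a * b) -> P a \/ P b }.

Record is_localization (A B : comPzRingType) (h : A -> B) (f : A) : Prop :=
  IsLocalization {
    loc_unit : exists g, h f * g = 1;
    loc_surj : forall b, exists n a, h (f ^+ n) * b = h a;
    loc_ker : forall a, h a = 0 -> exists n, f ^+ n * a = 0 }.

(* (U, O|_U) is isomorphic to Spec A for A = O(U): sending a point x to the
   prime of sections which are not invertible at x is a bijection from U to the
   primes of A, the sets D(f) = [set x | unit_at f x] form a base of the
   topology of U, and A -> O(D(f)) is the localization at f. *)
Record affine_open (X : ringedSpace) (U : opens X) : Prop := AffineOpen {
  affine_prime : forall x, oset U x -> prime_ideal [set f : rO U | ~ unit_at f x];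
  affine_point : forall P : set (rO U), prime_ideal P ->
    exists x, [/\ oset U x, [set f | ~ unit_at f x] = P &
      forall y, oset U y -> [set f | ~ unit_at f y] = P -> y = x];
  affine_base : forall V : opens X, V `<=` U -> forall x, oset V x ->
    exists f : rO U, unit_at f x /\ [set y | unit_at f y] `<=` V;
  affine_loc : forall (f : rO U) (V : opens X) (h : V `<=` U),
    V = [set y | unit_at f y] :> set X -> is_localization (rres h) f }.

Definition is_scheme (X : ringedSpace) : Prop :=
  forall x : X, exists U : opens X, oset U x /\ affine_open U.

Record integralScheme := IntegralScheme {
  ischeme :> ringedSpace;
  ischemeP : is_scheme ischeme;
  ischeme_ne : [set: ischeme] !=set0;
  ischeme_dom : forall U : opens ischeme, U !=set0 ->
    (1 : rO U) <> 0 /\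
    forall a b : rO U, a * b = 0 -> a = 0 \/ b = 0 }.

Record modSheaf (X : ringedSpace) := ModSheaf {
  msec :> forall U : opens X, lmodType (rO U);
  mres : forall U V : opens X, V `<=` U -> msec U -> msec V;
  mres_lin : forall (U V : opens X) (h : V `<=` U) (a : rO U) (s t : msec U),
    mres h (a *: s + t) = rres h a *: mres h s + mres h t;
  msec_sheaf : is_sheaf mres }.

Section Structure.
Variable X : ringedSpace.
Implicit Types U V W : opens X.
Let msecO (U : opens X) : lmodType (rO U) := (rO U)^o.
Let mresO (U V : opens X) (h : V `<=` U) (s : msecO U) : msecO V := rres h s.

Lemma mresO_lin U V (h : V `<=` U) (a : rO U) (s t : msecO U) :
  mresO h (a *: s + t) = rres h a *: mresO h s + mresO h t.
Proof. by rewrite /mresO rmorphD rmorphM. Qed.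

Definition structure_sheaf : modSheaf X :=
  ModSheaf mresO_lin (rO_sheaf X : is_sheaf mresO).
End Structure.

Section Restriction.
Variables (X : ringedSpace) (M : modSheaf X).
Implicit Types U V W : opens X.

Lemma mresD U V (h : V `<=` U) : {morph @mres X M U V h : s t / s + t}.
Proof. by move=> s t; have := mres_lin h 1 s t; rewrite !scale1r rmorph1 scale1r. Qed.

Lemma mres0 U V (h : V `<=` U) : @mres X M U V h 0 = 0.
Proof. by apply: (@addrI _ (mres h 0)); rewrite -mresD !addr0. Qed.

Lemma mresZ U V (h : V `<=` U) (a : rO U) (s : M U) :
  mres h (a *: s) = rres h a *: mres h s.
Proof. by have := mres_lin h a s 0; rewrite mres0 !addr0. Qed.

Lemma mresN U V (h : V `<=` U) : {morph @mres X M U V h : s / - s}.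
Proof. by move=> s; rewrite -scaleN1r mresZ rmorphN1 scaleN1r. Qed.

Lemma mres_comp U V W (h : V `<=` U) (h' : W `<=` V) (h'' : W `<=` U) (s : M U) :
  mres h' (mres h s) = mres h'' s.
Proof. exact: (sheaf_comp (msec_sheaf M)). Qed.

Lemma mres_irr U V (h h' : V `<=` U) (s : M U) : mres h s = mres h' s.
Proof. by rewrite (Prop_irrelevance h h'). Qed.

Lemma msec_empty U (s t : M U) : ~ (U !=set0) -> s = t.
Proof.
move=> U0; pose V (i : False) : opens X := match i with end.
apply: (sheaf_sep (msec_sheaf M) (V := V) (h := fun i => match i with end)).
  by move=> x Ux; case: U0; exists x.
by case.
Qed.
End Restriction.

Section Rational.
Variable X : integralScheme.
Implicit Types U V W : opens X.

Lemma opens_meet U V : U !=set0 -> V !=set0 -> (opensI U V) !=set0.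
Proof.
move=> U0 V0; apply: contrapT => UV0.
pose W := opensU U V; pose F (b : bool) := if b then U else V.
have FW b : F b `<=` W by case: b => x ?; [left | right].
have cov x : oset W x -> exists b, oset (F b) x.
  by case=> ?; [exists true | exists false].
have emp (Z : opens X) (s t : rO Z) : ~ (Z !=set0) -> s = t.
  by move=> H; have := (@msec_empty X (structure_sheaf X) Z s t H).
have glue (c : bool -> bool) :
  exists t : rO W, forall b, rres (FW b) t = (c b)%:R.
  apply: (@sheaf_glue _ _ _ (rO_sheaf X) W bool F FW cov
    (fun b => (c b)%:R : rO (F b))).
  move=> b b' Z hi hj; rewrite !rmorph_nat; case: (b =P b') => [-> //|bb'].
  apply: emp => -[x Zx]; apply: UV0; exists x.
  by case: b b' hi hj bb' => [] [] hi hj //= _; split;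
    [exact: hi | exact: hj | exact: hj | exact: hi].
have [s Hs] := glue id; have [t Ht] := glue negb.
have W0 : W !=set0 by case: U0 => x Ux; exists x; left.
have [_ /(_ s t)] := ischeme_dom W0.
case.
- apply: (sheaf_sep (rO_sheaf X) (V := F) (h := FW)) => // b.
  by rewrite rmorphM Hs Ht rmorph0; case: b; rewrite ?mulr0 ?mul0r.
- move=> s0; have := Hs true; rewrite s0 rmorph0 /=.
  by case: (ischeme_dom U0) => n01 _ /esym.
- move=> s0; have := Ht false; rewrite s0 rmorph0 /=.
  by case: (ischeme_dom V0) => n01 _ /esym.
Qed.

Section RatDef.
Variable M : modSheaf X.

Record prerat := PreRat {
  pr_dom : opens X;
  pr_ne : pr_dom !=set0;
  pr_sec : M pr_dom }.

HB.instance Definition _ := gen_eqMixin prerat.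
HB.instance Definition _ := gen_choiceMixin prerat.

Definition prerat_eq (p q : prerat) : Prop :=
  exists W (h : W `<=` pr_dom p) (h' : W `<=` pr_dom q),
    W !=set0 /\ mres h (pr_sec p) = mres h' (pr_sec q).

Definition prerat_eqb (p q : prerat) : bool := `[< prerat_eq p q >].

Lemma prerat_equiv : equiv_class_of prerat_eqb.
Proof.
split.
- move=> p; apply/asboolP; exists (pr_dom p), (@subset_refl _ _), (@subset_refl _ _).
  by split=> //; exact: pr_ne.
- move=> p q; apply/asboolP/asboolP => -[W [h [h' [W0 e]]]];
    by exists W, h', h.
- move=> q p r /asboolP[W [h [h' [W0 e]]]] /asboolP[Z [k [k' [Z0 e']]]].
  apply/asboolP; have WZ := opens_meet W0 Z0.
  have hW : opensI W Z `<=` W by move=> x [].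
  have hZ : opensI W Z `<=` Z by move=> x [].
  exists (opensI W Z), (subset_trans hW h), (subset_trans hZ k'); split=> //.
  rewrite -(mres_comp h hW) e -(mres_comp k' hZ) -e'.
  by rewrite (mres_comp _ _ (subset_trans hW h')) (mres_comp _ _ (subset_trans hW h')).
Qed.

Canonical prerat_equivRel := EquivRelPack prerat_equiv.

(* The rational sections of M, i.e. its stalk at the generic point of X. As X
   is irreducible, they are the sections over any nonempty open set of the
   (constant) sheaf of rational sections of M. *)
Definition ratSections : Type := {eq_quot prerat_equivRel}.

HB.instance Definition _ := Choice.on ratSections.
HB.instance Definition _ := EqQuotient.on ratSections.

(* The class of s; if U is empty, so that s = 0, it is taken to be 0. *)
Definition germ U (s : M U) : ratSections :=
  match pselect (U !=set0) with
  | left U0 => \pi_ratSections (PreRat U0 s)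
  | right _ => \pi_ratSections (@PreRat (opensT X) (ischeme_ne X) 0)
  end.

Definition rat_dom (v : ratSections) : opens X := pr_dom (repr v).
Definition rat_sec (v : ratSections) : M (rat_dom v) := pr_sec (repr v).

Lemma rat_dom_ne v : rat_dom v !=set0. Proof. exact: pr_ne. Qed.

Lemma germ_eqP U V (s : M U) (t : M V) : U !=set0 -> V !=set0 ->
  germ s = germ t <->
  exists W (h : W `<=` U) (h' : W `<=` V), W !=set0 /\ mres h s = mres h' t.
Proof.
move=> U0 V0; rewrite /germ; case: pselect => // U0'; case: pselect => // V0'.
split.
  by move=> /eqmodP /asboolP.
by move=> H; apply/eqmodP/asboolP.
Qed.

Lemma germ_sec v : germ (rat_sec v) = v.
Proof.
rewrite /germ; case: pselect => [U0|]; last by move/(_ (rat_dom_ne v)).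
rewrite -[RHS]reprK; congr (\pi_ratSections _); rewrite /rat_sec /rat_dom in U0 *.
by case: (repr v) U0 => D D0 s U0 /=; rewrite (Prop_irrelevance U0 D0).
Qed.

Lemma germ_res U V (h : V `<=` U) (s : M U) : V !=set0 ->
  germ (mres h s) = germ s.
Proof.
move=> V0; have U0 : U !=set0 by case: V0 => x /h; exists x.
apply/germ_eqP => //; exists V, (@subset_refl _ _), h; split=> //.
exact: mres_comp.
Qed.

Lemma germ_empty U (s : M U) : ~ (U !=set0) -> germ s = germ (0 : M (opensT X)).
Proof.
move=> U0; rewrite /germ; case: pselect => // _; case: pselect => [T0|[]].
  by rewrite (Prop_irrelevance T0 (ischeme_ne X)).
exact: ischeme_ne.
Qed.

Lemma germ_zero U : germ (0 : M U) = germ (0 : M (opensT X)).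
Proof.
case: (pselect (U !=set0)) => U0; last exact: germ_empty.
rewrite -(germ_res ((fun x _ => I) : U `<=` opensT X)) //.
by rewrite mres0.
Qed.

Lemma ratW (v w z : ratSections) : exists U (s t u : M U), [/\ U !=set0,
  v = germ s, w = germ t & z = germ u].
Proof.
pose UV := opensI (rat_dom v) (rat_dom w); pose U := opensI UV (rat_dom z).
have U0 : U !=set0.
  by do 2?apply: opens_meet; exact: rat_dom_ne.
have hv : U `<=` rat_dom v by move=> x [[]].
have hw : U `<=` rat_dom w by move=> x [[]].
have hz : U `<=` rat_dom z by move=> x [].
exists U, (mres hv (rat_sec v)), (mres hw (rat_sec w)), (mres hz (rat_sec z)).
by rewrite !germ_res // !germ_sec.
Qed.

Definition rat_add (v w : ratSections) : ratSections :=
  germ (mres (@opensIl _ (rat_dom v) (rat_dom w)) (rat_sec v)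
      + mres (@opensIr _ (rat_dom v) (rat_dom w)) (rat_sec w)).
Definition rat_opp (v : ratSections) : ratSections := germ (- rat_sec v).
Definition rat_zero : ratSections := germ (0 : M (opensT X)).

Lemma germ_add U (s t : M U) : U !=set0 ->
  rat_add (germ s) (germ t) = germ (s + t).
Proof.
move=> U0; set v := germ s; set w := germ t.
have /(germ_eqP _ _ (rat_dom_ne v) U0)[V [hv [hv' [V0 ev]]]] := germ_sec v.
have /(germ_eqP _ _ (rat_dom_ne w) U0)[W [hw [hw' [W0 ew]]]] := germ_sec w.
apply/germ_eqP => //; first by apply: opens_meet; exact: rat_dom_ne.
have kV := @opensIl X V W.
have kW := @opensIr X V W.
have kd : opensI V W `<=` opensI (rat_dom v) (rat_dom w).
  by move=> x [Vx Wx]; split; [exact: (hv x) | exact: (hw x)].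
exists (opensI V W), kd, (subset_trans kV hv'); split; first exact: opens_meet.
rewrite !mresD !(mres_comp _ _ (subset_trans kV hv)).
rewrite (mres_comp _ _ (subset_trans kW hw)).
rewrite -(mres_comp hv kV) ev -(mres_comp hw kW) ew.
by congr (_ + _); rewrite !(mres_comp _ _ (subset_trans kV hv')).
Qed.

Lemma germ_opp U (s : M U) : U !=set0 -> rat_opp (germ s) = germ (- s).
Proof.
move=> U0; set v := germ s.
have /(germ_eqP _ _ (rat_dom_ne v) U0)[V [hv [hv' [V0 ev]]]] := germ_sec v.
apply/germ_eqP => //; first exact: rat_dom_ne.
by exists V, hv, hv'; rewrite !mresN ev.
Qed.

Fact rat_addA : associative rat_add.
Proof.
move=> u v w; have [U [a [b [c [U0 -> -> ->]]]]] := ratW u v w.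
by rewrite !germ_add // addrA.
Qed.

Fact rat_addC : commutative rat_add.
Proof.
move=> u v; have [U [a [b [_ [U0 -> -> _]]]]] := ratW u v v.
by rewrite !germ_add // addrC.
Qed.

Fact rat_add0 : left_id rat_zero rat_add.
Proof.
move=> u; have [U [a [_ [_ [U0 -> _ _]]]]] := ratW u u u.
by rewrite /rat_zero -(germ_zero U) !germ_add // add0r.
Qed.

Fact rat_addN : left_inverse rat_zero rat_opp rat_add.
Proof.
move=> u; have [U [a [_ [_ [U0 -> _ _]]]]] := ratW u u u.
by rewrite /rat_zero -(germ_zero U) germ_opp // !germ_add // addNr.
Qed.

HB.instance Definition _ :=
  GRing.isZmodule.Build ratSections rat_addA rat_addC rat_add0 rat_addN.

Lemma germ0 U : germ (0 : M U) = 0. Proof. exact: germ_zero. Qed.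

Lemma germ_empty0 U (s : M U) : ~ (U !=set0) -> germ s = 0.
Proof. exact: germ_empty. Qed.

Lemma germD U (s t : M U) : germ (s + t) = germ s + germ t.
Proof.
case: (pselect (U !=set0)) => U0; first by rewrite -germ_add.
by rewrite !germ_empty0 // addr0.
Qed.

Lemma germN U (s : M U) : germ (- s) = - germ s.
Proof. by apply: (@addrI _ (germ s)); rewrite -germD !subrr germ0. Qed.

End RatDef.

(* The function field of X. *)
Definition funField : Type := ratSections (structure_sheaf X).
HB.instance Definition _ := GRing.Zmodule.on funField.

Definition fgerm U (a : rO U) : funField := germ (a : structure_sheaf X U).

Section Scale.
Variable M : modSheaf X.

Definition rat_scale (a : funField) (v : ratSections M) : ratSections M :=
  germ (rres (@opensIl _ (rat_dom a) (rat_dom v))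
          (rat_sec a : rO (rat_dom a))
        *: mres (@opensIr _ (rat_dom a) (rat_dom v)) (rat_sec v)).

Lemma germ_scale U (a : rO U) (s : M U) : U !=set0 ->
  rat_scale (fgerm a) (germ s) = germ (a *: s).
Proof.
move=> U0; set v := fgerm a; set w := germ s.
have /(germ_eqP _ _ (rat_dom_ne v) U0)[V [hv [hv' [V0 ev]]]] := germ_sec v.
have /(germ_eqP _ _ (rat_dom_ne w) U0)[W [hw [hw' [W0 ew]]]] := germ_sec w.
apply/germ_eqP => //; first by apply: opens_meet; exact: rat_dom_ne.
have kV := @opensIl X V W.
have kW := @opensIr X V W.
have kd : opensI V W `<=` opensI (rat_dom v) (rat_dom w).
  by move=> x [Vx Wx]; split; [exact: (hv x) | exact: (hw x)].
exists (opensI V W), kd, (subset_trans kV hv'); split; first exact: opens_meet.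
rewrite !mresZ (mres_comp _ _ (subset_trans kW hw)).
rewrite -(mres_comp hw kW) ew (mres_comp hw' kW (subset_trans kV hv')).
congr (_ *: _).
transitivity (@mres _ (structure_sheaf X) _ _ kV (mres hv (rat_sec v))).
  by rewrite (mres_comp _ _ (subset_trans kV hv))
             -(mres_comp (@opensIl _ _ _) kd).
by rewrite ev (mres_comp _ _ (subset_trans kV hv')).
Qed.
End Scale.

Lemma funFieldW (a : funField) (M : modSheaf X) (v w : ratSections M) :
  exists U (f : rO U) (s t : M U),
  [/\ U !=set0, a = fgerm f, v = germ s & w = germ t].
Proof.
have [V [s [t [_ [V0 -> -> _]]]]] := ratW v w v.
have [W [f [_ [_ [W0 -> _ _]]]]] := ratW a a a.
have kV := @opensIl X V W.
have kW := @opensIr X V W.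
have VW := opens_meet V0 W0.
exists (opensI V W), (rres kW f), (mres kV s), (mres kV t).
split=> //; rewrite ?germ_res //.
by rewrite -(@germ_res (structure_sheaf X) _ _ kW).
Qed.

Lemma funFieldW2 (a b : funField) (M : modSheaf X) (v : ratSections M) :
  exists U (f g : rO U) (s : M U),
  [/\ U !=set0, a = fgerm f, b = fgerm g & v = germ s].
Proof.
have [V [f [g [_ [V0 -> -> _]]]]] := ratW a b a.
have [W [s [_ [_ [W0 -> _ _]]]]] := ratW v v v.
have kV := @opensIl X V W.
have kW := @opensIr X V W.
have VW := opens_meet V0 W0.
exists (opensI V W), (rres kV f), (rres kV g), (mres kW s).
split=> //; rewrite ?germ_res //.
  by rewrite -(@germ_res (structure_sheaf X) _ _ kV).
by rewrite -(@germ_res (structure_sheaf X) _ _ kV).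
Qed.

Definition funField_mul : funField -> funField -> funField :=
  @rat_scale (structure_sheaf X).
Definition funField_one : funField := fgerm (1 : rO (opensT X)).

Lemma fgerm_mul U (a b : rO U) : U !=set0 ->
  funField_mul (fgerm a) (fgerm b) = fgerm (a * b).
Proof. exact: germ_scale. Qed.

Lemma fgerm_one U : U !=set0 -> fgerm (1 : rO U) = funField_one.
Proof.
move=> U0; pose h : U `<=` opensT X := fun x _ => I.
transitivity (fgerm (rres h 1)); first by rewrite rmorph1.
exact: (@germ_res (structure_sheaf X) _ _ h).
Qed.

Lemma fgermD U (a b : rO U) : fgerm (a + b) = fgerm a + fgerm b.
Proof. exact: germD. Qed.

Lemma fgerm0 U : fgerm (0 : rO U) = 0. Proof. exact: germ0. Qed.

Fact funField_mulA : associative funField_mul.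
Proof.
move=> a b c; have [U [u [v [w [U0 -> -> ->]]]]] := ratW a b c.
by rewrite !fgerm_mul // mulrA.
Qed.

Fact funField_mulC : commutative funField_mul.
Proof.
move=> a b; have [U [u [v [_ [U0 -> -> _]]]]] := ratW a b a.
by rewrite !fgerm_mul // mulrC.
Qed.

Fact funField_mul1 : left_id funField_one funField_mul.
Proof.
move=> a; have [U [u [_ [_ [U0 -> _ _]]]]] := ratW a a a.
by rewrite -(fgerm_one U0) !fgerm_mul // mul1r.
Qed.

Fact funField_mulDl : left_distributive funField_mul +%R.
Proof.
move=> a b c; have [U [u [v [w [U0 -> -> ->]]]]] := ratW a b c.
by rewrite !fgerm_mul // -!germD fgerm_mul // mulrDl.
Qed.

Fact funField_one_neq0 : funField_one != 0.
Proof.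
have T0 : opensT X !=set0 by exact: ischeme_ne.
apply/eqP => /(germ_eqP _ _ T0 T0)[W [h [h' [W0]]]].
by rewrite /= rmorph1 rmorph0; have [] := ischeme_dom W0.
Qed.

HB.instance Definition _ := GRing.Zmodule_isComNzRing.Build funField
  funField_mulA funField_mulC funField_mul1 funField_mulDl funField_one_neq0.

Lemma fgermM U (a b : rO U) : fgerm (a * b) = fgerm a * fgerm b.
Proof.
case: (pselect (U !=set0)) => U0; first by rewrite -fgerm_mul.
by rewrite /fgerm !germ_empty0 // mulr0.
Qed.

Lemma fgerm1 U : U !=set0 -> fgerm (1 : rO U) = 1.
Proof. exact: fgerm_one. Qed.

Lemma fgermX U (a : rO U) n : U !=set0 -> fgerm (a ^+ n) = fgerm a ^+ n.
Proof.
move=> U0; elim: n => [|n IHn]; first by rewrite !expr0 fgerm1.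
by rewrite !exprS fgermM IHn.
Qed.

Lemma fgerm_res U V (h : V `<=` U) (a : rO U) : V !=set0 ->
  fgerm (rres h a) = fgerm a.
Proof. exact: (@germ_res (structure_sheaf X) _ _ h). Qed.

Lemma fgerm_unit_at U (f : rO U) x : unit_at f x ->
  exists b, b * fgerm f = 1.
Proof.
move=> [V [h [g [Vx e]]]]; have V0 : V !=set0 by exists x.
by exists (fgerm g); rewrite mulrC -(fgerm_res h) // -fgermM e fgerm1.
Qed.

Lemma open_unit_at U (f : rO U) : open [set x | unit_at f x].
Proof.
rewrite openE => x [V [h [g [Vx e]]]]; rewrite /interior /= nbhsE.
exists V; first by split; [exact: osetP | exact: Vx].
by move=> y Vy; exists V, h, g.
Qed.

Lemma funField_unit (a : funField) : a != 0 -> exists b, b * a = 1.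
Proof.
have [U [f [_ [_ [[x Ux] -> _ _]]]]] := ratW a a a; rewrite -/(fgerm f) => f0.
have [V [Vx aV]] := ischemeP x.
have V0 : V !=set0 by exists x.
have [g [gx gU]] := affine_base aV (@opensIr X U V) (conj Ux Vx).
pose D := Opens (open_unit_at g).
have hU : D `<=` U by move=> y /gU [].
have hV : D `<=` V by move=> y /gU [].
have D0 : D !=set0 by exists x.
have [n [h e]] := loc_surj (affine_loc aV hV erefl) (rres hU f).
have {}e : fgerm g ^+ n * fgerm f = fgerm h.
  have := congr1 (@fgerm D) e.
  by rewrite fgermM !fgerm_res // fgermX.
suff [b hb] : exists b, b * fgerm h = 1.
  by exists (b * fgerm g ^+ n); rewrite -mulrA e.
have [n01 dom] := ischeme_dom V0.
have p0 : prime_ideal [set c : rO V | c = 0].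
  split=> //= [c d -> ->|c d ->]; first by rewrite addr0.
  by rewrite mulr0.
have [y [Vy Py _]] := affine_point aV p0.
apply: (@fgerm_unit_at V h y); apply: contrapT => nu.
have : [set c : rO V | ~ unit_at c y] h by [].
rewrite Py /= => h0; move: e; rewrite h0 fgerm0 => e.
have [b gb] := fgerm_unit_at gx.
suff f00 : fgerm f = 0 by move: f0; rewrite f00 eqxx.
rewrite -[fgerm f]mul1r -(expr1n _ n) -gb exprMn -mulrA e mulr0 //.
Qed.

Definition funField_inv (a : funField) : funField :=
  if a == 0 then 0 else xget 0 [set b | b * a = 1].

Fact funField_mulVf a : a != 0 -> funField_inv a * a = 1.
Proof.
move=> a0; rewrite /funField_inv (negPf a0).
have [b ba] := funField_unit a0.
by case: xgetP => [c _ //|/(_ b)].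
Qed.

Fact funField_inv0 : funField_inv 0 = 0.
Proof. by rewrite /funField_inv eqxx. Qed.

HB.instance Definition _ := GRing.ComNzRing_isField.Build funField
  funField_mulVf funField_inv0.

Section RatLmod.
Variable M : modSheaf X.

Fact rat_scaleA (a b : funField) (v : ratSections M) :
  rat_scale a (rat_scale b v) = rat_scale (a * b) v.
Proof.
have [U [f [g [s [U0 -> -> ->]]]]] := funFieldW2 a b v.
by rewrite -fgermM !germ_scale // scalerA.
Qed.

Fact rat_scale1 : left_id (1 : funField) (@rat_scale M).
Proof.
move=> v; have [U [s [_ [_ [U0 -> _ _]]]]] := ratW v v v.
by rewrite -(fgerm1 U0) germ_scale // scale1r.
Qed.

Fact rat_scaleDr : right_distributive (@rat_scale M) +%R.
Proof.
move=> a v w; have [U [f [s [t [U0 -> -> ->]]]]] := funFieldW a v w.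
by rewrite -germD !germ_scale // scalerDr germD.
Qed.

Fact rat_scaleDl (v : ratSections M) : {morph (@rat_scale M)^~ v : a b / a + b}.
Proof.
move=> a b; have [U [f [g [s [U0 -> -> ->]]]]] := funFieldW2 a b v.
by rewrite -fgermD !germ_scale // scalerDl germD.
Qed.

HB.instance Definition _ := GRing.Zmodule_isLmodule.Build funField (ratSections M)
  rat_scaleA rat_scale1 rat_scaleDr rat_scaleDl.

Lemma germZ U (a : rO U) (s : M U) : germ (a *: s) = fgerm a *: germ s.
Proof.
case: (pselect (U !=set0)) => U0; first by rewrite -germ_scale.
by rewrite !germ_empty0 // scaler0.
Qed.
End RatLmod.

End Rational.

#[local] Obligation Tactic := idtac.

Section Subsheaves.
Variable X : integralScheme.
Implicit Types (x y : X) (U V W : opens X).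

(* The local ring of X at x, as a subring of the function field. *)
Definition stalk x : set (funField X) :=
  [set a | exists U (f : rO U), oset U x /\ a = fgerm f].

Definition stalk_unit x : set (funField X) :=
  [set u | [/\ u != 0, stalk x u & stalk x u^-1]].

Lemma stalk1 x : stalk x 1.
Proof. by exists (opensT X), 1; split; last by rewrite fgerm1 //; exists x. Qed.

Lemma stalkM x a b : stalk x a -> stalk x b -> stalk x (a * b).
Proof.
move=> [U [f [Ux ->]]] [V [g [Vx ->]]].
have UVx : oset (opensI U V) x by [].
exists (opensI U V), (rres (@opensIl _ U V) f * rres (@opensIr _ U V) g).
by split=> //; rewrite fgermM !fgerm_res //; exists x.
Qed.

Lemma stalkD x a b : stalk x a -> stalk x b -> stalk x (a + b).
Proof.
move=> [U [f [Ux ->]]] [V [g [Vx ->]]].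
have UVx : oset (opensI U V) x by [].
exists (opensI U V), (rres (@opensIl _ U V) f + rres (@opensIr _ U V) g).
by split=> //; rewrite fgermD !fgerm_res //; exists x.
Qed.

Lemma stalk_open x a : stalk x a ->
  exists U, oset U x /\ forall y, oset U y -> stalk y a.
Proof. by move=> [U [f [Ux ->]]]; exists U; split=> // y Uy; exists U, f. Qed.

Lemma stalk_unit1 x : stalk_unit x 1.
Proof. by split; rewrite ?invr1 ?oner_neq0 //; exact: stalk1. Qed.

Lemma stalk_unitM x a b : stalk_unit x a -> stalk_unit x b ->
  stalk_unit x (a * b).
Proof.
move=> [a0 sa sa'] [b0 sb sb']; split; rewrite ?mulf_neq0 //.
  exact: stalkM.
by rewrite invfM; exact: stalkM.
Qed.

Lemma stalk_unitV x a : stalk_unit x a -> stalk_unit x a^-1.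
Proof. by move=> [a0 sa sa']; split; rewrite ?invrK ?invr_eq0. Qed.

(* A Cartier divisor, i.e. a section of K^*/O^*, given by the coset of its local
   equations at each point. *)
Record cartier := Cartier {
  eqn :> X -> set (funField X);
  eqn_neq0 : forall x t, eqn x t -> t != 0;
  eqn_coset : forall x t t', eqn x t ->
    (eqn x t' <-> exists2 u, stalk_unit x u & t' = u * t);
  eqn_open : forall x, exists t U,
    oset U x /\ forall y, oset U y -> eqn y t }.

Lemma eqn_ex (D : cartier) x : exists t, D x t.
Proof. by have [t [U [Ux Ht]]] := eqn_open D x; exists t; exact: Ht. Qed.

Lemma eqnZ (D : cartier) x t u : D x t -> stalk_unit x u -> D x (u * t).
Proof. by move=> Dt su; apply/(eqn_coset _ Dt); exists u. Qed.

Program Definition cartier0 : cartier := @Cartier stalk_unit _ _ _.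
Next Obligation. by move=> x t []. Qed.
Next Obligation.
move=> x t t' ut; split=> [ut'|[u su ->]]; last exact: stalk_unitM.
have [t0 _ _] := ut; exists (t' * t^-1); last by rewrite divfK.
by apply: stalk_unitM => //; exact: stalk_unitV.
Qed.
Next Obligation.
by move=> x; exists 1, (opensT X); split=> // y _; exact: stalk_unit1.
Qed.

Program Definition cartierD (D D' : cartier) : cartier :=
  @Cartier (fun x => [set s | exists t t', [/\ D x t, D' x t' & s = t * t']])
    _ _ _.
Next Obligation.
move=> D D' x _ [t [t' [Dt Dt' ->]]].
by apply: mulf_neq0; [exact: (eqn_neq0 Dt) | exact: (eqn_neq0 Dt')].
Qed.
Next Obligation.
move=> D D' x _ r [t [t' [Dt Dt' ->]]].
split=> [[s [s' [Ds Ds' ->]]]|[u su ->]].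
  have [u su ->] := (eqn_coset _ Dt).1 Ds.
  have [u' su' ->] := (eqn_coset _ Dt').1 Ds'.
  by exists (u * u'); [exact: stalk_unitM | rewrite mulrACA].
by exists (u * t), t'; split; rewrite ?mulrA //; exact: eqnZ.
Qed.
Next Obligation.
move=> D D' x.
have [t [U [Ux Ht]]] := eqn_open D x; have [t' [V [Vx Ht']]] := eqn_open D' x.
exists (t * t'), (opensI U V); split=> // y [Uy Vy].
by exists t, t'; split=> //; [exact: Ht | exact: Ht'].
Qed.

Program Definition cartierN (D : cartier) : cartier :=
  @Cartier (fun x => [set s | D x s^-1]) _ _ _.
Next Obligation. by move=> D x t Dt; rewrite -invr_eq0; exact: (eqn_neq0 Dt). Qed.
Next Obligation.
move=> D x t t' Dt; split=> [/(eqn_coset _ Dt)[u su e]|[u su ->]].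
  exists u^-1; first exact: stalk_unitV.
  by rewrite -[LHS]invrK e invfM invrK.
by rewrite /= invfM; apply: eqnZ => //; exact: stalk_unitV.
Qed.
Next Obligation.
move=> D x; have [t [U [Ux Ht]]] := eqn_open D x.
by exists t^-1, U; split=> // y Uy; rewrite /= invrK; exact: Ht.
Qed.

Definition cartierB (D D' : cartier) : cartier := cartierD D (cartierN D').

Definition effective (D : cartier) : Prop := forall x t, D x t -> stalk x t.

(* D <= D' *)
Definition cartier_le (D D' : cartier) : Prop := effective (cartierB D' D).

(* The stalk at x of O(-D). *)
Definition ideal_stalk (D : cartier) x : set (funField X) :=
  [set a | exists2 t, D x t & stalk x (t^-1 * a)].

(* x is a weakly associated point of the closed subscheme O/O(-D): the maximal
   ideal of the local ring at x is the radical of the annihilator of some nonzero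
   a in the stalk at x of O/O(-D). On a locally noetherian scheme these are the
   generic points of the irreducible and of the embedded components of D. *)
Definition component_pt (D : cartier) x : Prop :=
  exists a, [/\ stalk x a, ~ ideal_stalk D x a &
    forall g, stalk x g -> ~ stalk_unit x g ->
      exists n, ideal_stalk D x (g ^+ n * a)].

Definition no_common_component (D D' : cartier) : Prop :=
  forall x, ~ (component_pt D x /\ component_pt D' x).

(* A subsheaf of modules F of the sheaf of rational sections of M. As the latter
   is constant, F is given by its stalks inside ratSections M; the sections of F
   over a nonempty open set U are the v lying in F x for all x in U. *)
Record subSheaf (M : modSheaf X) := SubSheaf {
  sub_stalk :> X -> set (ratSections M);
  sub_stalk0 : forall x, sub_stalk x 0;
  sub_stalkD : forall x v w,
    sub_stalk x v -> sub_stalk x w -> sub_stalk x (v + w);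
  sub_stalkZ : forall x a v,
    stalk x a -> sub_stalk x v -> sub_stalk x (a *: v);
  sub_stalk_open : forall x v, sub_stalk x v ->
    exists U, oset U x /\ forall y, oset U y -> sub_stalk y v }.

Section SubOps.
Variable M : modSheaf X.
Implicit Types F G : subSheaf M.

Definition sub_le F G : Prop := forall x, F x `<=` G x.

Definition generically_equal F G : Prop :=
  exists U, dense (U : set X) /\ forall x, oset U x -> F x = G x.

(* M, or its image if M has torsion. *)
Program Definition sub_full : subSheaf M := @SubSheaf M
  (fun x => [set v | exists U (s : M U), oset U x /\ v = germ s]) _ _ _ _.
Next Obligation. by move=> x; exists (opensT X), 0; rewrite germ0. Qed.
Next Obligation.
move=> x _ _ [U [s [Ux ->]]] [V [t [Vx ->]]].
have UVx : oset (opensI U V) x by [].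
exists (opensI U V), (mres (@opensIl _ U V) s + mres (@opensIr _ U V) t).
by split=> //; rewrite germD !germ_res //; exists x.
Qed.
Next Obligation.
move=> x _ _ [U [s [Ux ->]]] [V [t [Vx ->]]].
have UVx : oset (opensI U V) x by [].
exists (opensI U V), (rres (@opensIl _ U V) s *: mres (@opensIr _ U V) t).
by split=> //; rewrite germZ fgerm_res ?germ_res //; exists x.
Qed.
Next Obligation.
by move=> x _ [U [s [Ux ->]]]; exists U; split=> // y Uy; exists U, s.
Qed.

(* F(D) *)
Program Definition twist F (D : cartier) : subSheaf M := @SubSheaf M
  (fun x => [set v | exists2 t, D x t & F x (t *: v)]) _ _ _ _.
Next Obligation.
move=> F D x; have [t Dt] := eqn_ex D x.
by exists t => //; rewrite scaler0; exact: sub_stalk0.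
Qed.
Next Obligation.
move=> F D x v w [t Dt Fv] [t' Dt' Fw]; exists t => //; rewrite scalerDr.
apply: sub_stalkD => //; have [u [_ su _] ->] := (eqn_coset _ Dt').1 Dt.
by rewrite -scalerA; exact: sub_stalkZ.
Qed.
Next Obligation.
move=> F D x a v sa [t Dt Fv]; exists t => //.
by rewrite scalerA mulrC -scalerA; exact: sub_stalkZ.
Qed.
Next Obligation.
move=> F D x v [t Dt Fv].
have [t' [U [Ux Ht']]] := eqn_open D x.
have [u [_ su _] e] := (eqn_coset _ Dt).1 (Ht' _ Ux).
have Fv' : F x (t' *: v) by rewrite e -scalerA; exact: sub_stalkZ.
have [V [Vx HV]] := sub_stalk_open Fv'.
exists (opensI U V); split=> // y [Uy Vy].
by exists t'; [exact: Ht' | exact: HV].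
Qed.

Program Definition sub_add F G : subSheaf M := @SubSheaf M
  (fun x => [set v | exists v1 v2, [/\ F x v1, G x v2 & v = v1 + v2]]) _ _ _ _.
Next Obligation.
by move=> F G x; exists 0, 0; split; rewrite ?addr0 //; exact: sub_stalk0.
Qed.
Next Obligation.
move=> F G x _ _ [v1 [v2 [Fv Gv ->]]] [w1 [w2 [Fw Gw ->]]].
by exists (v1 + w1), (v2 + w2); split; rewrite 1?addrACA //; exact: sub_stalkD.
Qed.
Next Obligation.
move=> F G x a _ sa [v1 [v2 [Fv Gv ->]]].
by exists (a *: v1), (a *: v2); split; rewrite ?scalerDr //; exact: sub_stalkZ.
Qed.
Next Obligation.
move=> F G x _ [v1 [v2 [Fv Gv ->]]].
have [U [Ux HU]] := sub_stalk_open Fv; have [V [Vx HV]] := sub_stalk_open Gv.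
exists (opensI U V); split=> // y [Uy Vy].
by exists v1, v2; split=> //; [exact: HU | exact: HV].
Qed.

Program Definition sub_cap F G : subSheaf M := @SubSheaf M
  (fun x => F x `&` G x) _ _ _ _.
Next Obligation. by move=> F G x; split; exact: sub_stalk0. Qed.
Next Obligation.
by move=> F G x v w [Fv Gv] [Fw Gw]; split; exact: sub_stalkD.
Qed.
Next Obligation.
by move=> F G x a v sa [Fv Gv]; split; exact: sub_stalkZ.
Qed.
Next Obligation.
move=> F G x v [Fv Gv].
have [U [Ux HU]] := sub_stalk_open Fv; have [V [Vx HV]] := sub_stalk_open Gv.
by exists (opensI U V); split=> // y [Uy Vy]; split; [exact: HU | exact: HV].
Qed.

(* The sections of F over U; only 0 over the empty set. *)
Definition subsec_pred F U : pred (ratSections M) := fun v =>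
  `[< (forall x, oset U x -> F x v) /\ (U !=set0 \/ v = 0) >].

Record subsec F U := Subsec {
  subsec_val :> ratSections M;
  subsec_valP : subsec_pred F U subsec_val }.

HB.instance Definition _ F U := [isSub for @subsec_val F U].
HB.instance Definition _ F U := [Choice of subsec F U by <:].

Fact subsec_closed F U : zmod_closed (subsec_pred F U).
Proof.
split; first by apply/asboolP; split; [move=> x _; exact: sub_stalk0 | right].
move=> v w /asboolP[Fv v0] /asboolP[Fw w0]; apply/asboolP; split.
  move=> x Ux; apply: sub_stalkD; first exact: Fv.
  rewrite -scaleN1r; apply: sub_stalkZ; last exact: Fw.
  exists U, (-1); split=> //; rewrite /fgerm germN; congr (- _).
  by rewrite -/(fgerm 1) fgerm1 //; exists x.
case: (pselect (U !=set0)) => U0; [by left | right].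
by case: v0 => // ->; case: w0 => // ->; rewrite subrr.
Qed.

HB.instance Definition _ F U :=
  GRing.isZmodClosed.Build (ratSections M) (subsec_pred F U) (subsec_closed F U).
HB.instance Definition _ F U :=
  [SubChoice_isSubZmodule of subsec F U by <:].

Fact subsec_scaleP F U (a : rO U) (v : subsec F U) :
  subsec_pred F U (fgerm a *: val v).
Proof.
have /asboolP[Fv v0] := subsec_valP v; apply/asboolP; split.
  move=> x Ux; apply: sub_stalkZ; last exact: Fv.
  by exists U, a.
by case: v0 => [|e]; [left | right; rewrite /= e scaler0].
Qed.

Definition subsec_scale F U (a : rO U) (v : subsec F U) : subsec F U :=
  Subsec (subsec_scaleP a v).

Fact subsec_scaleA F U (a b : rO U) (v : subsec F U) :
  subsec_scale a (subsec_scale b v) = subsec_scale (a * b) v.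
Proof. by apply: val_inj; rewrite /= fgermM scalerA. Qed.

Fact subsec_scale1 F U : left_id 1 (@subsec_scale F U).
Proof.
move=> v; apply: val_inj => /=; have /asboolP[_] := subsec_valP v.
case=> [U0|e]; first by rewrite fgerm1 // scale1r.
by rewrite e scaler0.
Qed.

Fact subsec_scaleDr F U : right_distributive (@subsec_scale F U) +%R.
Proof. by move=> a v w; apply: val_inj; rewrite /= scalerDr. Qed.

Fact subsec_scaleDl F U (v : subsec F U) :
  {morph (@subsec_scale F U)^~ v : a b / a + b}.
Proof. by move=> a b; apply: val_inj; rewrite /= fgermD scalerDl. Qed.

HB.instance Definition _ F U := GRing.Zmodule_isLmodule.Build (rO U)
  (subsec F U) (@subsec_scaleA F U) (@subsec_scale1 F U) (@subsec_scaleDr F U)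
  (@subsec_scaleDl F U).

Fact subsec_resP F U V (h : V `<=` U) (v : subsec F U) :
  subsec_pred F V (if pselect (V !=set0) then val v else 0).
Proof.
have /asboolP[Fv _] := subsec_valP v; apply/asboolP.
case: pselect => V0; last by split; [move=> x _; exact: sub_stalk0 | right].
by split; [move=> x /h; exact: Fv | left].
Qed.

Definition subsec_res F U V (h : V `<=` U) (v : subsec F U) : subsec F V :=
  Subsec (subsec_resP h v).

Fact subsec_res_lin F U V (h : V `<=` U) (a : rO U) (s t : subsec F U) :
  subsec_res h (a *: s + t) = rres h a *: subsec_res h s + subsec_res h t.
Proof.
apply: val_inj => /=; case: pselect => V0 /=; last by rewrite scaler0 addr0.
by rewrite fgerm_res.
Qed.

Lemma subsec_empty F U (v : subsec F U) : ~ (U !=set0) -> val v = 0.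
Proof. by have /asboolP[_ []] := subsec_valP v. Qed.

Fact subsec_is_sheaf F : is_sheaf (@subsec_res F).
Proof.
split.
- move=> U h v; apply: val_inj => /=; case: pselect => //= U0.
  by rewrite subsec_empty.
- move=> U V W h h' h'' v; apply: val_inj => /=.
  case: pselect => //= W0; case: pselect => //= -[].
  by have [x /h' Vx] := W0; exists x.
- move=> U I V h cov s t st; apply: val_inj.
  case: (pselect (U !=set0)) => [[x Ux]|U0]; last by rewrite !subsec_empty.
  have [i Vx] := cov _ Ux; have := congr1 val (st i).
  by rewrite /=; case: pselect => // -[]; exists x.
- move=> U I V h cov s ov.
  case: (pselect (U !=set0)) => [[x Ux]|U0]; last first.
    exists 0 => i; apply: val_inj => /=.
    have Vi0 : ~ (V i !=set0) by move=> [y /h Uy]; apply: U0; exists y.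
    by case: pselect => //= _; rewrite subsec_empty.
  have [i0 Vx] := cov _ Ux; have V0 : V i0 !=set0 by exists x.
  have agree i : V i !=set0 -> val (s i) = val (s i0).
    move=> Vi0; have W0 := opens_meet Vi0 V0.
    have := congr1 val (ov _ _ _ (@opensIl _ (V i) (V i0)) (@opensIr _ (V i) (V i0))).
    by rewrite /=; case: pselect.
  have tP : subsec_pred F U (val (s i0)).
    apply/asboolP; split; last by left; exists x.
    move=> y Uy; have [i Vy] := cov _ Uy.
    have /asboolP[Fs _] := subsec_valP (s i).
    by rewrite -(agree i); [exact: Fs | exists y].
  exists (Subsec tP) => i; apply: val_inj => /=.
  by case: pselect => [Vi0|Vi0] /=; [rewrite (agree i) | rewrite subsec_empty].
Qed.

Definition sheaf_of_sub F : modSheaf X :=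
  ModSheaf (@subsec_res_lin F) (subsec_is_sheaf F).

End SubOps.
End Subsheaves.

Section Modules.
Variable X : ringedSpace.
Implicit Types (U V W : opens X) (M N P : modSheaf X).

Definition locally_free (r : nat) M : Prop :=
  forall x : X, exists U (e : 'I_r -> M U), oset U x /\
    forall V (h : V `<=` U),
      (forall s : M V, exists a : 'I_r -> rO V,
        s = \sum_i a i *: mres h (e i)) /\
      (forall a : 'I_r -> rO V,
        \sum_i a i *: mres h (e i) = 0 -> forall i, a i = 0).

Definition line_bundle M : Prop := locally_free 1 M.

(* Morphisms M|_W -> N|_W; the values on open sets U not contained in W are
   irrelevant. *)
Record mhom W M N := Mhom {
  mhom_fun :> forall U, M U -> N U;
  mhom_lin : forall U, U `<=` W -> forall (a : rO U) (s t : M U),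
    mhom_fun (a *: s + t) = a *: mhom_fun s + mhom_fun t;
  mhom_res : forall U V (h : V `<=` U), U `<=` W -> forall s : M U,
    mhom_fun (mres h s) = mres h (mhom_fun s) }.

Program Definition mhom_id W M : mhom W M M := @Mhom W M M (fun U s => s) _ _.
Next Obligation. by []. Qed.
Next Obligation. by []. Qed.

Program Definition mhom_comp W M N P (g : mhom W N P) (f : mhom W M N) :
  mhom W M P := @Mhom W M P (fun U s => g U (f U s)) _ _.
Next Obligation. by move=> W M N P g f U h a s t; rewrite /= !mhom_lin. Qed.
Next Obligation. by move=> W M N P g f U V h h' s; rewrite /= !mhom_res. Qed.
End Modules.

Section Morphisms.
Variables Y X : ringedSpace.

Definition opens_preim (f : Y -> X) (cf : continuous f) (U : opens X) : opens Y :=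
  Opens ((continuousP f).1 cf _ (osetP U)).

(* smorph_local says that the homomorphisms of local rings are local. *)
Record smorph := Smorph {
  smorph_fun :> Y -> X;
  smorph_cont : continuous smorph_fun;
  sharp : forall U : opens X, {rmorphism rO U -> rO (opens_preim smorph_cont U)};
  sharp_res : forall (U V : opens X) (h : V `<=` U)
    (h' : opens_preim smorph_cont V `<=` opens_preim smorph_cont U) (a : rO U),
    sharp V (rres h a) = rres h' (sharp U a);
  smorph_local : forall (U : opens X) (a : rO U) (y : Y),
    oset U (smorph_fun y) -> unit_at (sharp U a) y ->
    unit_at a (smorph_fun y) }.

Definition spre (f : smorph) (U : opens X) : opens Y :=
  opens_preim (@smorph_cont f) U.

Definition dominant (f : smorph) : Prop := dense (range f).

(* Homomorphisms of O_X-modules M -> f_* N. *)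
Record fmodMap (f : smorph) (M : modSheaf X) (N : modSheaf Y) := FmodMap {
  fmodMap_fun :> forall U, M U -> N (spre f U);
  fmodMap_lin : forall (U : opens X) (a : rO U) (s t : M U),
    fmodMap_fun (a *: s + t) = sharp f U a *: fmodMap_fun s + fmodMap_fun t;
  fmodMap_res : forall (U V : opens X) (h : V `<=` U)
    (h' : spre f V `<=` spre f U) (s : M U),
    fmodMap_fun (mres h s) = mres h' (fmodMap_fun s) }.

(* N, together with eta : M -> f_* N, is the inverse image f^* M. *)
Definition is_pullback (f : smorph) (M : modSheaf X) (N : modSheaf Y)
    (eta : fmodMap f M N) : Prop :=
  forall (P : modSheaf Y) (theta : fmodMap f M P),
  exists h : mhom (opensT Y) N P,
    (forall U s, h _ (eta U s) = theta U s) /\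
    forall h' : mhom (opensT Y) N P,
      (forall U s, h' _ (eta U s) = theta U s) -> forall V t, h' V t = h V t.

Program Definition sharp_map (f : smorph) :
  fmodMap f (structure_sheaf X) (structure_sheaf Y) :=
  @FmodMap f (structure_sheaf X) (structure_sheaf Y) (fun U a => sharp f U a) _ _.
Next Obligation. by move=> f U a s t; rewrite /= rmorphD rmorphM. Qed.
Next Obligation. by move=> f U V h h' a; exact: sharp_res. Qed.
End Morphisms.

Section RationalPullback.
Variables (Y X : integralScheme) (f : smorph Y X).

(* The pullback of rational sections, along a dominant f. *)
Definition rat_pull (M : modSheaf X) (N : modSheaf Y) (eta : fmodMap f M N)
  (v : ratSections M) : ratSections N := germ (eta _ (rat_sec v)).

Definition fun_pull : funField X -> funField Y := rat_pull (sharp_map f).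

Hypothesis fdom : dominant f.

Lemma spre_ne (U : opens X) : U !=set0 -> spre f U !=set0.
Proof.
move=> U0; have [z [Uz [y _ e]]] := fdom U0 (osetP U).
by exists y; rewrite /= /preimage /= e.
Qed.

Lemma rat_pull_germ (M : modSheaf X) (N : modSheaf Y) (eta : fmodMap f M N)
  (U : opens X) (s : M U) : U !=set0 -> rat_pull eta (germ s) = germ (eta U s).
Proof.
move=> U0; have /(germ_eqP _ _ (rat_dom_ne _) U0)[V [h [h' [V0 e]]]] :=
  germ_sec (germ s).
have k : spre f V `<=` spre f (rat_dom (germ s)) by move=> y; exact: h.
have k' : spre f V `<=` spre f U by move=> y; exact: h'.
apply/germ_eqP; [exact/spre_ne/rat_dom_ne | exact: spre_ne |].
exists (spre f V), k, k'; split; first exact: spre_ne.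
by rewrite -(fmodMap_res eta h) -(fmodMap_res eta h') e.
Qed.

Lemma fun_pull_fgerm (U : opens X) (a : rO U) : U !=set0 ->
  fun_pull (fgerm a) = fgerm (sharp f U a).
Proof. exact: rat_pull_germ. Qed.

Lemma fun_pull1 : fun_pull 1 = 1.
Proof.
have T0 : opensT X !=set0 := ischeme_ne X.
rewrite -(fgerm1 T0) fun_pull_fgerm // rmorph1 fgerm1 //; exact: spre_ne.
Qed.

Lemma fun_pullM a b : fun_pull (a * b) = fun_pull a * fun_pull b.
Proof.
have [U [s [t [_ [U0 -> -> _]]]]] := ratW a b a.
rewrite -!/(fgerm _) -fgermM !fun_pull_fgerm // -fgermM.
by rewrite -rmorphM.
Qed.

Lemma fun_pullVK a : a != 0 -> fun_pull a^-1 * fun_pull a = 1.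
Proof. by move=> a0; rewrite -fun_pullM mulVf // fun_pull1. Qed.

Lemma fun_pull_neq0 a : a != 0 -> fun_pull a != 0.
Proof.
move=> /fun_pullVK e; apply/eqP => e0; move: e; rewrite e0 mulr0 => /esym/eqP.
by rewrite oner_eq0.
Qed.

Lemma fun_pullV a : a != 0 -> fun_pull a^-1 = (fun_pull a)^-1.
Proof.
move=> a0; apply: (mulIf (fun_pull_neq0 a0)).
by rewrite fun_pullVK // mulVf // fun_pull_neq0.
Qed.

Lemma stalk_pull y a : stalk (f y) a -> stalk y (fun_pull a).
Proof.
move=> [U [s [Uy ->]]]; exists (spre f U), (sharp f U s); split=> //.
by rewrite fun_pull_fgerm //; exists (f y).
Qed.

Lemma stalk_unit_pull y a : stalk_unit (f y) a -> stalk_unit y (fun_pull a).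
Proof.
move=> [a0 sa sa']; split; [exact: fun_pull_neq0 | exact: stalk_pull |].
by rewrite -fun_pullV //; exact: stalk_pull.
Qed.

Program Definition cartier_pull (D : cartier X) : cartier Y := @Cartier Y
  (fun y => [set s | exists t u,
     [/\ D (f y) t, stalk_unit y u & s = u * fun_pull t]]) _ _ _.
Next Obligation.
move=> D y _ [t [u [Dt [u0 _ _] ->]]].
by rewrite mulf_neq0 // fun_pull_neq0 // (eqn_neq0 Dt).
Qed.
Next Obligation.
move=> D y _ t' [t [u [Dt su ->]]]; split=> [[s [w [Ds sw ->]]]|[w sw ->]].
  have [z sz ->] := (eqn_coset _ Dt).1 Ds.
  exists (w * fun_pull z * u^-1).
    apply: stalk_unitM; last exact: stalk_unitV.
    by apply: stalk_unitM => //; exact: stalk_unit_pull.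
  by have [u0 _ _] := su; rewrite fun_pullM !mulrA mulfVK.
exists t, (w * u); split=> //; last by rewrite mulrA.
exact: stalk_unitM.
Qed.
Next Obligation.
move=> D y; have [t [U [Uy Ht]]] := eqn_open D (f y).
exists (fun_pull t), (spre f U); split=> // z Uz.
exists t, 1; split; [exact: Ht | exact: stalk_unit1 | by rewrite mul1r].
Qed.

(* F' is the inverse image f^* F, seen inside the rational sections of N = f^* M
   via the pullback of rational sections. *)
Definition sub_pullback (M : modSheaf X) (N : modSheaf Y) (eta : fmodMap f M N)
    (F : subSheaf M) (F' : subSheaf N) : Prop :=
  exists theta : fmodMap f (sheaf_of_sub F) (sheaf_of_sub F'),
    (forall U (v : subsec F U),
      subsec_val (theta U v) = rat_pull eta (subsec_val v)) /\
    is_pullback theta.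
End RationalPullback.

Section Echelon.
Variable X : integralScheme.

Section Persistence.
Variable M : modSheaf X.
Implicit Types A B C : subSheaf M.

(* For B contained in A: A/B is locally free of finite rank over O/O(-D). *)
Definition locally_free_quot (D : cartier X) A B : Prop :=
  forall x : X, exists (U : opens X) (k : nat) (e : 'I_k -> ratSections M),
    oset U x /\ forall y, oset U y ->
    [/\ forall i, A y (e i),
        forall v, A y v -> exists a : 'I_k -> funField X,
          (forall i, stalk y (a i)) /\ B y (v - \sum_i a i *: e i)
      & forall a : 'I_k -> funField X, (forall i, stalk y (a i)) ->
          (B y (\sum_i a i *: e i) <-> forall i, ideal_stalk D y (a i))].

(* For B contained in A contained in C: A/B is locally a direct summand of C/B,
   with complement Q/B. *)
Definition locally_split_quot A B C : Prop :=
  forall x : X, exists (U : opens X) (Q : subSheaf M),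
    oset U x /\ forall y, oset U y ->
    [/\ B y `<=` Q y, Q y `<=` C y, A y `&` Q y = B y & sub_add A Q y = C y].
End Persistence.

(* Only the indices 0, ..., m are relevant for data of length m. *)
Record echData (E : modSheaf X) := EchData {
  ech_sub : nat -> subSheaf E;
  ech_delta : nat -> cartier X;
  ech_D : nat -> cartier X }.

Section Data.
Variables (E : modSheaf X) (chi : echData E).

Definition ech_ddelta (i : nat) : cartier X :=
  cartierB (ech_delta chi i) (ech_delta chi i.-1).
Definition ech_dD (i : nat) : cartier X :=
  cartierB (ech_D chi i) (ech_D chi i.-1).
Definition ech_Ddag (i : nat) : cartier X :=
  cartierB (ech_delta chi i) (ech_D chi i).

(* The kernel of E^i -> E^j (x) O_(d delta_i) = E^j / E^j(- d delta_i) is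
   E^i n E^j(- d delta_i), and its image is the subsheaf
   (E^i + E^j(- d delta_i)) / E^j(- d delta_i). *)
Definition persistence (m : nat) : Prop :=
  forall i, (0 < i <= m)%N ->
    let tw F := twist F (cartierN (ech_ddelta i)) in
    sub_le (tw (ech_sub chi i.-1)) (ech_sub chi i) /\
    forall j, (j < i)%N ->
    [/\ sub_le (sub_cap (ech_sub chi i) (tw (ech_sub chi j)))
               (tw (ech_sub chi i.-1)),
        locally_free_quot (ech_ddelta i)
          (sub_add (ech_sub chi i) (tw (ech_sub chi j))) (tw (ech_sub chi j))
      & locally_split_quot
          (sub_add (ech_sub chi i) (tw (ech_sub chi j))) (tw (ech_sub chi j))
          (ech_sub chi j)].

Record is_preechelon (m : nat) : Prop := IsPreechelon {
  ech_free : exists r, locally_free r E /\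
    forall i, (i <= m)%N -> locally_free r (sheaf_of_sub (ech_sub chi i));
  ech_sub0 : forall x, ech_sub chi 0 x = sub_full E x;
  ech_chain : forall i, (i < m)%N -> sub_le (ech_sub chi i.+1) (ech_sub chi i);
  ech_delta0 : ech_delta chi 0 = cartier0 X;
  ech_ddelta_eff : forall i, (0 < i <= m)%N -> effective (ech_ddelta i);
  ech_persistence : persistence m }.

Record is_echelon (m : nat) : Prop := IsEchelon {
  ech_pre : is_preechelon m;
  ech_D0 : ech_D chi 0 = cartier0 X;
  ech_D_le : forall i, (i <= m)%N -> cartier_le (ech_D chi i) (ech_delta chi i);
  ech_dD_eff : forall i, (0 < i <= m)%N -> effective (ech_dD i);
  ech_dD_le : forall i, (0 < i <= m)%N -> cartier_le (ech_dD i) (ech_ddelta i);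
  ech_nocommon : forall i, (i <= m)%N ->
    no_common_component (ech_D chi i) (ech_Ddag i) }.

(* E_j and i |-> E_j^i. *)
Fixpoint ech_stage (j : nat) : subSheaf E * (nat -> subSheaf E) :=
  if j is j'.+1 then
    let Ej := (ech_stage j').1 in
    let Eji := (ech_stage j').2 in
    let Ej1 := sub_add (twist (Eji 1) (ech_dD j)) Ej in
    (Ej1, fun i => sub_cap (twist (Eji i.+1) (ech_ddelta j)) Ej1)
  else (sub_full E, ech_sub chi).

Definition Mod (m : nat) : subSheaf E := (ech_stage m).1.
End Data.

Record echelon (m : nat) := Echelon {
  ech_bundle : modSheaf X;
  ech_data :> echData ech_bundle;
  echelonP : is_echelon ech_data m }.

(* Homomorphisms E -> E' mapping E^i into E'^i, from a datum to one whose
   divisors have larger increments (e.g. to one with the same divisors). *)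
Record echHom (m : nat) (chi chi' : echelon m) := EchHom {
  eh_map :> mhom (opensT X) (ech_bundle chi) (ech_bundle chi');
  eh_sub : forall i, (i <= m)%N ->
    forall (U : opens X) (s : ech_bundle chi U),
      (forall x, oset U x -> ech_sub chi i x (germ s)) ->
      forall x, oset U x -> ech_sub chi' i x (germ (eh_map U s));
  eh_delta : forall i, (0 < i <= m)%N ->
    cartier_le (ech_ddelta chi i) (ech_ddelta chi' i);
  eh_D : forall i, (0 < i <= m)%N -> cartier_le (ech_dD chi i) (ech_dD chi' i) }.

Lemma cartier_le_refl (D : cartier X) : cartier_le D D.
Proof.
move=> x _ [t [t' [Dt Dt' ->]]].
have t0 := eqn_neq0 Dt; have [u su e] := (eqn_coset _ Dt).1 Dt'.
have -> : t * t' = u^-1 by rewrite -[t']invrK e invfM mulrCA divff ?mulr1.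
by have [] := stalk_unitV su.
Qed.

Lemma cartier_le_trans (D D' D'' : cartier X) :
  cartier_le D D' -> cartier_le D' D'' -> cartier_le D D''.
Proof.
move=> le1 le2 x _ [t'' [s [Dt'' Ds ->]]]; have [t' Dt'] := eqn_ex D' x.
have -> : t'' * s = (t'' * t'^-1) * (t' * s).
  by rewrite mulrA divfK // (eqn_neq0 Dt').
apply: stalkM; [apply: le2; exists t'', t'^-1 | apply: le1; exists t', s].
  by split=> //; rewrite /= invrK.
by split.
Qed.

Program Definition echHom_id (m : nat) (chi : echelon m) : echHom chi chi :=
  @EchHom m chi chi (mhom_id (opensT X) (ech_bundle chi)) _ _ _.
Next Obligation. by []. Qed.
Next Obligation. by move=> m chi i _; exact: cartier_le_refl. Qed.
Next Obligation. by move=> m chi i _; exact: cartier_le_refl. Qed.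

Program Definition echHom_comp (m : nat) (chi1 chi2 chi3 : echelon m)
    (h : echHom chi2 chi3) (g : echHom chi1 chi2) : echHom chi1 chi3 :=
  @EchHom m chi1 chi3 (mhom_comp h g) _ _ _.
Next Obligation.
move=> m c1 c2 c3 h g i im U s Hs; apply: eh_sub => //; exact: eh_sub.
Qed.
Next Obligation.
move=> m c1 c2 c3 h g i im.
exact: cartier_le_trans (eh_delta g im) (eh_delta h im).
Qed.
Next Obligation.
move=> m c1 c2 c3 h g i im.
exact: cartier_le_trans (eh_D g im) (eh_D h im).
Qed.

(* phi maps E^i into L(- D_i), over the open set W. *)
Definition ech_compatible (E : modSheaf X) (chi : echData E) (m : nat)
    (W : opens X) (L : modSheaf X) (phi : mhom W E L) : Prop :=
  forall i, (i <= m)%N -> forall (U : opens X) (s : E U), U `<=` W ->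
    (forall x, oset U x -> ech_sub chi i x (germ s)) ->
    forall x, oset U x ->
      twist (sub_full L) (cartierN (ech_D chi i)) x (germ (phi U s)).

(* h restricts to phi on E, for E contained in E'. *)
Definition extends (E : modSheaf X) (W : opens X) (L : modSheaf X)
    (phi : mhom W E L) (E' : subSheaf E)
    (h : mhom W (sheaf_of_sub E') L) : Prop :=
  forall (U : opens X) (s : E U) (v : subsec E' U), U `<=` W ->
    subsec_val v = germ s -> h U v = phi U s.
End Echelon.

(* chi' = f^* chi, as a datum on F = f^* E. *)
Record ech_pullback (Y X : integralScheme) (f : smorph Y X) (fdom : dominant f)
    (E : modSheaf X) (F : modSheaf Y) (eta : fmodMap f E F) (m : nat)
    (chi : echData E) (chi' : echData F) : Prop := EchPullback {
  ech_pull_sub : forall i, (i <= m)%N ->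
    sub_pullback eta (ech_sub chi i) (ech_sub chi' i);
  ech_pull_delta : forall i, (i <= m)%N ->
    ech_delta chi' i = cartier_pull fdom (ech_delta chi i);
  ech_pull_D : forall i, (i <= m)%N ->
    ech_D chi' i = cartier_pull fdom (ech_D chi i) }.

(* Main.v *)
From HB Require Import structures.
Require Import Defs.
From mathcomp Require Import all_boot all_algebra ring.
From mathcomp Require Import all_classical.
From mathcomp Require Import topology_structure.

(* Near any point, E has a basis e_k with levels c_k such that E^i is spanned by
   the multiples of e_k by the product of the local equations t_l of d delta_l
   over c_k < l <= i. It is built one step of the chain at a time: by
   persistence, generators of E^i modulo E^(i-1)(- d delta_i) are independent in
   the fibre of E, so they can be exchanged for basis vectors.

   Write Y_i, X_i for the local equations of D_i and of its complement
   delta_i - D_i. They have no common component, so Y_i q and X_i q can both be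
   regular only if q is; hence E_j is spanned by the e_k / Y_(min (j, c_k)), so
   that Mod is free on the e_k / Y_(c_k) and is the sum of the E^i(D_i).
   Functoriality and the extension of phi follow from this description, and
   maximality by applying the hypothesis to the functionals Y_(c_k) e_k^*. A
   pullback of a locally free sheaf has the pulled back local bases, so the
   description is compatible with dominant base change. *)

Set Implicit Arguments.
Unset Strict Implicit.
Unset Printing Implicit Defensive.

Import GRing.Theory.
Local Open Scope classical_set_scope.
Local Open Scope ring_scope.

(** * Coordinates and local rings *)

(** Persistence speaks only of quotients modulo [d delta_i]. At a point where [t_i] is a unit it is
    empty, but there [E^i] and [E^(i-1)] coincide; elsewhere it places [E^i] inside the fibre of
    [E]. Hence bases are first built over one local ring, with a case distinction on [t_i], and
    spread to a neighbourhood only at the end. An exchange does not spoil the earlier members of the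
    chain: the pivot coordinate is a unit divisible by the weight of the replaced vector, so that
    weight is a unit.

    Components are weakly associated points and nothing is noetherian, so the common component that
    rules out a nonregular quotient comes from a minimal prime found by Zorn's lemma.

    Inverse images are known only by their universal property. Two facts link it to bases: an
    inverse image carries a basis to a basis, and a map doing so locally is an inverse image. A
    dominant map need not be flat, so persistence, which concerns kernels and images, is not pulled
    back directly; it is recovered from the pulled back frames. *)

Section Coordinates.
Variables (K : fieldType) (V : lmodType K).

(** A basis is carried together with its coordinate functionals because every lattice below is
    described by divisibility conditions on coordinates. *)
Record dual_basis r (e : 'I_r -> V) (co : 'I_r -> V -> K) : Prop := DualBasis {
  co_lin : forall k a v w, co k (a *: v + w) = a * co k v + co k w;
  coE : forall v, v = \sum_k co k v *: e k;
  co_dual : forall k l, co k (e l) = (k == l)%:R }.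

Section Theory.
Variables (r : nat) (e : 'I_r -> V) (co : 'I_r -> V -> K).
Hypothesis B : dual_basis e co.

Lemma coD k v w : co k (v + w) = co k v + co k w.
Proof. by rewrite -[v]scale1r (co_lin B) mul1r scale1r. Qed.

Lemma co0 k : co k 0 = 0.
Proof. by apply: (@addrI _ (co k 0)); rewrite -coD !addr0. Qed.

Lemma coZ k a v : co k (a *: v) = a * co k v.
Proof. by rewrite -[a *: v]addr0 (co_lin B) co0 addr0. Qed.

Lemma coB k v w : co k (v - w) = co k v - co k w.
Proof. by rewrite -scaleN1r coD coZ mulN1r. Qed.

Lemma co_sum k n (v : 'I_n -> V) (P : pred 'I_n) :
  co k (\sum_(i | P i) v i) = \sum_(i | P i) co k (v i).
Proof. by apply: (big_morph (co k)); [exact: coD | exact: co0]. Qed.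

Lemma co_sumE k a : co k (\sum_l a l *: e l) = a k.
Proof.
rewrite co_sum (bigD1 k) //= coZ (co_dual B) eqxx mulr1 big1 ?addr0 // => l lk.
by rewrite coZ (co_dual B) eq_sym (negPf lk) mulr0.
Qed.

Lemma co_diagE k a (w : 'I_r -> K) :
  co k (\sum_l a l *: (w l *: e l)) = a k * w k.
Proof.
rewrite -(co_sumE k (fun l => a l * w l)); congr (co k _).
by apply: eq_bigr => l _; rewrite scalerA.
Qed.

Lemma co_inj v w : (forall k, co k v = co k w) -> v = w.
Proof. by move=> h; rewrite (coE B v) (coE B w); apply: eq_bigr => k _; rewrite h. Qed.

(** Steinitz exchange: the new coordinates come from solving the expansion of [g] for [e k0]. The
    only denominator is [co k0 g], so the change of basis is integral in both directions once [g]
    has integral coordinates and this one is a unit. *)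
Lemma basis_exchange g k0 : co k0 g != 0 ->
  dual_basis (fun k => if k == k0 then g else e k)
    (fun k v => if k == k0 then co k0 v / co k0 g
                else co k v - co k g * (co k0 v / co k0 g)).
Proof.
move=> g0; split.
- move=> k a v w; case: eqP => _; rewrite !(co_lin B); first by field.
  by field.
- move=> v; apply: co_inj => k; rewrite co_sum (bigD1 k0) //= eqxx coZ.
  have [->|kk0] := eqVneq k k0.
    rewrite divfK // big1 ?addr0 // => l lk.
    by rewrite (negPf lk) coZ (co_dual B) eq_sym (negPf lk) mulr0.
  rewrite (bigD1 k) //= (negPf kk0) coZ (co_dual B) eqxx mulr1 big1 => [|l].
    by field.
  case/andP=> lk0 lk; rewrite (negPf lk0) coZ (co_dual B).
  by rewrite eq_sym (negPf lk) mulr0.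
- move=> k l; have [kk0|kk0] := boolP (k == k0);
    have [lk0|lk0] := boolP (l == k0).
  + by rewrite (eqP kk0) (eqP lk0) eqxx divff.
  + by rewrite (eqP kk0) (co_dual B) eq_sym (negPf lk0) mul0r.
  + by rewrite (eqP lk0) (negPf kk0) divff // mulr1 subrr.
  + by rewrite !(co_dual B) [k0 == l]eq_sym (negPf lk0) mul0r mulr0 subr0.
Qed.
End Theory.

Lemma basis_free_span r (e : 'I_r -> V) :
  (forall v, exists a : 'I_r -> K, v = \sum_k a k *: e k) ->
  (forall a : 'I_r -> K, \sum_k a k *: e k = 0 -> forall k, a k = 0) ->
  exists co, dual_basis e co.
Proof.
move=> /choice[f fE] free; exists (fun k v => f v k).
have uniq a b : \sum_k a k *: e k = \sum_k b k *: e k -> forall k, a k = b k.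
  move=> /eqP; rewrite -subr_eq0 -sumrB => /eqP h k; apply/eqP.
  rewrite -subr_eq0; apply/eqP; apply: (free (fun k => a k - b k)).
  by rewrite -[RHS]h; apply: eq_bigr => l _; rewrite scalerBl.
split=> [k a v w|//|k l].
  apply: (uniq _ (fun k => a * f v k + f w k)); rewrite -fE {1}(fE v) {1}(fE w).
  by rewrite scaler_sumr -big_split; apply: eq_bigr => l _;
    rewrite scalerDl scalerA.
apply: (uniq _ (fun k => (k == l)%:R)); rewrite -fE (bigD1 l) //= eqxx scale1r.
by rewrite big1 ?addr0 // => k' /negPf ->; rewrite scale0r.
Qed.
End Coordinates.

(** * Products of local equations between two levels *)

Section Gap.
Variables (K : fieldType) (t : nat -> K).

(* The coefficient in E^j of a basis vector lying in E^c but in no smaller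
   member of the chain. *)
Definition gap (c j : nat) : K := \prod_(c.+1 <= l < j.+1) t l.

Lemma gapS c j : gap c j.+1 = if (c <= j)%N then gap c j * t j.+1 else 1.
Proof.
rewrite /gap; case: leqP => cj; first by rewrite big_nat_recr.
by rewrite big_geq.
Qed.

Lemma gap_geq c j : (j <= c)%N -> gap c j = 1.
Proof. by move=> jc; rewrite /gap big_geq. Qed.

Lemma gapM c j i : (c <= j)%N -> (j <= i)%N -> gap c i = gap c j * gap j i.
Proof. by move=> cj ji; rewrite /gap -big_cat_nat. Qed.

Lemma gap_ind (P : K -> Prop) m c j : P 1 -> (forall a b, P a -> P b -> P (a * b)) ->
  (forall i, (0 < i <= m)%N -> P (t i)) -> (j <= m)%N -> P (gap c j).
Proof.
move=> P1 PM Pt jm; rewrite /gap big_nat_cond.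
elim/big_ind: _ => // i; rewrite andbT ltnS => /andP[ci ij]; apply: Pt.
by rewrite (leq_ltn_trans _ ci) //= (leq_trans ij).
Qed.
End Gap.

(** * Local subrings of a field *)

Section LocalAlgebra.
Variables (K : fieldType) (R : set K).

Record is_subring : Prop := IsSubring {
  subring1 : R 1;
  subringB : forall a b, R a -> R b -> R (a - b);
  subringM : forall a b, R a -> R b -> R (a * b) }.

Definition subunit (u : K) : Prop := [/\ u != 0, R u & R u^-1].
Definition nonunit (a : K) : Prop := R a /\ ~ subunit a.
Definition is_local : Prop :=
  is_subring /\ forall a b, nonunit a -> nonunit b -> nonunit (a + b).

Section Subring.
Hypothesis RS : is_subring.

Lemma subring0 : R 0.
Proof. by rewrite -(subrr 1); apply: subringB => //; exact: subring1. Qed.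
Lemma subringN a : R a -> R (- a).
Proof. by move=> Ra; rewrite -sub0r; apply: subringB => //; exact: subring0. Qed.
Lemma subringD a b : R a -> R b -> R (a + b).
Proof. by move=> Ra Rb; rewrite -[b]opprK; apply/subringB/subringN. Qed.
Lemma subring_nat n : R n%:R.
Proof.
elim: n => [|n IHn]; first exact: subring0.
by rewrite -addn1 natrD; apply: subringD => //; exact: subring1.
Qed.
Lemma subring_sum n (a : 'I_n -> K) (P : pred 'I_n) :
  (forall i, P i -> R (a i)) -> R (\sum_(i | P i) a i).
Proof.
by move=> Ra; elim/big_ind: _ => //; [exact: subring0 | exact: subringD].
Qed.
Lemma subunit1 : subunit 1.
Proof. by split; rewrite ?invr1 ?oner_neq0 //; exact: subring1. Qed.
Lemma subunit_factor a b : R a -> R b -> subunit (a * b) -> subunit a.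
Proof.
move=> Ra Rb [ab0 _ Rab]; have := ab0; rewrite mulf_eq0 negb_or => /andP[a0 b0].
split=> //; have -> : a^-1 = (a * b)^-1 * b by field; rewrite a0 b0.
exact: subringM.
Qed.
Lemma nonunitM a b : R a -> nonunit b -> nonunit (a * b).
Proof.
move=> Ra [Rb nb]; split; first exact: subringM.
by rewrite mulrC => /(subunit_factor Rb Ra).
Qed.
Lemma nonunit0 : nonunit 0.
Proof. by split; [exact: subring0 | case; rewrite eqxx]. Qed.
End Subring.
End LocalAlgebra.

(** * Adapted bases *)

Section AdaptedBasis.
Variables (K : fieldType) (R : set K) (V : lmodType K).
Hypothesis RL : is_local R.
Let RS : is_subring R := RL.1.

Record is_submod (S : set V) : Prop := IsSubmod {
  submod0 : S 0;
  submodD : forall v w, S v -> S w -> S (v + w);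
  submodZ : forall a v, R a -> S v -> S (a *: v) }.

Lemma submod_sum S n (v : 'I_n -> V) (P : pred 'I_n) : is_submod S ->
  (forall i, P i -> S (v i)) -> S (\sum_(i | P i) v i).
Proof.
by move=> HS Sv; elim/big_ind: _ => //; [exact: submod0 | exact: submodD].
Qed.

Lemma submodB S v w : is_submod S -> S v -> S w -> S (v - w).
Proof.
move=> HS Sv Sw; rewrite -scaleN1r; apply: submodD => //; apply: submodZ => //.
by apply: subringN => //; exact: subring1.
Qed.

Definition adapted (E : nat -> set V) (t : nat -> K) i r (e : 'I_r -> V)
    (co : 'I_r -> V -> K) (c : 'I_r -> nat) : Prop :=
  [/\ dual_basis e co, forall k, (c k <= i)%N &
  forall j, (j <= i)%N -> forall v,
    E j v <-> forall k, R ((gap t (c k) j)^-1 * co k v)].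

Lemma lattice_submod r (e : 'I_r -> V) co (w : 'I_r -> K) : dual_basis e co ->
  is_submod [set v | forall k, R (w k * co k v)].
Proof.
move=> B; split=> [k|v v' Sv Sv' k|a v Ra Sv k].
- by rewrite (co0 B) mulr0; exact: subring0.
- by rewrite (coD B) mulrDr; exact: subringD.
- by rewrite (coZ B) mulrCA; exact: subringM.
Qed.

(** * One step of the chain at one point, from [E^i] to [E^(i+1)] *)

Section Step.
Variables (E : nat -> set V) (t : nat -> K) (i r : nat).
Let T := t i.+1.
(** With [B = T E^0], the quotient [A / B] is the image of [E^(i+1)] in [E^0 / T E^0]. The
    hypotheses below are persistence for this image: [inj] identifies the kernel, [g0] is a basis
    over [R / T], and [Q / B] is a complement. *)
Let A := [set v | exists v1 v2, [/\ E i.+1 v1, E 0%N (T^-1 *: v2) & v = v1 + v2]].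
Let B := [set v | E 0%N (T^-1 *: v)].

Hypothesis ES : forall j, is_submod (E j).
Hypothesis t_neq0 : forall l, (0 < l <= i.+1)%N -> t l != 0.
Hypothesis Rt : forall l, (0 < l <= i.+1)%N -> R (t l).
Hypothesis chain : E i.+1 `<=` E i.
Hypothesis tE : forall v, E i v -> E i.+1 (T *: v).
Hypothesis inj : forall v, E i.+1 v -> B v -> E i (T^-1 *: v).
Variables (n : nat) (g0 : 'I_n -> V).
Hypothesis Ag0 : forall l, A (g0 l).
Hypothesis gen0 : forall v, A v -> exists a : 'I_n -> K,
  (forall l, R (a l)) /\ B (v - \sum_l a l *: g0 l).
Hypothesis free0 : forall a : 'I_n -> K, (forall l, R (a l)) ->
  B (\sum_l a l *: g0 l) -> forall l, R (T^-1 * a l).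
Variable Q : set V.
Hypothesis QS : is_submod Q.
Hypothesis AQ : A `&` Q = B.
Hypothesis AQE : forall v, E 0%N v -> exists v1 v2, [/\ A v1, Q v2 & v = v1 + v2].

Let T0 : T != 0. Proof. by apply: t_neq0; rewrite /= leqnn. Qed.
Let RT : R T. Proof. by apply: Rt; rewrite /= leqnn. Qed.

Lemma step_B_submod : is_submod B.
Proof.
split=> [|v w Bv Bw|a v Ra Bv]; rewrite /B /= ?scaler0; first exact: submod0.
  by rewrite scalerDr; exact: submodD.
by rewrite scalerA mulrC -scalerA; exact: submodZ.
Qed.

Lemma step_A_submod : is_submod A.
Proof.
have BS := step_B_submod.
split=> [|_ _ [v1 [v2 [h1 h2 ->]]] [w1 [w2 [k1 k2 ->]]]|a _ Ra [v1 [v2 [h1 h2 ->]]]].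
- by exists 0, 0; rewrite scaler0 addr0; split => //; exact: submod0.
- exists (v1 + w1), (v2 + w2); split; rewrite 1?addrACA //; first exact: submodD.
  exact: (submodD BS).
- exists (a *: v1), (a *: v2); split; rewrite ?scalerDr //; first exact: submodZ.
  exact: (submodZ BS).
Qed.

(** Dropping the component in [B] of each [g0 l] leaves its class unchanged and gives a vector of
    [E^(i+1)] itself, as a basis vector of level [i.+1] has to be. *)
Lemma step_lift : exists g : 'I_n -> V, [/\ forall l, E i.+1 (g l),
  forall v, A v -> exists a : 'I_n -> K,
    (forall l, R (a l)) /\ B (v - \sum_l a l *: g l)
  & forall a : 'I_n -> K, (forall l, R (a l)) ->
    B (\sum_l a l *: g l) -> forall l, R (T^-1 * a l)].
Proof.
have BS := step_B_submod.
have /choice[g gP] : forall l, exists v, E i.+1 v /\ B (g0 l - v).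
  by move=> l; have [v1 [v2 [h1 h2 e]]] := Ag0 l; exists v1; rewrite e addrC addKr.
have sumB (a : 'I_n -> K) : (forall l, R (a l)) ->
  B (\sum_l a l *: g0 l - \sum_l a l *: g l).
  move=> Ra; rewrite -sumrB; apply: submod_sum => // l _; rewrite -scalerBr.
  by apply: submodZ => //; have [] := gP l.
exists g; split=> [l|v Av|a Ra Bg]; first by have [] := gP l.
  have [a [Ra Ba]] := gen0 Av; exists a; split=> //.
  rewrite -[v](subrK (\sum_l a l *: g0 l)) -addrA.
  by apply: submodD => //; exact: sumB.
apply: free0 => //; rewrite -[X in B X](subrK (\sum_l a l *: g l)).
by apply: submodD => //; exact: sumB.
Qed.

(** Where [T] is invertible, [E^(i+1)] and [E^i] coincide, so no level rises: the new factor in each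
    [gap] is a unit. *)
Lemma step_unit (e : 'I_r -> V) co c : subunit R T -> adapted E t i e co c ->
  adapted E t i.+1 e co c.
Proof.
move=> [_ _ RT'] [Be ci H]; split=> // [k|j]; first exact: leqW.
rewrite leq_eqVlt ltnS => /orP[/eqP ->|/H //] v.
have -> : E i.+1 v <-> E i v.
  split=> [|Ev]; first exact: chain.
  by rewrite -[v]scale1r -(mulVf T0) -scalerA; apply: submodZ => //; exact: tE.
rewrite H //; split=> h k; have := h k; rewrite gapS ci invfM.
  by move=> h'; rewrite mulrAC; exact: subringM.
move=> h'; have -> : (gap t (c k) i)^-1 * co k v =
  T * ((gap t (c k) i)^-1 * T^-1 * co k v).
  by rewrite [_ * T^-1]mulrC -mulrA mulVKf.
exact: subringM.
Qed.

Section NonUnit.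
Hypothesis NT : nonunit R T.
Variable g : 'I_n -> V.
Hypothesis Eg : forall l, E i.+1 (g l).
Hypothesis gen : forall v, A v -> exists a : 'I_n -> K,
    (forall l, R (a l)) /\ B (v - \sum_l a l *: g l).
Hypothesis free : forall a : 'I_n -> K, (forall l, R (a l)) ->
    B (\sum_l a l *: g l) -> forall l, R (T^-1 * a l).

Let A_g l : A (g l).
Proof.
by exists (g l), 0; rewrite scaler0 addr0; split => //; exact: submod0.
Qed.

(* The stage of the exchange at which the first s of the g's have been put into
   the basis, with level i.+1. *)
Definition exchanged s (e : 'I_r -> V) co c : Prop :=
  [/\ dual_basis e co, forall k, (c k <= i.+1)%N,
  forall j, (j <= i)%N -> forall v,
    E j v <-> forall k, R ((gap t (c k) j)^-1 * co k v),
  forall k, c k = i.+1 -> exists2 l : 'I_n, (l < s)%N & e k = g l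
  & forall l : 'I_n, (l < s)%N -> exists2 k, c k = i.+1 & e k = g l].

Let gap_neq0 c j : (j <= i)%N -> gap t c j != 0.
Proof.
move=> ji; apply: (@gap_ind _ t (fun x => x != 0) i.+1); rewrite ?oner_eq0 ?leqW //.
by move=> a b; exact: mulf_neq0.
Qed.

Let R_gap c j : (j <= i)%N -> R (gap t c j).
Proof.
move=> ji; apply: (@gap_ind _ t R i.+1); rewrite ?leqW //.
  exact: subring1.
by move=> a b; exact: subringM.
Qed.

(** Otherwise the next [g] would be, up to the span of the [g]'s already used, in the maximal ideal
    times [E^0]. As [A / B] is a direct summand of [E^0 / B], it would then be in the maximal ideal
    times [A / B] up to that span, against the independence of the [g]'s. *)
Lemma exchange_pivot s e co c (hs : (s < n)%N) : exchanged s e co c ->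
  exists2 k, (c k <= i)%N & subunit R (co k (g (Ordinal hs))).
Proof.
move=> [Be ci HE done _]; set gs := g _; apply: contrapT => no.
have BS := step_B_submod; have AS := step_A_submod.
have E0e k : E 0%N (e k).
  apply/HE => // l; rewrite (co_dual Be) gap_geq // invr1 mul1r.
  exact: subring_nat.
have Rco k : R (co k gs).
  have /HE h : E i gs by apply/chain/Eg.
  have := h (leqnn i) k; case: (leqP (c k) i) => ck h'.
    have -> : co k gs = gap t (c k) i * ((gap t (c k) i)^-1 * co k gs).
      by rewrite mulVKf // gap_neq0.
    by apply: subringM => //; exact: R_gap.
  by move: h'; rewrite gap_geq ?invr1 ?mul1r // ltnW.
(* Vectors which, modulo [B], are combinations of the [g]'s with a nonunit coefficient on [gs]. The
   contradiction comes from [gs] being one of them. *)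
pose S := [set v | exists a : 'I_n -> K, [/\ forall l, R (a l),
  nonunit R (a (Ordinal hs)) & B (v - \sum_l a l *: g l)]].
have SS : is_submod S.
  split=> [|v w [a [Ra na Ba]] [b [Rb nb Bb]]|x v Rx [a [Ra na Ba]]].
  - exists (fun=> 0); split=> [l||]; [exact: subring0 | exact: nonunit0 |].
    by rewrite big1 ?subr0 => [|l _]; rewrite ?scale0r //; exact: submod0.
  - exists (fun l => a l + b l); split=> [l||]; first exact: subringD.
      exact: RL.2.
    under eq_bigr do rewrite scalerDl.
    by rewrite big_split opprD addrACA; exact: submodD.
  - exists (fun l => x * a l); split=> [l||]; first exact: subringM.
      exact: nonunitM.
    under eq_bigr do rewrite -scalerA.
    by rewrite -scaler_sumr -scalerBr; exact: submodZ.
have BSub : B `<=` S.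
  move=> v Bv; exists (fun=> 0); split=> [l||]; [exact: subring0 | exact: nonunit0 |].
  by rewrite big1 ?subr0 => [|l _]; rewrite ?scale0r.
have nonunitA x v : nonunit R x -> A v -> S (x *: v).
  move=> nx /gen[a [Ra Ba]]; exists (fun l => x * a l); split=> [l||].
  - by apply: subringM => //; exact: nx.1.
  - by rewrite mulrC; exact: nonunitM.
  - under eq_bigr do rewrite -scalerA.
    by rewrite -scaler_sumr -scalerBr; apply: submodZ => //; exact: nx.1.
have Sg (l : 'I_n) : (l < s)%N -> S (g l).
  move=> ls; exists (fun l' => (l' == l)%:R); split=> [l'||].
  - exact: subring_nat.
  - have -> : Ordinal hs == l = false by apply/eqP => el; rewrite -el /= ltnn in ls.
    exact: nonunit0.
  - rewrite (bigD1 l) //= eqxx scale1r big1 => [|l' /negPf ->].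
      by rewrite addr0 subrr; exact: submod0.
    by rewrite scale0r.
have /choice[al /choice[q alq]] : forall k, exists v1 v2,
  [/\ A v1, Q v2 & e k = v1 + v2] by move=> k; exact: AQE.
have [a [Ra na Ba]] : S gs.
  pose w := \sum_(k | (c k <= i)%N) co k gs *: q k.
  pose z := \sum_(k | (c k <= i)%N) co k gs *: al k.
  pose d := \sum_(k | ~~ (c k <= i)%N) co k gs *: e k.
  (* [d] is the part on the vectors already exchanged; [z] and [w] are the components in [A] and [Q]
     of the rest. Since [w] is also [gs - d - z], it lies in [A] and in [Q], hence in [B]. *)
  have gsE : gs = d + z + w.
    rewrite [LHS](coE Be) (bigID (fun k => c k <= i)%N) /= addrC -addrA.
    congr (_ + _); rewrite /z /w -big_split; apply: eq_bigr => k _.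
    by have [_ _ ->] := alq k; rewrite scalerDr.
  have nco k : (c k <= i)%N -> nonunit R (co k gs).
    by move=> ck; split=> // u; apply: no; exists k.
  have done' k : ~~ (c k <= i)%N -> exists2 l : 'I_n, (l < s)%N & e k = g l.
    by rewrite -ltnNge => ck; apply: done; apply/anti_leq; rewrite ci.
  have Aw : A w.
    have -> : w = gs - d - z by rewrite gsE -addrA -opprD addrC addKr.
    apply: submodB => //; first apply: submodB => //; first exact: A_g.
      apply: submod_sum => // k /done'[l _ ->]; apply: submodZ => //.
    apply: submod_sum => // k _; apply: submodZ => //.
    by have [] := alq k.
  have Qw : Q w.
    by apply: submod_sum => // k _; apply: submodZ => //; have [] := alq k.
  rewrite gsE; apply: submodD => //; first apply: submodD => //.
  - by apply: submod_sum => // k /done'[l ls ->]; apply: submodZ => //; exact: Sg.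
  - apply: submod_sum => // k /nco nk; apply: nonunitA => //.
    by have [] := alq k.
  - by apply: BSub; rewrite -AQ.
(* Now [gs] has two expressions modulo [B], with coefficients 1 and [a (Ordinal hs)] on itself.
   Freeness makes their difference a multiple of the nonunit [T], so 1 would be a sum of two
   nonunits. *)
have R1 : R (T^-1 * (1 - a (Ordinal hs))).
  have := @free (fun l => (l == Ordinal hs)%:R - a l).
  move=> /(_ _ _ (Ordinal hs)); rewrite eqxx; apply.
    by move=> l; apply: subringB => //; exact: subring_nat.
  under eq_bigr do rewrite scalerBl.
  rewrite sumrB (bigD1 (Ordinal hs)) //= eqxx scale1r.
  rewrite [X in _ + X - _]big1 ?addr0 // => l /negPf ->.
  by rewrite scale0r.
have n1 : nonunit R (1 - a (Ordinal hs)).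
  rewrite -[1 - _](mulVKf T0) mulrC; exact: nonunitM.
have := RL.2 _ _ n1 na; rewrite subrK => -[_]; apply; exact: subunit1.
Qed.

(** Raising the pivot to level [i.+1] turns its weight in [E j], for [j <= i], from [gap t (c k0) j]
    into 1. The lattice is the same because [gs] lies in [E i], which forces this weight to divide
    the unit [co k0 gs]. *)
Lemma exchange_next s e co c (hs : (s < n)%N) : exchanged s e co c ->
  exists (e' : 'I_r -> V) co' c', exchanged s.+1 e' co' c'.
Proof.
move=> ex; have [k0 ck0 uk0] := exchange_pivot hs ex.
have [Be ci HE done done'] := ex; set gs := g _ in uk0.
have [cg0 Rg Rg'] := uk0; have Be' := basis_exchange Be cg0.
exists (fun k => if k == k0 then gs else e k),
  (fun k v => if k == k0 then co k0 v / co k0 gs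
              else co k v - co k gs * (co k0 v / co k0 gs)),
  (fun k => if k == k0 then i.+1 else c k); split; first exact: Be'.
- by move=> k; case: eqP.
- move=> j ji v.
  have Ri j' : (j' <= i)%N -> R ((gap t (c k0) j')^-1 * co k0 gs).
    move=> j'i; have /HE h : E i gs by apply/chain/Eg.
    have := h (leqnn i) k0 => {}h; case: (leqP (c k0) j') => cj; last first.
      by rewrite gap_geq ?invr1 ?mul1r // ltnW.
    have -> : (gap t (c k0) j')^-1 * co k0 gs =
       gap t j' i * ((gap t (c k0) i)^-1 * co k0 gs).
      by rewrite (gapM _ cj j'i); field; rewrite !gap_neq0.
    by apply: subringM => //; exact: R_gap.
  have Rj k : R ((gap t (c k) j)^-1 * co k gs).
    have /HE h : E i gs by apply/chain/Eg.
    have := h (leqnn i) k => {}h; case: (leqP (c k) j) => cj; last first.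
      have := h; have [cki|cki] := leqP (c k) i; last first.
        by rewrite !gap_geq // ltnW.
      move=> h'; rewrite gap_geq ?(ltnW cj) // invr1 mul1r.
      by rewrite -[co k gs](mulVKf (gap_neq0 (c k) (leqnn i)));
        apply: subringM => //; exact: R_gap.
    have -> : (gap t (c k) j)^-1 * co k gs =
       gap t j i * ((gap t (c k) i)^-1 * co k gs).
      by rewrite (gapM _ cj ji); field; rewrite !gap_neq0.
    by apply: subringM => //; exact: R_gap.
  (* p^-1 (co g) is integral and co g is a unit, so p is a unit. *)
  have Rp : R (gap t (c k0) j)^-1.
    rewrite -[X in R X](mulfK cg0); apply: subringM => //; exact: Ri.
  rewrite HE //; split=> h k.
    have [_|kk0] := eqVneq k k0.
      rewrite gap_geq ?leqW // invr1 mul1r; apply: subringM => //.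
      rewrite -[co k0 v](mulVKf (gap_neq0 (c k0) ji)).
      by apply: subringM => //; exact: R_gap.
    rewrite mulrBr; apply: subringB => //.
    rewrite (mulrA _ (co k gs)); apply: subringM => //; apply: subringM => //.
    rewrite -[co k0 v](mulVKf (gap_neq0 (c k0) ji)).
    by apply: subringM => //; exact: R_gap.
  have h0 : R (co k0 v / co k0 gs).
    by have := h k0; rewrite eqxx gap_geq ?leqW // invr1 mul1r.
  have [->|kk0] := eqVneq k k0.
    rewrite -[co k0 v](divfK cg0); apply: subringM => //.
    exact: subringM.
  have := h k; rewrite (negPf kk0) => hk.
  have -> : (gap t (c k) j)^-1 * co k v =
    (gap t (c k) j)^-1 * (co k v - co k gs * (co k0 v / co k0 gs)) +
    (gap t (c k) j)^-1 * co k gs * (co k0 v / co k0 gs).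
    by field; rewrite cg0 gap_neq0.
  by apply: subringD => //; exact: subringM.
- move=> k; case: eqP => [_ _|_ /done[l ls ->]]; first by exists (Ordinal hs).
  by exists l => //; exact: ltnW.
- move=> l; rewrite ltnS leq_eqVlt => /orP[/eqP ls|/done'[k ck ek]].
    by exists k0; rewrite eqxx //; congr g; exact: val_inj.
  exists k; case: eqP => kk0 //; by rewrite kk0 in ck; rewrite ck ltnn in ck0.
Qed.

(** After all [n] exchanges, a vector of [E^(i+1)] is a combination of the [g]'s plus a remainder in
    both [E^(i+1)] and [B], which lies in [T E^i] by [inj]. Hence the factor [T] on vectors of level
    at most [i], and no factor on the [g]'s. *)
Lemma step_nonunit (e : 'I_r -> V) co c : adapted E t i e co c ->
  exists (e' : 'I_r -> V) co' c', adapted E t i.+1 e' co' c'.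
Proof.
move=> [Be ci HE].
have [e' [co' [c' [Be' ci' HE' done done']]]] :
    exists (e' : 'I_r -> V) co' c', exchanged n e' co' c'.
  have : (n <= n)%N by []; move: {1 3}n; elim=> [_|s IH sn].
    exists e, co, c; split=> // [k|k ck]; first exact: leqW.
    by have := ci k; rewrite ck ltnn.
  have [e' [co' [c' ex]]] := IH (ltnW sn); exact: (exchange_next sn ex).
exists e', co', c'; split=> // j.
rewrite leq_eqVlt ltnS => /orP[/eqP ->|/HE' //] v.
pose S := [set v | forall k, R ((gap t (c' k) i.+1)^-1 * co' k v)].
have SS : is_submod S by exact: (lattice_submod _ Be').
have gapT k : gap t (c' k) i.+1 = if (c' k <= i)%N then gap t (c' k) i * T else 1.
  exact: gapS.
split=> [Ev|h].
  rewrite -/(S v).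
  have [a [Ra Ba]] : exists a : 'I_n -> K,
      (forall l, R (a l)) /\ B (v - \sum_l a l *: g l).
    by apply: gen; exists v, 0; rewrite scaler0 addr0; split => //; exact: submod0.
  rewrite -[v](subrK (\sum_l a l *: g l)); apply: (submodD SS) => //.
    have : E i (T^-1 *: (v - \sum_l a l *: g l)).
      apply: inj => //; apply: submodB => //; apply: submod_sum => // l _.
      by apply: submodZ.
    move: (v - _) => w /HE'-/(_ (leqnn i)) h k.
    have := h k; rewrite (coZ Be') gapT; case: leqP => ck h'.
      by rewrite invfM -mulrA.
    rewrite gap_geq ?(ltnW ck) // invr1 mul1r in h'.
    rewrite invr1 mul1r -[co' k w](mulVKf T0); exact: subringM.
  apply: (submod_sum SS) => l _; apply: (submodZ SS) => // k.
  have [k1 ck1 <-] := done' l (ltn_ord l); rewrite (co_dual Be').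
  have [kk|kk] := eqVneq k k1; last by rewrite mulr0; exact: subring0.
  rewrite kk gapT ck1 ltnn invr1 mul1r; exact: subring1.
rewrite (coE Be' v); apply: submod_sum => // k _.
have := h k; rewrite gapT; case: leqP => ck h'.
  have -> : co' k v *: e' k = T *: ((T^-1 * co' k v) *: e' k).
    by rewrite scalerA mulVKf.
  apply: tE; apply/HE' => // l; rewrite (coZ Be') (co_dual Be').
  have [->|_] := eqVneq l k; last by rewrite !mulr0; exact: subring0.
  by rewrite mulr1 mulrA -invfM.
have [l _ ->] : exists2 l : 'I_n, (l < n)%N & e' k = g l.
  by apply: done; apply/anti_leq; rewrite ci'.
by apply: submodZ => //; rewrite invr1 mul1r in h'.
Qed.
End NonUnit.

Lemma adapted_step (e : 'I_r -> V) co c : adapted E t i e co c ->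
  exists (e' : 'I_r -> V) co' c', adapted E t i.+1 e' co' c'.
Proof.
move=> ad; have [u|nu] := pselect (subunit R T).
  by exists e, co, c; exact: step_unit.
have [g [h1 h2 h3]] := step_lift.
exact: (step_nonunit _ h1 h2 h3 ad).
Qed.
End Step.
End AdaptedBasis.

(** * Local rings of an integral scheme *)

Section Stalks.
Variable X : integralScheme.
Implicit Types (x y : X) (U V W : opens X).

Lemma domX U (f g : rO U) n : U !=set0 -> f ^+ n * g = 0 -> f = 0 \/ g = 0.
Proof.
move=> U0; have [_ dom] := ischeme_dom U0.
elim: n => [|n IHn]; first by rewrite mul1r; right.
by rewrite exprS -mulrA => /dom[|/IHn]; [left |].
Qed.

Lemma unit_at_neq0 U (f : rO U) x : unit_at f x -> f <> 0.
Proof.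
move=> [V [h [g [Vx e]]]] f0; have V0 : V !=set0 by exists x.
by have [n01 _] := ischeme_dom V0; move: e; rewrite f0 rmorph0 mul0r => /esym.
Qed.

(** The section vanishes on some nonempty basic open set [D(g)], hence is killed by a power of [g];
    as [g] is nonzero in a domain, the section is zero. *)
Lemma fgerm_affine_eq0 V (h : rO V) : affine_open V -> V !=set0 ->
  fgerm h = 0 -> h = 0.
Proof.
move=> aV V0; rewrite -(fgerm0 V) => /(germ_eqP _ _ V0 V0).
move=> [W [k [k' [[x Wx]]]]] /=; rewrite rmorph0 => hW.
have [g [gx gW]] := affine_base aV k Wx.
pose D := Opens (open_unit_at g).
have hV : D `<=` V by move=> y /gW /k.
have hD : rres hV h = 0.
  have := congr1 (rres (gW : D `<=` W)) hW; rewrite rmorph0 => <-.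
  by rewrite (sheaf_comp (rO_sheaf X) _ _ hV).
have [n /domX] := loc_ker (affine_loc aV hV erefl) hD.
by case=> // g0; case: (unit_at_neq0 gx).
Qed.

Lemma affine_frac U x (f : rO U) : oset U x -> exists V (g h : rO V),
  [/\ affine_open V, oset V x, unit_at g x,
   [set y | unit_at g y] `<=` U & fgerm g * fgerm f = fgerm h].
Proof.
move=> Ux; have [V [Vx aV]] := ischemeP x.
have [g [gx gU]] := affine_base aV (@opensIr X U V) (conj Ux Vx).
pose D := Opens (open_unit_at g).
have hU : D `<=` U by move=> y /gU [].
have hV : D `<=` V by move=> y /gU [].
have D0 : D !=set0 by exists x.
have [n [h e]] := loc_surj (affine_loc aV hV erefl) (rres hU f).
have {}e : fgerm (g ^+ n.+1) * fgerm f = fgerm (g * h).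
  have V0 : V !=set0 by exists x.
  have := congr1 (@fgerm _ D) e.
  by rewrite fgermM !fgerm_res // exprS !fgermM -mulrA => ->.
(* The extra factor [g] matters when [n = 0]: the denominator must stay noninvertible wherever [g]
   is, so that its basic open set remains inside [U]. *)
exists V, (g ^+ n.+1), (g * h); split=> //.
  have [W [k [q [Wx e1]]]] := gx; exists W, k, (q ^+ n.+1); split=> //.
  by rewrite rmorphXn -exprMn e1 expr1n.
move=> y [W [k [q [Wx e1]]]]; apply: hU.
exists W, k, (rres k (g ^+ n) * q); split=> //.
by rewrite mulrA -rmorphM -exprS.
Qed.

Lemma fgerm_eq0 U (f : rO U) : U !=set0 -> fgerm f = 0 -> f = 0.
Proof.
move=> U0 f0.
pose I := {x | oset U x}.
have /choice[W WP] : forall i : I, exists W : opens X,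
    oset W (sval i) /\ exists h : W `<=` U, rres h f = 0.
  move=> [x Ux] /=; have [V [g [h [aV Vx gx gU]]]] := affine_frac f Ux.
  rewrite f0 mulr0 => /esym h0.
  pose D := Opens (open_unit_at g).
  have [Vx' [k [q [Dx e]]]] := gx.
  have V0 : V !=set0 by exists x.
  have D0 : D !=set0 by exists x.
  exists D; split=> //; exists gU.
  have hV : D `<=` V.
    by move=> y [Z [kZ [_ [Zy _]]]]; exact: kZ.
  have [n [h' e']] := loc_surj (affine_loc aV hV erefl) (rres (gU : D `<=` U) f).
  have h'0 : h' = 0.
    apply: fgerm_affine_eq0 => //.
    by rewrite -(fgerm_res hV) // -e' fgermM !fgerm_res // f0 mulr0.
  have [u eu] := loc_unit (affine_loc aV hV erefl).
  have : (rres hV g * u) ^+ n * rres (gU : D `<=` U) f = 0.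
    by rewrite exprMn mulrAC -rmorphXn e' h'0 rmorph0 mul0r.
  by rewrite eu expr1n mul1r.
have h i : W i `<=` U by have [_ []] := WP i.
apply: (sheaf_sep (rO_sheaf X) (V := W) (h := h)).
  by move=> x Ux; exists (exist _ x Ux); have [] := WP (exist _ x Ux).
move=> i; have [_ [h' e]] := WP i; rewrite rmorph0.
by rewrite (Prop_irrelevance (h i) h').
Qed.

Lemma rO_empty U (f g : rO U) : ~ (U !=set0) -> f = g.
Proof. exact: (@msec_empty X (structure_sheaf X)). Qed.

Lemma fgerm_inj U (f g : rO U) : U !=set0 -> fgerm f = fgerm g -> f = g.
Proof.
move=> U0 e; apply/eqP; rewrite -subr_eq0; apply/eqP; apply: fgerm_eq0 => //.
by rewrite /fgerm germD germN -!/(fgerm _) e subrr.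
Qed.

Lemma stalk_fgerm U (f : rO U) x : oset U x -> stalk x (fgerm f).
Proof. by move=> Ux; exists U, f. Qed.

Lemma stalk_subring x : is_subring (stalk x).
Proof.
split; [exact: stalk1 | | exact: stalkM].
move=> a b sa sb; rewrite -[b]opprK opprK; apply: stalkD => //.
have T0 : opensT X !=set0 by exists x.
have -> : - b = fgerm (-1 : rO (opensT X)) * b.
  by rewrite /fgerm germN -/(fgerm _) fgerm1 // mulN1r.
by apply: stalkM => //; exact: stalk_fgerm.
Qed.

(** Local representatives agree on overlaps because a section is determined by its class in the
    function field, so they glue. *)
Lemma stalk_section U a : U !=set0 -> (forall x, oset U x -> stalk x a) ->
  exists s : rO U, fgerm s = a.
Proof.
move=> [x0 Ux0] Ua; pose I := {x | oset U x}.
have ex : forall i : I, exists (W : opens X) (s : rO W),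
    [/\ oset W (sval i), W `<=` U & fgerm s = a].
  move=> [x Ux] /=; have [W [s [Wx ->]]] := Ua x Ux.
  exists (opensI U W), (rres (@opensIr _ U W) s).
  split=> //; first exact: opensIl.
  by rewrite fgerm_res //; exists x.
pose W i := sval (cid (ex i)); pose exs i := svalP (cid (ex i)).
pose s i : rO (W i) := sval (cid (exs i)).
have Hs i : [/\ oset (W i) (sval i), W i `<=` U & fgerm (s i) = a].
  exact: svalP (cid (exs i)).
have h i : W i `<=` U by have [] := Hs i.
have [t ht] : exists t, forall i, rres (h i) t = s i.
  apply: (sheaf_glue (rO_sheaf X)).
    by move=> x Ux; exists (exist _ x Ux); have [] := Hs (exist _ x Ux).
  move=> i j Z hi hj; case: (pselect (Z !=set0)) => Z0; last exact: rO_empty.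
  apply: fgerm_inj => //; rewrite !fgerm_res //.
  by have [_ _ ->] := Hs i; have [_ _ ->] := Hs j.
exists t; have [Wx _ <-] := Hs (exist _ x0 Ux0).
by rewrite -ht fgerm_res //; exists x0.
Qed.

Lemma stalk_unit_fgerm U (f : rO U) x : oset U x ->
  stalk_unit x (fgerm f) <-> unit_at f x.
Proof.
move=> Ux; have U0 : U !=set0 by exists x.
split=> [[f0 _ [V [g [Vx e]]]]|[V [h [g [Vx e]]]]].
  have UVx : oset (opensI U V) x by [].
  exists (opensI U V), (@opensIl _ U V), (rres (@opensIr _ U V) g); split=> //.
  have UV0 : opensI U V !=set0 by exists x.
  apply: fgerm_inj => //.
  by rewrite fgermM !fgerm_res // -e fgerm1 // divff.
have V0 : V !=set0 by exists x.
have e' : fgerm f * fgerm g = 1.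
  by rewrite -(fgerm_res h) // -fgermM e fgerm1.
have f0 : fgerm f != 0.
  by apply: contra_eq_neq e' => ->; rewrite mul0r eq_sym oner_neq0.
split=> //; first exact: stalk_fgerm.
have -> : (fgerm f)^-1 = fgerm g by rewrite -[RHS](mulKf f0) e' mulr1.
exact: stalk_fgerm.
Qed.

Lemma stalk_frac U x a : affine_open U -> oset U x -> stalk x a ->
  exists g h : rO U, unit_at g x /\ fgerm g * a = fgerm h.
Proof.
move=> aU Ux [V [f [Vx ->]]].
have [g [gx gV]] := affine_base aU (@opensIr X V U) (conj Vx Ux).
pose D := Opens (open_unit_at g).
have hU : D `<=` U by move=> y /gV [].
have hV : D `<=` V by move=> y /gV [].
have D0 : D !=set0 by exists x.
have [n [h e]] := loc_surj (affine_loc aU hU erefl) (rres hV f).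
exists (g ^+ n), h; split.
  have [W [k [q [Wx e1]]]] := gx; exists W, k, (q ^+ n); split=> //.
  by rewrite rmorphXn -exprMn e1 expr1n.
have := congr1 (@fgerm _ D) e.
by rewrite fgermM !fgerm_res.
Qed.

(** Over an affine neighbourhood, a common denominator turns a sum of nonunits into
    [g' * h + g * h'], which lies in the prime of sections not invertible at [x]. *)
Lemma stalk_local x : is_local (stalk x).
Proof.
split; first exact: stalk_subring.
move=> a b [sa na] [sb nb]; split; first exact: stalkD.
have [U [Ux aU]] := ischemeP x; have U0 : U !=set0 by exists x.
have [g [h [gx e]]] := stalk_frac aU Ux sa.
have [g' [h' [gx' e']]] := stalk_frac aU Ux sb.
have P := affine_prime aU Ux.
have ug : stalk_unit x (fgerm g) by apply/stalk_unit_fgerm.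
have ug' : stalk_unit x (fgerm g') by apply/stalk_unit_fgerm.
have nh : ~ unit_at h x.
  move=> /(stalk_unit_fgerm _ Ux); rewrite -e => u; apply: na.
  have -> : a = (fgerm g)^-1 * (fgerm g * a) by rewrite mulKf //; case: ug.
  by apply: stalk_unitM => //; exact: stalk_unitV.
have nh' : ~ unit_at h' x.
  move=> /(stalk_unit_fgerm _ Ux); rewrite -e' => u; apply: nb.
  have -> : b = (fgerm g')^-1 * (fgerm g' * b) by rewrite mulKf //; case: ug'.
  by apply: stalk_unitM => //; exact: stalk_unitV.
have : ~ unit_at (g' * h + g * h') x.
  by apply: (primeD P); exact: (primeM P).
move=> n /(stalk_unitM (stalk_unitM ug ug')); apply: contra_not n => u.
apply/stalk_unit_fgerm => //; rewrite fgermD !fgermM -e -e'.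
have -> : fgerm g' * (fgerm g * a) + fgerm g * (fgerm g' * b) =
  fgerm g * fgerm g' * (a + b) by ring.
exact: u.
Qed.

Lemma nonzero_stalk_unit (a : funField X) : a != 0 ->
  exists U, U !=set0 /\ forall x, oset U x -> stalk_unit x a.
Proof.
have sec (b : funField X) : exists U, U !=set0 /\ forall x, oset U x -> stalk x b.
  have [U [f [_ [_ [U0 -> _ _]]]]] := ratW b b b.
  by exists U; split=> // x Ux; exact: (@stalk_fgerm U f).
move=> a0; have [U [U0 Ua]] := sec a; have [V [V0 Va]] := sec a^-1.
exists (opensI U V); split; first exact: opens_meet.
by move=> x [Ux Vx]; split=> //; [exact: Ua | exact: Va].
Qed.
End Stalks.

(** * Common components *)

(* The complement of P is a maximal multiplicative set disjoint from I. *)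
Lemma minimal_prime (A : comPzRingType) (I S0 : set A) :
  I 0 -> (forall a b, I a -> I b -> I (a + b)) -> (forall a b, I b -> I (a * b)) ->
  S0 1 -> (forall a b, S0 a -> S0 b -> S0 (a * b)) ->
  (forall a, S0 a -> ~ I a) ->
  exists P : set A, [/\ prime_ideal P, I `<=` P, forall a, P a -> ~ S0 a &
    forall g, P g -> exists s n, ~ P s /\ I (s * g ^+ n)].
Proof.
move=> I0 ID IM S1 SM SI.
(* The conditions are put on the union with [S0] so that the union of the empty chain, the empty
   set, also satisfies them. *)
pose good (S : set A) := (forall a b, (S `|` S0) a -> (S `|` S0) b ->
  (S `|` S0) (a * b)) /\ forall a, (S `|` S0) a -> ~ I a.
have [S [[S'M S'I] Smax]] : exists S, good S /\ forall T, S `<` T -> ~ good T.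
  apply: Zorn_bigcup => F FP tot; split; last first.
    move=> a [[T FT Ta]|]; last exact: SI.
    by have [_] := FP _ FT; apply; left.
  move=> a b [[T FT Ta]|Sa] [[T' FT' Tb]|Sb].
  - have [TT|TT] := tot _ _ FT FT'.
      have [h _] := FP _ FT'; have [||h'|h'] := h a b; [left; exact: TT | by left | |].
        by left; exists T'.
      by right.
    have [h _] := FP _ FT; have [||h'|h'] := h a b; [by left | left; exact: TT | |].
      by left; exists T.
    by right.
  - have [h _] := FP _ FT; have [||h'|h'] := h a b; [by left | by right | |].
      by left; exists T.
    by right.
  - have [h _] := FP _ FT'; have [||h'|h'] := h a b; [by right | by left | |].
      by left; exists T'.
    by right.
  - by right; exact: SM.
have S'1 : (S `|` S0) 1 by right.
pose P := [set a | ~ (S `|` S0) a].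
(* By maximality, the multiplicative set obtained by adjoining the powers of [g] must meet [I]. *)
have witness g : P g -> exists s n, (S `|` S0) s /\ I (s * g ^+ n).
  move=> Pg; apply: contrapT => no.
  pose T := [set a | exists s n, (S `|` S0) s /\ a = s * g ^+ n].
  have sub a : (S `|` S0) a -> T a by move=> Sa; exists a, 0%N; rewrite mulr1.
  apply: (Smax T).
    split; first by move=> a Sa; apply: sub; left.
    by move=> /(_ g) h; apply: Pg; left; apply: h; exists 1, 1%N; rewrite mul1r.
  have TS0 a : (T `|` S0) a -> T a by case=> // Sa; apply: sub; right.
  split.
    move=> _ _ /TS0[s [n [Ss ->]]] /TS0[s' [n' [Ss' ->]]]; left.
    exists (s * s'), (n + n')%N; split; last by rewrite mulrACA exprD.
    exact: S'M.
  move=> _ /TS0[s [n [Ss ->]]] Ia; apply: no.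
  by exists s, n.
exists P; split.
- split=> /=.
  + by move=> /S'I; apply.
  (* If [a + b] were in the multiplicative set, so would be [s * s' * (a + b) ^+ (n + n')]. In each
     binomial term the exponent of [a] is at least [n] or that of [b] at least [n'], so this element
     would be in [I]. *)
  + move=> a b Pa Pb Sab.
    have [s [n [Ss Ia]]] := witness _ Pa; have [s' [n' [Ss' Ib]]] := witness _ Pb.
    have Sn k : (S `|` S0) ((a + b) ^+ k).
      by elim: k => // k IHk; rewrite exprS; exact: S'M.
    apply: (S'I _ (S'M _ _ (S'M _ _ Ss Ss') (Sn (n + n')%N))).
    rewrite exprDn mulr_sumr; elim/big_ind: _ => //= i _.
    rewrite mulrnAr -mulr_natl; apply: (IM _%:R).
    have [ni|ni] := leqP n (n + n' - i).
      rewrite -(subnK ni) exprD.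
      have -> : s * s' * (a ^+ (n + n' - i - n) * a ^+ n * b ^+ i) =
        (s' * a ^+ (n + n' - i - n) * b ^+ i) * (s * a ^+ n) by ring.
      exact: IM.
    have n'i : (n' <= i)%N.
      rewrite leqNgt; apply/negP => h; move: ni; rewrite ltnNge => /negP; apply.
      by rewrite -addnBA ?leq_addr // ltnW.
    rewrite -(subnK n'i) exprD subnK //.
    have -> : s * s' * (a ^+ (n + n' - i) * (b ^+ (i - n') * b ^+ n')) =
      (s * a ^+ (n + n' - i) * b ^+ (i - n')) * (s' * b ^+ n') by ring.
    exact: IM.
  + move=> a b Pb Sab; have [s [n [Ss Ib]]] := witness _ Pb.
    have Sn k : (S `|` S0) ((a * b) ^+ k).
      by elim: k => // k IHk; rewrite exprS; exact: S'M.
    apply: (S'I _ (S'M _ _ Ss (Sn n))).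
    by rewrite exprMn mulrCA; exact: IM.
  + by [].
  + move=> a b Pab; apply: contrapT => /not_orP[/contrapT Sa /contrapT Sb].
    by apply: Pab; exact: S'M.
- by move=> a Ia Sa; exact: (S'I _ Sa).
- by move=> a Pa Sa; apply: Pa; right.
- move=> g /witness[s [n [Ss Ig]]]; exists s, n; split=> //; exact.
Qed.

Section Components.
Variable X : integralScheme.
Implicit Types (x y : X) (D : cartier X).

Lemma eqn_nbhd D x t : D x t -> exists U : opens X,
  oset U x /\ forall y, oset U y -> D y t.
Proof.
move=> Dt; have [t' [U [Ux Ht']]] := eqn_open D x.
have [u [u0 su su'] ->] := (eqn_coset _ (Ht' _ Ux)).1 Dt.
have [V [Vx HV]] := stalk_open su; have [W [Wx HW]] := stalk_open su'.
exists (opensI U (opensI V W)); split=> // y [Uy [Vy Wy]].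
by apply: eqnZ; [exact: Ht' | split=> //; [exact: HV | exact: HW]].
Qed.

Lemma ideal_stalkE D x t a : D x t -> ideal_stalk D x a <-> stalk x (t^-1 * a).
Proof.
move=> Dt; split=> [[t' Dt' sa]|]; last by exists t.
have [u [u0 _ su'] e] := (eqn_coset _ Dt).1 Dt'.
have t0 := eqn_neq0 Dt.
have [w [_ sw _] e'] := (eqn_coset _ Dt).1 Dt'.
have -> : t^-1 * a = u * (t'^-1 * a) by rewrite e invfM -mulrA mulVKf.
by apply: stalkM => //; move: e' sw; rewrite e => /(mulIf t0) ->.
Qed.

(* If q is not regular at x, then the conductor of q gives a component common to
   D and D': at a generization of x given by a prime minimal over it, the
   classes of Y q and Z q are both nonzero and killed by powers of nonunits. *)
Lemma no_common_regular D D' x Y Z q : no_common_component D D' ->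
  D x Y -> D' x Z -> stalk x (Y * q) -> stalk x (Z * q) -> stalk x q.
Proof.
move=> nc DY DZ sY sZ; apply: contrapT => nq.
have [U [Ux aU]] := ischemeP x; have U0 : U !=set0 by exists x.
pose I := [set f : rO U | stalk x (fgerm f * q)].
have RS := stalk_subring x.
(* [I] is the ideal of denominators of [q] at [x]. Avoiding all sections invertible at [x] makes the
   prime a generization [y] of [x]. *)
have [|a b|a b||a b|a|P [PP IP PS Pw]] := @minimal_prime _ I [set f : rO U | unit_at f x].
- by rewrite /I /= fgerm0 mul0r; exact: subring0.
- by rewrite /I /= fgermD mulrDl; exact: stalkD.
- by move=> sb; rewrite /I /= fgermM -mulrA; apply: stalkM => //; exact: stalk_fgerm.
- by apply: (stalk_unit_fgerm _ Ux).1; rewrite fgerm1 //; exact: stalk_unit1.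
- move=> /(stalk_unit_fgerm _ Ux) ua /(stalk_unit_fgerm _ Ux) ub.
  by apply: (stalk_unit_fgerm _ Ux).1; rewrite fgermM; exact: stalk_unitM.
- move=> /(stalk_unit_fgerm _ Ux) [a0 _ sa'] Ia; apply: nq.
  by rewrite -(mulKf a0 q); exact: stalkM.
have [y [Uy Py _]] := affine_point aU PP.
have gen (W : opens X) : oset W x -> oset W y.
  move=> Wx; have [f [fx fW]] := affine_base aU (@opensIr X W U) (conj Wx Ux).
  suff /fW [] : unit_at f y by [].
  by apply: contrapT => nf; have /PS : P f by rewrite -Py.
have stalk_gen a : stalk x a -> stalk y a.
  by move=> [W [f [Wx ->]]]; apply: stalk_fgerm; exact: gen.
have eqn_gen (C : cartier X) t : C x t -> C y t.
  by move=> /eqn_nbhd[W [/gen Wy]]; apply.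
have unitP (f : rO U) : ~ P f <-> stalk_unit y (fgerm f).
  rewrite -Py /= (stalk_unit_fgerm _ Uy); split=> [/contrapT //|u h]; exact: h.
have nqy : ~ stalk y q.
  move=> /(stalk_frac aU Uy)[g [h [gy e]]].
  suff /IP : I g by rewrite -Py /= ; exact.
  by rewrite /I /= e; exact: stalk_fgerm.
(* Minimality of the prime over the conductor: the multiplier [s] of the power is outside it, hence
   a unit at [y]. *)
have killed g : stalk y g -> ~ stalk_unit y g -> exists n, stalk y (g ^+ n * q).
  move=> sg ng; have [k [h [ky e]]] := stalk_frac aU Uy sg.
  have uk : stalk_unit y (fgerm k) by apply/stalk_unit_fgerm.
  have [k0 sk sk'] := uk.
  have /Pw[s [n [/unitP us Is]]] : P h.
    apply: contrapT => /unitP uh; apply: ng.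
    rewrite -(mulKf k0 g) e; apply: stalk_unitM => //; exact: stalk_unitV.
  have [s0 _ ss'] := us.
  exists n; rewrite -(mulKf k0 g) e.
  have -> : ((fgerm k)^-1 * fgerm h) ^+ n * q =
     (fgerm k)^-1 ^+ n * ((fgerm s)^-1 * (fgerm (s * h ^+ n) * q)).
    by rewrite fgermM fgermX // exprMn -mulrA -[_ * _ * q]mulrA mulKf.
  apply: stalkM.
    by elim: n {Is} => [|n IHn]; [exact: stalk1 | rewrite exprS; exact: stalkM].
  by apply: stalkM => //; exact: stalk_gen.
have comp (C : cartier X) W : C x W -> stalk x (W * q) -> component_pt C y.
  move=> CW sW; have W0 := eqn_neq0 CW; exists (W * q); split.
  - exact: stalk_gen.
  - by rewrite (ideal_stalkE _ (eqn_gen _ _ CW)) mulKf.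
  move=> g sg /(killed g sg)[n sn]; exists n.
  by rewrite (ideal_stalkE _ (eqn_gen _ _ CW)) mulrCA mulKf.
by apply: (nc y); split; [exact: comp DY sY | exact: comp DZ sZ].
Qed.
End Components.

(** * Bases over open sets *)

(** The condition inside [locally_free], isolated so that one frame can be passed around; it ranges
    over all smaller open sets, hence survives restriction. *)
Definition is_basis (X : ringedSpace) (M : modSheaf X) (U : opens X) r
    (e : 'I_r -> M U) : Prop :=
  forall (V : opens X) (h : V `<=` U),
    (forall s : M V, exists a : 'I_r -> rO V, s = \sum_i a i *: mres h (e i)) /\
    (forall a : 'I_r -> rO V,
      \sum_i a i *: mres h (e i) = 0 -> forall i, a i = 0).

Section Bases.
Variable X : integralScheme.
Implicit Types (x y : X) (U V W : opens X).

(** Abstract in [F] in order to serve both the neighbourhoods of a point and the nonempty open sets,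
    which play the part of neighbourhoods of the generic point. *)
Lemma finite_opens (F : opens X -> Prop) n (P : 'I_n -> X -> Prop) :
  F (opensT X) -> (forall U V, F U -> F V -> F (opensI U V)) ->
  (forall i, exists U, F U /\ forall y, oset U y -> P i y) ->
  exists U, F U /\ forall y, oset U y -> forall i, P i y.
Proof.
move=> FT FI FP.
suff /(_ n)[U [FU HU]] : forall k, exists U, F U /\ forall y, oset U y ->
    forall i : 'I_n, (i < k)%N -> P i y.
  by exists U; split=> // y Uy i; exact: HU.
elim=> [|k [U [FU HU]]]; first by exists (opensT X).
have [kn|kn] := ltnP k n; last first.
  by exists U; split=> // y Uy i _; apply: HU => //; exact: leq_trans kn.
have [V [FV HV]] := FP (Ordinal kn); exists (opensI U V).
split; first exact: FI.
move=> y [Uy Vy] i; rewrite ltnS leq_eqVlt => /orP[/eqP ik|ik]; last exact: HU.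
by rewrite (_ : i = Ordinal kn); [exact: HV | exact: val_inj].
Qed.

Lemma finite_nbhd x n (P : 'I_n -> X -> Prop) :
  (forall i, exists U, oset U x /\ forall y, oset U y -> P i y) ->
  exists U, oset U x /\ forall y, oset U y -> forall i, P i y.
Proof. exact: (@finite_opens (fun U => oset U x)). Qed.

Lemma common_section n (a : 'I_n -> funField X) U : U !=set0 ->
  exists V (h : V `<=` U) (b : 'I_n -> rO V),
    V !=set0 /\ forall i, fgerm (b i) = a i.
Proof.
move=> U0.
have [V [V0 HV]] : exists V, V !=set0 /\ forall y, oset V y ->
    forall i, stalk y (a i).
  apply: (@finite_opens (fun V => V !=set0)); first exact: ischeme_ne.
    by move=> V W; exact: opens_meet.
  move=> i; have [W [f [_ [_ [W0 -> _ _]]]]] := ratW (a i) (a i) (a i).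
  by exists W; split=> // y Wy; exact: (@stalk_fgerm X W f).
have UV := opens_meet U0 V0.
have /choice[b bE] : forall i, exists b : rO (opensI U V), fgerm b = a i.
  by move=> i; apply: stalk_section => // y [_ Vy]; exact: HV.
by exists (opensI U V), (@opensIl _ U V), b.
Qed.

Section Model.
Variables (M : modSheaf X) (Z : lmodType (funField X)) (rho : forall U, M U -> Z).

(* Covers both germs of sections of M and the sections of a subsheaf, which
   already are rational sections. *)
Record rational_model : Prop := RationalModel {
  rm_lin : forall U (a : rO U) (s t : M U),
    rho (a *: s + t) = fgerm a *: rho s + rho t;
  rm_res : forall U V (h : V `<=` U) (s : M U), V !=set0 -> rho (mres h s) = rho s;
  rm_eq0 : forall U (s : M U), U !=set0 -> rho s = 0 ->
    exists V (h : V `<=` U), V !=set0 /\ mres h s = 0 }.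

Hypothesis HM : rational_model.

Lemma rmD U (s t : M U) : U !=set0 -> rho (s + t) = rho s + rho t.
Proof. by move=> U0; have := rm_lin HM 1 s t; rewrite scale1r fgerm1 // scale1r. Qed.

Lemma rm0 U : U !=set0 -> rho (0 : M U) = 0.
Proof. by move=> U0; apply: (@addrI _ (rho (0 : M U))); rewrite -rmD ?addr0. Qed.

Lemma rmZ U (a : rO U) (s : M U) : U !=set0 -> rho (a *: s) = fgerm a *: rho s.
Proof. by move=> U0; have := rm_lin HM a s 0; rewrite addr0 rm0 // addr0. Qed.

Lemma rm_sum U n (s : 'I_n -> M U) : U !=set0 ->
  rho (\sum_i s i) = \sum_i rho (s i).
Proof.
move=> U0; elim/big_rec2: _ => [|i v w _ <-]; first exact: rm0.
exact: rmD.
Qed.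

Lemma rm_comb U V (h : V `<=` U) n (a : 'I_n -> rO V) (s : 'I_n -> M U) :
  V !=set0 ->
  rho (\sum_i a i *: mres h (s i)) = \sum_i fgerm (a i) *: rho (s i).
Proof.
by move=> V0; rewrite rm_sum //; apply: eq_bigr => i _; rewrite rmZ // rm_res.
Qed.

Lemma mres_sum (N : modSheaf X) U V (h : V `<=` U) n (s : 'I_n -> N U) :
  mres h (\sum_i s i) = \sum_i mres h (s i).
Proof. by apply: (big_morph (mres h)); [exact: mresD | exact: mres0]. Qed.

Lemma rm_free U r (e : 'I_r -> M U) (a : 'I_r -> funField X) : U !=set0 ->
  is_basis e -> \sum_i a i *: rho (e i) = 0 -> forall i, a i = 0.
Proof.
move=> U0 He; have [V [h [b [V0 bE]]]] := common_section a U0.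
under eq_bigr do rewrite -bE; rewrite -(rm_comb h) // => /(rm_eq0 HM V0).
move=> [W [k [W0]]]; rewrite mres_sum => sum0 i.
have kh := subset_trans k h; have [_ free] := He W kh.
rewrite -bE -(fgerm_res k) // (free (fun i => rres k (b i))) ?fgerm0 //.
by rewrite -[RHS]sum0; apply: eq_bigr => j _; rewrite mresZ (mres_comp h k kh).
Qed.

Lemma rm_span U r (e : 'I_r -> M U) V (s : M V) x : oset U x -> oset V x ->
  is_basis e ->
  exists2 a : 'I_r -> funField X,
    forall i, stalk x (a i) & rho s = \sum_i a i *: rho (e i).
Proof.
move=> Ux Vx He; pose h := @opensIl _ U V; pose k := @opensIr _ U V.
have UVx : oset (opensI U V) x by [].
have UV0 : opensI U V !=set0 by exists x.
have [/(_ (mres k s))[a sE] _] := He _ h.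
exists (fun i => fgerm (a i)); first by move=> i; exact: stalk_fgerm UVx.
by rewrite -(rm_res HM k) // sE rm_comb.
Qed.
End Model.

Lemma germ_model (M : modSheaf X) : rational_model (@germ X M).
Proof.
split=> [U a s t|U V h s|U s U0]; [by rewrite germD germZ | exact: germ_res |].
rewrite -(germ0 M U) => /(germ_eqP _ _ U0 U0)[V [h [h' [V0 e]]]].
by exists V, h; rewrite e mres0.
Qed.

Lemma subsec_model (M : modSheaf X) (F : subSheaf M) :
  rational_model (fun U (v : sheaf_of_sub F U) => subsec_val v).
Proof.
split=> [//|U V h s V0|U s U0 s0] /=; first by case: pselect.
by exists U, (@subset_refl _ _); split=> //; apply: val_inj => /=; case: pselect.
Qed.

Section Frames.
Variable M : modSheaf X.

Lemma germ_basis U r (e : 'I_r -> M U) : U !=set0 -> is_basis e ->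
  exists co : 'I_r -> ratSections M -> funField X, dual_basis (fun k => germ (e k)) co.
Proof.
move=> U0 He; apply: basis_free_span; last first.
  by move=> a; exact: (rm_free (germ_model M) U0 He).
move=> v; have [V [s [_ [_ [V0 -> _ _]]]]] := ratW v v v.
have [x [Ux Vx]] := opens_meet U0 V0.
by have [a _ ->] := rm_span (germ_model M) s Ux Vx He; exists a.
Qed.

Lemma sub_stalk_sum (F : subSheaf M) x n (v : 'I_n -> ratSections M) :
  (forall i, F x (v i)) -> F x (\sum_i v i).
Proof.
move=> Fv; elim/big_ind: _ => //; first exact: sub_stalk0.
exact: sub_stalkD.
Qed.

Lemma sub_full_coord U r (e : 'I_r -> M U)
    (co : 'I_r -> ratSections M -> funField X) x v : is_basis e ->
  dual_basis (fun k => germ (e k)) co -> oset U x ->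
  sub_full M x v <-> forall k, stalk x (co k v).
Proof.
move=> He B Ux; split=> [[V [s [Vx ->]]] k|h].
  have [a sa ->] := rm_span (germ_model M) s Ux Vx He.
  by rewrite (co_sumE B).
rewrite (coE B v); apply: sub_stalk_sum => k; apply: sub_stalkZ => //.
by exists U, (e k).
Qed.

Lemma subsec_stalk (F : subSheaf M) U (v : subsec F U) x : oset U x -> F x v.
Proof. by move=> Ux; have /asboolP[h _] := subsec_valP v; exact: h. Qed.

Lemma subsec_of (F : subSheaf M) U v : U !=set0 ->
  (forall x, oset U x -> F x v) -> exists s : subsec F U, subsec_val s = v.
Proof.
move=> U0 Fv; have vP : subsec_pred F U v by apply/asboolP; split=> //; left.
by exists (Subsec vP).
Qed.

Lemma sub_gens (F : subSheaf M) U r (b : 'I_r -> sheaf_of_sub F U) x :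
  is_basis b -> oset U x -> (forall k, F x (subsec_val (b k))) /\
    forall v, F x v -> exists2 a : 'I_r -> funField X,
    forall i, stalk x (a i) & v = \sum_i a i *: subsec_val (b i).
Proof.
move=> Hb Ux; split=> [k|v Fv]; first exact: subsec_stalk.
have [V [Vx HV]] := sub_stalk_open Fv.
have V0 : V !=set0 by exists x.
have [s <-] := subsec_of V0 HV.
exact: (rm_span (subsec_model F) s Ux Vx Hb).
Qed.

Section Diagonal.
Variables (F : subSheaf M) (U : opens X) (r : nat) (e : 'I_r -> ratSections M).
Variables (co : 'I_r -> ratSections M -> funField X) (w : 'I_r -> funField X).
Hypothesis B : dual_basis e co.
Hypothesis w0 : forall k, w k != 0.

(** Over [U], the subsheaf is the direct sum of the lines spanned by the [w k *: e k]. *)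
Definition coord_lattice : Prop := forall x, oset U x -> forall v,
  F x v <-> forall k, stalk x ((w k)^-1 * co k v).

Lemma basis_coord_lattice (b : 'I_r -> sheaf_of_sub F U) : is_basis b ->
  (forall k, subsec_val (b k) = w k *: e k) -> coord_lattice.
Proof.
move=> Hb bE x Ux v; have [Fb gen] := sub_gens Hb Ux; split=> [/gen[a sa ->] k|h].
  under eq_bigr do rewrite bE.
  by rewrite (co_diagE B) mulrCA mulVf // mulr1.
rewrite (coE B v); apply: sub_stalk_sum => k.
rewrite -[co k v](mulVKf (w0 k)) mulrC -scalerA -bE.
exact: sub_stalkZ.
Qed.

Lemma coord_lattice_gen : coord_lattice -> forall x k, oset U x -> F x (w k *: e k).
Proof.
move=> HF x k Ux; apply/HF => // l; rewrite (coZ B) (co_dual B).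
have [->|_] := eqVneq l k; last by rewrite !mulr0; exact: (subring0 (stalk_subring x)).
rewrite mulr1 mulVf //; exact: stalk1.
Qed.

(** The rescaled coordinates of a section are rational functions regular at every point, hence
    sections of the structure sheaf. *)
Lemma coord_lattice_basis : U !=set0 -> coord_lattice ->
  exists b : 'I_r -> sheaf_of_sub F U,
    is_basis b /\ forall k, subsec_val (b k) = w k *: e k.
Proof.
move=> U0 HF.
have /choice[b bE] : forall k, exists b : subsec F U, subsec_val b = w k *: e k.
  by move=> k; apply: subsec_of => // x; exact: coord_lattice_gen.
exists b; split=> // V h.
have [V0|V0] := pselect (V !=set0); last first.
  split=> [s|a _ i]; last exact: rO_empty.
  by exists (fun=> 0); exact: (@msec_empty X (sheaf_of_sub F)).
have SM := subsec_model F.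
split=> [s|a /(congr1 (fun s : subsec F V => subsec_val s)) /= a0 i].
  have /choice[a aE] : forall k, exists a : rO V,
      fgerm a = (w k)^-1 * co k (subsec_val s).
    move=> k; apply: stalk_section => // x Vx.
    by move: k; apply/HF; [exact: h | exact: subsec_stalk].
  exists a; apply: val_inj; rewrite [RHS](rm_comb SM h a b V0) /= [LHS](coE B).
  by apply: eq_bigr => k _; rewrite aE bE scalerA mulrAC mulVf // mul1r.
apply: fgerm_inj => //; rewrite fgerm0.
have := rm_comb SM h a b V0; rewrite a0 => /esym /(congr1 (co i)).
under eq_bigr do rewrite bE.
rewrite (co_diagE B) (co0 B) => /eqP; rewrite mulf_eq0 (negPf (w0 i)) orbF.
by move/eqP.
Qed.
End Diagonal.
End Frames.
End Bases.

(** * Local frames of an echelon datum *)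

Section Divisors.
Variable X : integralScheme.
Implicit Types (x y : X) (U V W : opens X) (D : cartier X).

Lemma cartierB_eqn D D' x t t' : D x t -> D' x t' -> cartierB D D' x (t * t'^-1).
Proof. by move=> Dt Dt'; exists t, t'^-1; split; rewrite //= invrK. Qed.

Lemma cartierB_eqnD D D' x t t' : cartierB D D' x t -> D' x t' -> D x (t * t').
Proof.
move=> [s [s' [Ds /= Ds' ->]]] Dt'.
have [u su ->] := (eqn_coset _ Ds').1 Dt'.
have s0 : s' != 0 by have := eqn_neq0 Ds'; rewrite invr_eq0.
have -> : s * s' * (u * s'^-1) = u * s by rewrite mulrACA mulfV // mulr1 mulrC.
exact: eqnZ.
Qed.

Lemma effective_eqn D : (forall x, exists2 t, D x t & stalk x t) -> effective D.
Proof.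
move=> HD x t Dt; have [t' Dt' st'] := HD x.
by have [u [_ su _] ->] := (eqn_coset _ Dt').1 Dt; exact: stalkM.
Qed.

Lemma cartier_leP D D' x t t' : cartier_le D D' -> D x t -> D' x t' ->
  stalk x (t' * t^-1).
Proof. by move=> le Dt Dt'; apply: le; exact: cartierB_eqn. Qed.

Section Twist.
Variable M : modSheaf X.
Implicit Types F : subSheaf M.

Lemma sub_submod F x : is_submod (stalk x) (F x).
Proof. by split; [exact: sub_stalk0 | exact: sub_stalkD | exact: sub_stalkZ]. Qed.

Lemma twistE F D x t : D x t -> twist F D x = [set v | F x (t *: v)].
Proof.
move=> Dt; apply/seteqP; split=> v /=; last by move=> ?; exists t.
move=> [t' Dt' Fv]; have [u [_ su _] ->] := (eqn_coset _ Dt').1 Dt.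
by rewrite -scalerA; exact: sub_stalkZ.
Qed.

Lemma twistNE F D x t : D x t -> twist F (cartierN D) x = [set v | F x (t^-1 *: v)].
Proof. by move=> Dt; apply: twistE; rewrite /= invrK. Qed.
End Twist.
End Divisors.

Section Frame.
Variables (X : integralScheme) (E : modSheaf X) (chi : echData E) (m : nat).
Implicit Types (x z : X) (U V W : opens X).

(** Vectors, coordinates and equations are rational objects, so the same ones, with the same levels,
    serve at every point of [U]. *)
Record frame U r (e : 'I_r -> ratSections E)
    (co : 'I_r -> ratSections E -> funField X) (c : 'I_r -> nat)
    (t y : nat -> funField X) : Prop := Frame {
  frame_basis : dual_basis e co;
  frame_level : forall k, (c k <= m)%N;
  frame_sub : forall i, (i <= m)%N ->
    coord_lattice (ech_sub chi i) U co (fun k => gap t (c k) i);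
  frame_t : forall i, (0 < i <= m)%N -> forall x, oset U x ->
    ech_ddelta chi i x (t i);
  frame_y : forall i, (0 < i <= m)%N -> forall x, oset U x -> ech_dD chi i x (y i) }.

Lemma frame_eqns x : exists U (t y : nat -> funField X), oset U x /\
  forall i, (0 < i <= m)%N -> forall z, oset U z ->
    ech_ddelta chi i z (t i) /\ ech_dD chi i z (y i).
Proof.
have /choice[t /choice[y ty]] : forall i, exists t y, exists U, oset U x /\
    forall z, oset U z -> ech_ddelta chi i z t /\ ech_dD chi i z y.
  move=> i; have [t [U [Ux HU]]] := eqn_open (ech_ddelta chi i) x.
  have [y [V [Vx HV]]] := eqn_open (ech_dD chi i) x.
  by exists t, y, (opensI U V); split=> // z [/HU ? /HV ?].
have [U [Ux HU]] := @finite_nbhd X x m.+1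
  (fun i z => ech_ddelta chi i z (t i) /\ ech_dD chi i z (y i)) (fun i => ty i).
exists U, t, y; split=> // i /andP[_ im] z Uz.
by have := HU z Uz (Ordinal (im : (i < m.+1)%N)).
Qed.

Lemma adapted_exists r x t : is_preechelon chi m -> locally_free r E ->
  (forall i, (0 < i <= m)%N -> ech_ddelta chi i x (t i)) ->
  exists (e : 'I_r -> ratSections E) co c,
    adapted (stalk x) (fun j => ech_sub chi j x) t m e co c.
Proof.
move=> [_ sub0 chain _ eff pers] free Ht.
suff H : forall i, (i <= m)%N -> exists (e : 'I_r -> ratSections E) co c,
    adapted (stalk x) (fun j => ech_sub chi j x) t i e co c by exact: H.
elim=> [_|i IHi im].
  have [U [s [Ux Hs]]] := free x; have U0 : U !=set0 by exists x.
  have [co B] := germ_basis U0 Hs; exists (fun k => germ (s k)), co, (fun=> 0%N).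
  split=> // j; rewrite leqn0 => /eqP -> v; rewrite sub0 (sub_full_coord v Hs B Ux).
  by split=> h k; have := h k; rewrite gap_geq // invr1 mul1r.
have [e [co [c ad]]] := IHi (ltnW im).
have Ti : ech_ddelta chi i.+1 x (t i.+1) by exact: Ht.
have [subT] := pers i.+1 im; have inj j := twistNE (ech_sub chi j) Ti.
(* The exchange takes place in the fibre of [E^0], of which the current vectors form a basis; hence
   the comparison with index 0. *)
move=> /(_ 0%N isT)[ker lfree split].
have [U [n [g [Ux Hg]]]] := lfree x; have [W [Q [Wx HQ]]] := split x.
have [gA ggen gfree] := Hg x Ux; have [BQ QE AQ AQE] := HQ x Wx.
have T0 := eqn_neq0 Ti.
have [] := @adapted_step _ _ _ (stalk_local x) (fun j => ech_sub chi j x) t i r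
  _ _ _ _ _ _ n g _ _ _ (Q x) _ _ _ e co c ad; last by move=> e' H; exists e'.
- by move=> j; exact: sub_submod.
- by move=> l /andP[l0 li]; apply/eqn_neq0/Ht; rewrite l0 (leq_trans li).
- by move=> l /andP[l0 li]; apply/eff/Ht; rewrite l0 (leq_trans li).
- exact: chain.
- move=> v Ev.
  suff h : twist (ech_sub chi i) (cartierN (ech_ddelta chi i.+1)) x (t i.+1 *: v).
    exact: (subT x).
  by rewrite inj /= scalerA mulVf // scale1r.
- move=> v Ev Bv; have : twist (ech_sub chi i) (cartierN (ech_ddelta chi i.+1)) x v.
    by apply: ker; split=> //; rewrite inj.
  by rewrite inj.
- move=> l; have [v1 [v2 [h1 h2 ->]]] := gA l; exists v1, v2; split=> //.
  by rewrite inj in h2.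
- move=> v [v1 [v2 [h1 h2 ->]]].
  have [|a [sa Ba]] := ggen (v1 + v2); first by exists v1, v2; rewrite inj.
  by exists a; split=> //; rewrite inj in Ba.
- move=> a sa Ba; have h : forall l, ideal_stalk (ech_ddelta chi i.+1) x (a l).
    by apply/gfree => //; rewrite inj.
  move=> l.
  exact/(ideal_stalkE _ Ti).
- exact: sub_submod.
- rewrite -[RHS](inj 0%N) -AQ; congr (_ `&` _); apply/seteqP.
  by split=> v [v1 [v2 [h1 h2 ->]]]; exists v1, v2; rewrite inj in h2 *.
- move=> v Ev; have := Ev.
  rewrite -[X in X v]AQE => -[_ [v2 [[w1 [w2 [h1 h2 ->]]] h3 ->]]].
  exists (w1 + w2), v2; split=> //; exists w1, w2; split=> //.
  by rewrite inj in h2.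
Qed.

(** An adapted basis at [x] remains adapted nearby. Each [E^i] and its coordinate lattice are
    finitely generated, and each inclusion between them is tested on generators, which is an open
    condition. *)
Lemma frame_exists r x : is_preechelon chi m -> locally_free r E ->
  (forall i, (i <= m)%N -> locally_free r (sheaf_of_sub (ech_sub chi i))) ->
  exists U e co c t y, oset U x /\ @frame U r e co c t y.
Proof.
move=> pre freeE free; have [U [t [y [Ux ty]]]] := frame_eqns x.
have [|e [co [c [B cm HE]]]] := @adapted_exists r x t pre freeE.
  by move=> i im; have [] := ty i im x Ux.
have g0 k i : (i <= m)%N -> gap t (c k) i != 0.
  apply: (@gap_ind _ t (fun a => a != 0) m); rewrite ?oner_eq0 //.
    by move=> a b; exact: mulf_neq0.
  by move=> j jm; have [/eqn_neq0] := ty j jm x Ux.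
have [V [Vx HV]] : exists V, oset V x /\ forall z, oset V z -> forall i : 'I_m.+1,
    forall v, ech_sub chi i z v <->
      forall k, stalk z ((gap t (c k) i)^-1 * co k v).
  apply: finite_nbhd => i; have im : (i <= m)%N by rewrite -ltnS.
  have [W [b [Wx Hb]]] := free i im x.
  have [V [Vx HV]] : exists V, oset V x /\ forall z, oset V z -> forall k l,
      stalk z ((gap t (c k) i)^-1 * co k (subsec_val (b l))).
    apply: finite_nbhd => k; apply: finite_nbhd => l; apply: stalk_open.
    by move: k; apply/HE => //; have [] := sub_gens Hb Wx.
  have [V' [V'x HV']] : exists V, oset V x /\ forall z, oset V z -> forall k,
      ech_sub chi i z (gap t (c k) i *: e k).
    apply: finite_nbhd => k; apply: sub_stalk_open; apply/HE => // l.
    rewrite (coZ B) (co_dual B); have [->|_] := eqVneq l k.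
      by rewrite mulr1 mulVf ?g0 //; exact: stalk1.
    by rewrite !mulr0; exact: (subring0 (stalk_subring x)).
  exists (opensI W (opensI V V')); split=> // z [Wz [Vz V'z]] v.
  have [_ gen] := sub_gens Hb Wz; split=> [/gen[a sa ->] k|h].
    rewrite (co_sum B) mulr_sumr; apply: (subring_sum (stalk_subring z)) => l _.
    by rewrite (coZ B) mulrCA; apply: stalkM => //; exact: HV.
  rewrite (coE B v); apply: sub_stalk_sum => k.
  rewrite -[co k v](mulVKf (g0 k i im)) mulrC -scalerA.
  by apply: sub_stalkZ => //; exact: HV'.
exists (opensI U V), e, co, c, t, y; split=> //; split=> //.
- move=> i im z [_ Vz] v; exact: (HV z Vz (Ordinal (im : (i < m.+1)%N))).
- by move=> i im z [Uz _]; have [] := ty i im z Uz.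
- by move=> i im z [Uz _]; have [] := ty i im z Uz.
Qed.
End Frame.

(** * The modification in a frame *)

Section ModCoefficients.
Variables (K : fieldType) (R : set K) (t y : nat -> K) (m : nat).
Hypothesis RS : is_subring R.
Hypothesis t0 : forall l, (0 < l <= m)%N -> t l != 0.
Hypothesis y0 : forall l, (0 < l <= m)%N -> y l != 0.
Hypothesis Ry : forall l, (0 < l <= m)%N -> R (y l).
Hypothesis Rx : forall l, (0 < l <= m)%N -> R (t l / y l).
Hypothesis regular : forall i q, (i <= m)%N -> R (gap y 0 i * q) ->
  R (gap t 0 i / gap y 0 i * q) -> R q.

Lemma gap_neq0 (s : nat -> K) c j : (forall l, (0 < l <= m)%N -> s l != 0) ->
  (j <= m)%N -> gap s c j != 0.
Proof.
move=> s0; apply: (@gap_ind _ s (fun a => a != 0) m); rewrite ?oner_eq0 //.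
by move=> a b; exact: mulf_neq0.
Qed.

Lemma gap_in (s : nat -> K) c j : (forall l, (0 < l <= m)%N -> R (s l)) ->
  (j <= m)%N -> R (gap s c j).
Proof.
by move=> Rs; apply: (@gap_ind _ s R m); [exact: subring1 | exact: subringM |].
Qed.

Lemma gap_div c j : gap (fun l => t l / y l) c j = gap t c j / gap y c j.
Proof. by rewrite /gap prodf_div. Qed.

Let X c j := gap (fun l => t l / y l) c j.

(** A vector of level at most [j] acquires no new pole at step [j.+1]. Here [w] is a coordinate of
    [y_(j+1) v] for [v] in [E_j^1(dD_(j+1))]; membership in [E_j] controls the multiple of [q] by
    the equation of [D_(j+1)], membership in [E^(j+1)(delta_j)] the multiple by that of its
    complement, and [regular] combines the two. *)
Lemma mod_coef_low c j w : (c <= j)%N -> (j < m)%N -> R (gap y 0 c * w) ->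
  R ((gap t c j.+1)^-1 * (gap t 0 j * w)) -> R (gap y 0 c * ((y j.+1)^-1 * w)).
Proof.
move=> cj jm Rw Rt; set q := _ * (_ * w).
have cm : (c <= m)%N := leq_trans cj (ltnW jm).
have j1 : (0 < j.+1 <= m)%N by [].
apply: (regular jm).
  have -> : gap y 0 j.+1 * q = gap y 0 j * (gap y 0 c * w).
    by rewrite /q gapS leq0n; field; rewrite y0.
  by apply: subringM => //; exact: gap_in (ltnW jm).
have -> : gap t 0 j.+1 / gap y 0 j.+1 * q =
  X c j.+1 * (t j.+1 / y j.+1) * ((gap t c j.+1)^-1 * (gap t 0 j * w)).
  have := gap_neq0 c y0 jm; have := gap_neq0 c t0 jm.
  have := gap_neq0 0%N y0 cm; have := gap_neq0 0%N y0 (ltnW jm).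
  rewrite /X gap_div /q !gapS leq0n cj.
  rewrite [gap y 0 j](gapM _ (leq0n c) cj) !mulf_eq0 !negb_or.
  move=> /andP[a0 b0] _ /andP[d0 _] _; field.
  by rewrite a0 b0 d0 !y0 // t0.
by apply: subringM => //; apply: subringM; [|exact: gap_in | exact: Rx].
Qed.

(** A vector of level above [j] does acquire the pole along [dD_(j+1)]: the equation of [delta_j]
    clears a pole along [D_j], leaving the equation of the complement. *)
Lemma mod_coef_high j a : (j < m)%N -> R (gap y 0 j.+1 * a) ->
  R (gap t 0 j * (y j.+1 * a)).
Proof.
move=> jm Ra.
have -> : gap t 0 j * (y j.+1 * a) = X 0 j * (gap y 0 j.+1 * a).
  have j0 := gap_neq0 0%N y0 (ltnW jm).
  by rewrite /X gap_div gapS leq0n; field; rewrite j0.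
by apply: subringM => //; exact: gap_in (ltnW jm).
Qed.

Lemma mod_coef_t c j a : (j < m)%N -> R (gap y 0 (minn j.+1 c) * a) ->
  R (gap y 0 (minn j c) * (t j.+1 * a)).
Proof.
move=> jm; have j1 : (0 < j.+1 <= m)%N by [].
case: (leqP c j) => cj.
  rewrite (minn_idPr (leqW cj)) mulrCA => Ra; apply: subringM => //.
  by rewrite -[t _](divfK (y0 j1)); apply: subringM => //; [exact: Rx | exact: Ry].
rewrite (minn_idPl cj) gapS leq0n => Ra.
have -> : gap y 0 j * (t j.+1 * a) = t j.+1 / y j.+1 * (gap y 0 j * y j.+1 * a).
  by field; rewrite y0.
by apply: subringM => //; exact: Rx.
Qed.

Lemma mod_coef_mono c j a : (j < m)%N -> R (gap y 0 (minn j c) * a) ->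
  R (gap y 0 (minn j.+1 c) * a).
Proof.
move=> jm; case: (leqP c j) => cj.
  by rewrite (minn_idPr (leqW cj)).
rewrite (minn_idPl cj) gapS leq0n => Ra.
by rewrite mulrAC mulrC; apply: subringM => //; exact: Ry.
Qed.
End ModCoefficients.

Lemma co_cond (K : fieldType) (V : lmodType K) r (e : 'I_r -> V) co v k
    (P : pred 'I_r) : dual_basis e co ->
  co k (\sum_(l | P l) co l v *: e l) = if P k then co k v else 0.
Proof.
move=> B; rewrite big_mkcond -(co_sumE B k (fun l => if P l then co l v else 0)).
by congr (co k _); apply: eq_bigr => l _; case: (P l); rewrite ?scale0r.
Qed.

Section ModFrame.
Variables (X : integralScheme) (E : modSheaf X) (chi : echData E) (m : nat).
Variables (U : opens X) (r : nat) (e : 'I_r -> ratSections E).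
Variables (co : 'I_r -> ratSections E -> funField X) (c : 'I_r -> nat).
Variables (t y : nat -> funField X).
Hypothesis Fr : frame chi m U e co c t y.
Let B := frame_basis Fr.

Section Equations.
Variables (x : X).
Hypothesis Ux : oset U x.

Lemma frame_t_neq0 l : (0 < l <= m)%N -> t l != 0.
Proof. by move=> lm; exact: (eqn_neq0 (frame_t Fr lm Ux)). Qed.

Lemma frame_y_neq0 l : (0 < l <= m)%N -> y l != 0.
Proof. by move=> lm; exact: (eqn_neq0 (frame_y Fr lm Ux)). Qed.

Lemma gap_eqn (D : nat -> cartier X) (s : nat -> funField X) : D 0%N = cartier0 X ->
  (forall i, (0 < i <= m)%N -> cartierB (D i) (D i.-1) x (s i)) ->
  forall i, (i <= m)%N -> D i x (gap s 0 i).
Proof.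
move=> D0 Ds; elim=> [_|i IHi im].
  by rewrite D0 gap_geq //; exact: stalk_unit1.
rewrite gapS leq0n mulrC; apply: cartierB_eqnD (IHi (ltnW im)).
exact: (Ds i.+1).
Qed.
End Equations.

Hypothesis HE : is_echelon chi m.

Section AtPoint.
Variables (x : X).
Hypothesis Ux : oset U x.
Let RS := stalk_subring x.
Let t0 := frame_t_neq0 Ux.
Let y0 := frame_y_neq0 Ux.

Lemma frame_delta_eqn i : (i <= m)%N -> ech_delta chi i x (gap t 0 i).
Proof.
apply: (@gap_eqn x (ech_delta chi)); first by have [[]] := HE.
by move=> j jm; exact: (frame_t Fr _ Ux).
Qed.

Lemma frame_D_eqn i : (i <= m)%N -> ech_D chi i x (gap y 0 i).
Proof.
apply: (@gap_eqn x (ech_D chi)); first by have [] := HE.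
by move=> j jm; exact: (frame_y Fr _ Ux).
Qed.

Lemma frame_y_in l : (0 < l <= m)%N -> stalk x (y l).
Proof. by move=> lm; apply: (ech_dD_eff HE lm); exact: (frame_y Fr _ Ux). Qed.

Lemma frame_x_in l : (0 < l <= m)%N -> stalk x (t l / y l).
Proof.
move=> lm; apply: (cartier_leP (ech_dD_le HE lm)); first exact: (frame_y Fr _ Ux).
exact: (frame_t Fr _ Ux).
Qed.

Lemma frame_regular i q : (i <= m)%N -> stalk x (gap y 0 i * q) ->
  stalk x (gap t 0 i / gap y 0 i * q) -> stalk x q.
Proof.
move=> im; apply: (no_common_regular (ech_nocommon HE im)).
  exact: frame_D_eqn.
by apply: cartierB_eqn; [exact: frame_delta_eqn | exact: frame_D_eqn].
Qed.

Lemma frame_subE i v : (i <= m)%N -> ech_sub chi i x v <->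
  forall k, stalk x ((gap t (c k) i)^-1 * co k v).
Proof. by move=> im; exact: (frame_sub Fr im Ux). Qed.

Lemma frame_full v : sub_full E x v <-> forall k, stalk x (co k v).
Proof.
rewrite -(ech_sub0 (ech_pre HE) x) frame_subE //; split=> h k; have := h k;
  by rewrite gap_geq // invr1 mul1r.
Qed.

Lemma frame_t_in l : (0 < l <= m)%N -> stalk x (t l).
Proof.
by move=> lm; apply: (ech_ddelta_eff (ech_pre HE) lm); exact: (frame_t Fr _ Ux).
Qed.

Lemma frame_sub_le i v k : (i <= m)%N -> ech_sub chi i x v -> stalk x (co k v).
Proof.
move=> im /(frame_subE _ im)/(_ k) h.
rewrite -[co k v](mulVKf (gap_neq0 (c k) t0 im)); apply: stalkM => //.
exact: (gap_in RS _ frame_t_in im).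
Qed.

(* E_j^i = E_j n E^(i+j)(delta_j), the intersections with the earlier E_l being
   automatic. *)
Lemma stage_frame j : (j <= m)%N ->
  (forall v, (ech_stage chi j).1 x v <->
     forall k, stalk x (gap y 0 (minn j (c k)) * co k v)) /\
  (forall i, (i + j <= m)%N -> forall v, (ech_stage chi j).2 i x v <->
     (ech_stage chi j).1 x v /\ ech_sub chi (i + j) x (gap t 0 j *: v)).
Proof.
elim: j => [_|j IHj jm].
  split=> [v|i im v]; rewrite [(ech_stage chi 0).1]/= frame_full.
    by split=> h k; have := h k; rewrite min0n gap_geq // mul1r.
  rewrite [(ech_stage chi 0).2]/= addn0 gap_geq // scale1r; split=> [Ev|[]//].
  by split=> // k; apply: frame_sub_le Ev; rewrite addn0 in im.
have [IH1 IH2] := IHj (ltnW jm); have j1 : (0 < j.+1 <= m)%N by [].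
have yj : ech_dD chi j.+1 x (y j.+1) by exact: (frame_y Fr _ Ux).
have tj : ech_ddelta chi j.+1 x (t j.+1) by exact: (frame_t Fr _ Ux).
have lowP := mod_coef_low RS t0 y0 frame_y_in frame_x_in frame_regular.
have highP := mod_coef_high RS y0 frame_x_in.
have tP := mod_coef_t RS y0 frame_y_in frame_x_in.
have monoP := mod_coef_mono RS frame_y_in.
have H1 v : (ech_stage chi j.+1).1 x v <->
    forall k, stalk x (gap y 0 (minn j.+1 (c k)) * co k v).
  have tw := twistE ((ech_stage chi j).2 1%N) yj.
  split=> [[v1 [v2 [Fv1 Fv2 ->]]] k|h].
    rewrite (coD B) mulrDr; apply: stalkD; last first.
      by apply: monoP => //; exact: ((IH1 v2).1 Fv2 k).
    rewrite tw in Fv1; have {Fv1}[] := (IH2 1%N jm _).1 Fv1.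
    move=> /IH1/(_ k) h1 /(frame_subE _ jm)/(_ k).
    rewrite !(coZ B) in h1 *.
    have e1 : co k v1 = (y j.+1)^-1 * (y j.+1 * co k v1) by rewrite mulKf // y0.
    case: (leqP (c k) j) => ck h2.
      rewrite (minn_idPr (leqW ck)) e1; apply: lowP => //.
      by rewrite (minn_idPr ck) in h1.
    rewrite (minn_idPl ck) gapS leq0n -mulrA.
    by rewrite (minn_idPl (ltnW ck)) in h1.
  (* The two summands of [E_(j+1)] separate the levels: vectors of level above [j] get their new
     pole from [E_j^1(dD_(j+1))], the others are already in [E_j]. *)
  exists (\sum_(k | (j < c k)%N) co k v *: e k),
    (\sum_(k | ~~ (j < c k)%N) co k v *: e k); split.
  - rewrite tw; apply/IH2 => //; split.
      apply/IH1 => k; rewrite (coZ B) (co_cond _ _ _ B); case: ifP => ck.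
        have := h k; rewrite (minn_idPl ck) (minn_idPl (ltnW ck)) gapS leq0n.
        by rewrite mulrA.
      by rewrite !mulr0; exact: subring0.
    apply/frame_subE => // k; rewrite !(coZ B) (co_cond _ _ _ B); case: ifP => ck.
      rewrite gap_geq // invr1 mul1r; apply: highP => //.
      by have := h k; rewrite (minn_idPl ck).
    by rewrite !mulr0; exact: subring0.
  - apply/IH1 => k; rewrite (co_cond _ _ _ B); case: ifP => ck.
      rewrite -leqNgt in ck; have := h k.
      by rewrite (minn_idPr ck) (minn_idPr (leqW ck)).
    by rewrite !mulr0; exact: subring0.
  - by rewrite [LHS](coE B) (bigID (fun k => j < c k)%N).
split=> // i im v.
have tw := twistE ((ech_stage chi j).2 i.+1) tj.
have im' : (i.+1 + j <= m)%N by rewrite addSn -addnS.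
rewrite [(ech_stage _ _).2]/=; split=> [[Fv Gv]|[Gv Ev]].
  split=> //; rewrite tw in Fv; have [_] := (IH2 _ im' _).1 Fv.
  by rewrite scalerA addSn -addnS gapS.
split=> //; rewrite tw; apply/IH2 => //; split.
  (* Multiplication by [t_(j+1)] carries [E_(j+1)] into [E_j], so membership of the multiple in
     [E_j] adds no condition. *)
  by apply/IH1 => k; rewrite (coZ B); apply: tP => //; move: k; apply/H1.
by rewrite scalerA addSn -addnS; rewrite gapS in Ev.
Qed.
End AtPoint.

Lemma Mod_coord_lattice :
  coord_lattice (Mod chi m) U co (fun k => (gap y 0 (c k))^-1).
Proof.
move=> x Ux v; rewrite (stage_frame Ux (leqnn m)).1.
by split=> h k; have := h k; rewrite invrK (minn_idPr (frame_level Fr k)).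
Qed.
End ModFrame.

(** * Persistence from local frames *)

Section CoordSub.
Variables (X : integralScheme) (M : modSheaf X) (r : nat).
Variables (e : 'I_r -> ratSections M) (co : 'I_r -> ratSections M -> funField X).
Variable w : 'I_r -> funField X.
Hypothesis B : dual_basis e co.

Lemma coord_sub_exists : exists F : subSheaf M,
  forall x v, F x v <-> forall k, stalk x (w k * co k v).
Proof.
have L x := lattice_submod (stalk_local x) w B.
have open x v : (forall k, stalk x (w k * co k v)) ->
    exists U, oset U x /\ forall z, oset U z -> forall k, stalk z (w k * co k v).
  by move=> h; apply: finite_nbhd => k; exact: stalk_open.
exists (@SubSheaf X M (fun x => [set v | forall k, stalk x (w k * co k v)])
  (fun x => submod0 (L x)) (fun x v v' => @submodD _ _ _ _ (L x) v v')
  (fun x a v => @submodZ _ _ _ _ (L x) a v) open).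
by [].
Qed.
End CoordSub.

Section FramePersistence.
Variables (X : integralScheme) (E : modSheaf X) (chi : echData E) (m : nat).
Variables (U : opens X) (r : nat) (e : 'I_r -> ratSections E).
Variables (co : 'I_r -> ratSections E -> funField X) (c : 'I_r -> nat).
Variables (t y : nat -> funField X).
Hypothesis Fr : frame chi m U e co c t y.
Hypothesis st : forall l, (0 < l <= m)%N -> forall x, oset U x -> stalk x (t l).
Let B := frame_basis Fr.

Section AtPoint.
Variables (x : X).
Hypothesis Ux : oset U x.
Let RS := stalk_subring x.
Let t0 := frame_t_neq0 Fr Ux.
Let subE := frame_subE Fr Ux.

Lemma gap_split d i j a : (j <= i)%N -> (i <= m)%N ->
  stalk x ((gap t d i)^-1 * a) -> stalk x ((gap t d j)^-1 * a).
Proof.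
move=> ji im sa; have [dj|dj] := leqP d j.
  have -> : (gap t d j)^-1 * a = gap t j i * ((gap t d i)^-1 * a).
    rewrite (gapM t dj ji) invfM [_ * (gap t j i)^-1]mulrC -mulrA mulVKf //.
    exact: (gap_neq0 j t0 im).
  by apply: stalkM => //; apply: (gap_in RS _ _ im) => l lm; exact: st.
rewrite gap_geq ?(ltnW dj) // invr1 mul1r.
rewrite -[a](mulVKf (gap_neq0 d t0 im)).
by apply: stalkM => //; apply: (gap_in RS _ _ im) => l lm; exact: st.
Qed.

Variable i : nat.
Hypothesis im : (0 < i <= m)%N.
Let i_gt0 : (0 < i)%N. Proof. by case/andP: im. Qed.
Let i_le : (i <= m)%N. Proof. by case/andP: im. Qed.
Let tw j := twistNE (ech_sub chi j) (frame_t Fr im Ux).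
Let ti0 : t i != 0 := t0 im.
Let sti : stalk x (t i) := st im Ux.

Lemma gapi d : gap t d i = if (d < i)%N then gap t d i.-1 * t i else 1.
Proof. by rewrite -[in LHS](prednK i_gt0) gapS -ltnS prednK. Qed.

Lemma divt a : stalk x ((t i)^-1 * a) -> stalk x a.
Proof. by move=> sa; rewrite -[a](mulVKf ti0); exact: stalkM. Qed.

Lemma twist_frame j v : (j <= m)%N ->
  twist (ech_sub chi j) (cartierN (ech_ddelta chi i)) x v <->
  forall k, stalk x ((t i)^-1 * ((gap t (c k) j)^-1 * co k v)).
Proof.
move=> jm; rewrite tw /= subE //.
by split=> h k; have := h k; rewrite (coZ B) mulrCA.
Qed.

Lemma frame_twist_le v :
  twist (ech_sub chi i.-1) (cartierN (ech_ddelta chi i)) x v -> ech_sub chi i x v.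
Proof.
have im1 : (i.-1 <= m)%N := leq_trans (leq_pred i) i_le.
move=> /(twist_frame v im1) h; apply/subE => // k; have := h k.
rewrite gapi; case: ltnP => ck; first by rewrite invfM [_ * (t i)^-1]mulrC mulrA.
rewrite gap_geq; last exact: leq_trans (leq_pred i) ck.
by rewrite invr1 !mul1r; exact: divt.
Qed.

Variable j : nat.
Hypothesis ji : (j < i)%N.
Let jm : (j <= m)%N. Proof. exact: leq_trans (ltnW ji) i_le. Qed.
Let ji1 : (j <= i.-1)%N. Proof. by rewrite -ltnS prednK. Qed.

Lemma frame_twist_cap v : ech_sub chi i x v ->
  twist (ech_sub chi j) (cartierN (ech_ddelta chi i)) x v ->
  twist (ech_sub chi i.-1) (cartierN (ech_ddelta chi i)) x v.
Proof.
move=> /(subE _ i_le) h1 /(twist_frame v jm) h2.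
apply/twist_frame => [|k]; first exact: leq_trans (leq_pred i) i_le.
have := h1 k; have := h2 k; rewrite gapi; case: ltnP => ck.
  by move=> _; rewrite invfM [_ * (t i)^-1]mulrC mulrA.
rewrite !gap_geq //; first exact: leq_trans (leq_pred i) ck.
exact: leq_trans (ltnW ji) ck.
Qed.

Let Tj := twist (ech_sub chi j) (cartierN (ech_ddelta chi i)).
Let A := sub_add (ech_sub chi i) Tj.

(** Compared with [Tj], the only gain is on vectors of level at least [i], whose coefficients need
    no longer be divisible by [t i]. So [A / Tj] is free over [O / t_i] on these vectors. *)
Lemma frame_A v : A x v <-> forall k,
  if (c k < i)%N then stalk x ((t i)^-1 * ((gap t (c k) j)^-1 * co k v))
  else stalk x (co k v).
Proof.
split=> [[v1 [v2 [/(subE _ i_le) h1 /(twist_frame _ jm) h2 ->]]] k|h].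
  rewrite (coD B); have := h1 k; have := h2 k; rewrite gapi; case: ltnP => ck s2.
    rewrite invfM => s1; rewrite !mulrDr; apply: stalkD => //; rewrite mulrCA.
    apply: (gap_split ji1); first exact: leq_trans (leq_pred i) i_le.
    by rewrite mulrA.
  rewrite invr1 mul1r => s1; apply: stalkD => //; apply: divt.
  by rewrite gap_geq ?invr1 ?mul1r // in s2; exact: leq_trans (ltnW ji) ck.
exists (\sum_(k | ~~ (c k < i)%N) co k v *: e k),
  (\sum_(k | (c k < i)%N) co k v *: e k); split.
- apply/subE => // k; rewrite (co_cond _ _ _ B) gapi; have := h k.
  case: ltnP => ck /=; first by rewrite mulr0 => _; exact: subring0.
  by rewrite invr1 mul1r.
- apply/twist_frame => // k; rewrite (co_cond _ _ _ B); have := h k.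
  by case: ltnP => // ck; rewrite !mulr0 => _; exact: subring0.
- by rewrite [LHS](coE B) addrC (bigID (fun k => c k < i)%N).
Qed.

Section Quotient.
Let P := [pred k | (i <= c k)%N].

Lemma co_enum_val l0 (a : 'I_#|P| -> funField X) :
  co (enum_val l0) (\sum_l a l *: e (enum_val l)) = a l0.
Proof.
rewrite (co_sum B) (bigD1 l0) //= (coZ B) (co_dual B) eqxx mulr1.
rewrite big1 ?addr0 // => l ll0; rewrite (coZ B) (co_dual B).
by rewrite (inj_eq enum_val_inj) eq_sym (negPf ll0) mulr0.
Qed.

Lemma co_enum_out k (a : 'I_#|P| -> funField X) : (c k < i)%N ->
  co k (\sum_l a l *: e (enum_val l)) = 0.
Proof.
move=> ck; rewrite (co_sum B) big1 // => l _; rewrite (coZ B) (co_dual B).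
have [kl|] := eqVneq; last by rewrite mulr0.
by have := enum_valP l; rewrite -kl inE leqNgt ck.
Qed.

Lemma level_enum k : (i <= c k)%N -> exists l : 'I_#|P|, k = enum_val l.
Proof.
by move=> ck; have kP : k \in P by []; exists (enum_rank_in kP k); rewrite enum_rankK_in.
Qed.

Lemma frame_quot_gen (l : 'I_#|P|) : A x (e (enum_val l)).
Proof.
have cl : (i <= c (enum_val l))%N := enum_valP l.
apply/frame_A => k; rewrite (co_dual B); have [->|_] := eqVneq.
  by rewrite ltnNge cl; exact: stalk1.
by rewrite !mulr0; case: ifP => _; exact: subring0.
Qed.

Lemma frame_quot_span v : A x v -> exists a : 'I_#|P| -> funField X,
  (forall l, stalk x (a l)) /\ Tj x (v - \sum_l a l *: e (enum_val l)).
Proof.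
move=> /frame_A h; exists (fun l => co (enum_val l) v).
split=> [l|].
  by have := h (enum_val l); have := enum_valP l; rewrite inE leqNgt => /negPf ->.
apply/twist_frame => // k; rewrite (coB B); have [ck|ck] := ltnP (c k) i.
  by have := h k; rewrite co_enum_out // subr0 ck.
have [l ->] := level_enum ck; rewrite co_enum_val subrr !mulr0; exact: subring0.
Qed.

Lemma frame_quot_free (a : 'I_#|P| -> funField X) :
  Tj x (\sum_l a l *: e (enum_val l)) <->
  forall l, ideal_stalk (ech_ddelta chi i) x (a l).
Proof.
have Hi z := ideal_stalkE z (frame_t Fr im Ux).
rewrite (twist_frame _ jm); split=> [h l|h k].
  apply/Hi; have := h (enum_val l); have cl := enum_valP l; rewrite co_enum_val.
  rewrite gap_geq ?invr1 ?mul1r //.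
  exact: leq_trans (ltnW ji) cl.
have [ck|ck] := ltnP (c k) i.
  by rewrite co_enum_out // !mulr0; exact: subring0.
rewrite gap_geq ?invr1 ?mul1r; last exact: leq_trans (ltnW ji) ck.
by have [l ->] := level_enum ck; rewrite co_enum_val; apply/Hi.
Qed.
End Quotient.

Section Complement.
Variable Q : subSheaf E.
Hypothesis QE : forall z v, Q z v <-> forall k, stalk z
  ((if (c k < i)%N then (gap t (c k) j)^-1 else (t i)^-1) * co k v).

(** [Q] agrees with [E^j] on vectors of level below [i] and with [Tj] on the others, while [A] does
    the reverse; intersection and sum can be read off level by level. *)
Lemma frame_split : [/\ Tj x `<=` Q x, Q x `<=` ech_sub chi j x,
  A x `&` Q x = Tj x & sub_add A Q x = ech_sub chi j x].
Proof.
have TQ : Tj x `<=` Q x.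
  move=> v /(twist_frame _ jm) h; apply/QE => k; have := h k; case: ltnP => ck.
    exact: divt.
  by rewrite gap_geq ?invr1 ?mul1r //; exact: leq_trans (ltnW ji) ck.
have QEj : Q x `<=` ech_sub chi j x.
  move=> v /QE h; apply/subE => // k; have := h k; case: ltnP => // ck /divt.
  by rewrite gap_geq ?invr1 ?mul1r //; exact: leq_trans (ltnW ji) ck.
have AE : A x `<=` ech_sub chi j x.
  move=> v /frame_A h; apply/subE => // k; have := h k; case: ltnP => ck.
    exact: divt.
  by rewrite gap_geq ?invr1 ?mul1r //; exact: leq_trans (ltnW ji) ck.
split=> //; apply/seteqP; split=> v.
- move=> [/frame_A h1 /QE h2]; apply/twist_frame => // k.
  have := h1 k; have := h2 k; case: ltnP => // ck; rewrite gap_geq ?invr1 ?mul1r //.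
  exact: leq_trans (ltnW ji) ck.
- move=> Tv; split; last exact: TQ.
  by exists 0, v; split=> //; [exact: sub_stalk0 | rewrite add0r].
- move=> [v1 [v2 [Av Qv ->]]]; apply: sub_stalkD; [exact: AE | exact: QEj].
- move=> /(subE _ jm) h; exists (\sum_(k | ~~ (c k < i)%N) co k v *: e k),
    (\sum_(k | (c k < i)%N) co k v *: e k); split.
  + apply/frame_A => k; rewrite (co_cond _ _ _ B); have := h k.
    case: ltnP => ck /=; first by rewrite !mulr0 => _; exact: subring0.
    by rewrite gap_geq ?invr1 ?mul1r //; exact: leq_trans (ltnW ji) ck.
  + apply/QE => k; rewrite (co_cond _ _ _ B); have := h k.
    by case: ltnP => // ck; rewrite mulr0 => _; exact: subring0.
  + by rewrite [LHS](coE B) addrC (bigID (fun k => c k < i)%N).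
Qed.
End Complement.
End AtPoint.

Lemma frame_chain i x : (i < m)%N -> oset U x ->
  ech_sub chi i.+1 x `<=` ech_sub chi i x.
Proof.
move=> im Ux v /(frame_subE Fr Ux _ im) h; apply/(frame_subE Fr Ux _ (ltnW im)) => k.
exact: (gap_split Ux (leqnSn i) im).
Qed.
End FramePersistence.

(** Converse to the construction of frames. It serves for base change, where frames pull back but
    the kernels and images occurring in persistence are not directly accessible. *)
Lemma frames_persistence (X : integralScheme) (E : modSheaf X) (chi : echData E) m :
  (forall i, (0 < i <= m)%N -> effective (ech_ddelta chi i)) ->
  (forall x, exists U r e co c t y, oset U x /\ @frame X E chi m U r e co c t y) ->
  persistence chi m.
Proof.
move=> eff Hf i im.
have st U r e co c t y : @frame X E chi m U r e co c t y ->
    forall l, (0 < l <= m)%N -> forall x, oset U x -> stalk x (t l).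
  by move=> Fr l lm x Ux; apply: (eff l lm); exact: (frame_t Fr lm Ux).
split=> [x v|j ji].
  have [U [r [e [co [c [t [y [Ux Fr]]]]]]]] := Hf x.
  exact: (frame_twist_le Fr (st _ _ _ _ _ _ _ Fr) Ux im).
split=> [x v [Ev Tv]|x|x]; have [U [r [e [co [c [t [y [Ux Fr]]]]]]]] := Hf x.
- exact: (frame_twist_cap Fr Ux im ji).
- exists U, #|[pred k | (i <= c k)%N]|, (fun l => e (enum_val l)).
  split=> // z Uz; split=> [l|v|a _].
  + exact: (frame_quot_gen Fr (st _ _ _ _ _ _ _ Fr) Uz im ji).
  + exact: (frame_quot_span Fr (st _ _ _ _ _ _ _ Fr) Uz im ji).
  + exact: (frame_quot_free Fr Uz im ji).
- have [Q QE] := coord_sub_exists (fun k => if (c k < i)%N then (gap t (c k) j)^-1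
    else (t i)^-1) (frame_basis Fr).
  exists U, Q; split=> // z Uz.
  exact: (frame_split Fr (st _ _ _ _ _ _ _ Fr) Uz im ji QE).
Qed.

(** * Pullbacks and bases *)

Section OpenPushforward.
Variables (Y : ringedSpace) (V0 : opens Y) (N : modSheaf Y).
Implicit Types U V W : opens Y.

(** The restriction of [N] to [V0] pushed forward to [Y]. The universal property of an inverse image
    tests only modules on all of [Y], whereas coordinates for a basis over [U] exist only over the
    preimage of [U]; mapping into this sheaf bridges the two. *)
Definition push_sec W : Type := N (opensI W V0).
HB.instance Definition _ W := GRing.Zmodule.on (push_sec W).

Definition push_scale W (a : rO W) (s : push_sec W) : push_sec W :=
  rres (@opensIl _ W V0) a *: (s : N (opensI W V0)).

Fact push_scaleA W (a b : rO W) (s : push_sec W) :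
  push_scale a (push_scale b s) = push_scale (a * b) s.
Proof. by rewrite /push_scale scalerA rmorphM. Qed.

Fact push_scale1 W : left_id 1 (@push_scale W).
Proof. by move=> s; rewrite /push_scale rmorph1 scale1r. Qed.

Fact push_scaleDr W : right_distributive (@push_scale W) +%R.
Proof. by move=> a s s'; rewrite /push_scale scalerDr. Qed.

Fact push_scaleDl W (s : push_sec W) : {morph (@push_scale W)^~ s : a b / a + b}.
Proof. by move=> a b; rewrite /push_scale rmorphD scalerDl. Qed.

HB.instance Definition _ W := GRing.Zmodule_isLmodule.Build (rO W) (push_sec W)
  (@push_scaleA W) (@push_scale1 W) (@push_scaleDr W) (@push_scaleDl W).

Lemma opensSI U V : V `<=` U -> opensI V V0 `<=` opensI U V0.
Proof. by move=> h x [/h]. Qed.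

Definition push_res U V (h : V `<=` U) (s : push_sec U) : push_sec V :=
  mres (opensSI h) (s : N (opensI U V0)).

Lemma push_res_lin U V (h : V `<=` U) (a : rO U) (s t : push_sec U) :
  push_res h (a *: s + t) = rres h a *: push_res h s + push_res h t.
Proof.
have k := subset_trans (@opensIl _ V V0) h.
rewrite /push_res mres_lin (sheaf_comp (rO_sheaf Y) _ _ k).
by rewrite -(sheaf_comp (rO_sheaf Y) h (@opensIl _ V V0) k).
Qed.

Lemma push_is_sheaf : is_sheaf push_res.
Proof.
have NS := msec_sheaf N; split.
- by move=> U h s; rewrite /push_res; exact: (sheaf_id NS).
- by move=> U V W h h' h'' s; exact: mres_comp.
- move=> U I V h cov s t st.
  apply: (sheaf_sep NS (V := fun i => opensI (V i) V0) (h := fun i => opensSI (h i))).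
    by move=> x [/cov[i Vx] V0x]; exists i.
  exact: st.
- move=> U I V h cov s ov.
  have [t ht] : exists t, forall i, @mres _ N _ _ (opensSI (h i)) t = s i.
    apply: (sheaf_glue NS); first by move=> x [/cov[i Vx] V0x]; exists i.
    move=> i j W hi hj.
    have ki : W `<=` V i by move=> x /hi [].
    have kj : W `<=` V j by move=> x /hj [].
    have k : W `<=` opensI W V0 by move=> x Wx; split=> //; have [] := hi x Wx.
    have := congr1 (@mres _ N _ _ k) (ov i j W ki kj); rewrite /push_res.
    by rewrite !(mres_comp _ _ hi) !(mres_comp _ _ hj).
  by exists t.
Qed.

Definition pushforward : modSheaf Y := ModSheaf push_res_lin push_is_sheaf.
End OpenPushforward.

Section Sums.
Variables (Y : ringedSpace) (M N : modSheaf Y).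
Implicit Types U V W : opens Y.

Lemma mhomD W (g : mhom W M N) U (s t : M U) : U `<=` W -> g U (s + t) = g U s + g U t.
Proof. by move=> UW; have := mhom_lin g UW 1 s t; rewrite !scale1r. Qed.

Lemma mhom0 W (g : mhom W M N) U : U `<=` W -> g U 0 = 0.
Proof. by move=> UW; apply: (@addrI _ (g U 0)); rewrite -mhomD // !addr0. Qed.

Lemma mhomZ W (g : mhom W M N) U a (s : M U) : U `<=` W -> g U (a *: s) = a *: g U s.
Proof. by move=> UW; have := mhom_lin g UW a s 0; rewrite mhom0 // !addr0. Qed.

Lemma mhom_comb W (g : mhom W M N) U n (a : 'I_n -> rO U) (s : 'I_n -> M U) :
  U `<=` W -> g U (\sum_i a i *: s i) = \sum_i a i *: g U (s i).
Proof.
move=> UW; elim/big_rec2: _ => [|i v w _ <-]; first exact: mhom0.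
by rewrite mhomD // mhomZ.
Qed.

Lemma mres_comb U V (h : V `<=` U) n (a : 'I_n -> rO U) (s : 'I_n -> N U) :
  mres h (\sum_i a i *: s i) = \sum_i rres h (a i) *: mres h (s i).
Proof.
elim/big_rec2: _ => [|i v w _ <-]; first exact: mres0.
by rewrite mres_lin.
Qed.
End Sums.

Section Pullback.
Variables (Y X : ringedSpace) (f : smorph Y X) (M : modSheaf X).
Implicit Types U V W : opens X.

Section Maps.
Variables (N : modSheaf Y) (eta : fmodMap f M N).

Lemma fmodMapD U (s t : M U) : eta U (s + t) = eta U s + eta U t.
Proof. by have := fmodMap_lin eta 1 s t; rewrite !scale1r rmorph1 scale1r. Qed.

Lemma fmodMap0 U : eta U 0 = 0.
Proof. by apply: (@addrI _ (eta U 0)); rewrite -fmodMapD !addr0. Qed.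

Lemma fmodMap_comb U n (a : 'I_n -> rO U) (s : 'I_n -> M U) :
  eta U (\sum_i a i *: s i) = \sum_i sharp f U (a i) *: eta U (s i).
Proof.
elim/big_rec2: _ => [|i v w _ <-]; first exact: fmodMap0.
by rewrite fmodMap_lin.
Qed.
End Maps.

Section BasisCoordinates.
Variables (U : opens X) (r : nat) (e : 'I_r -> M U).
Hypothesis He : is_basis e.

Definition bcoord V (h : V `<=` U) (s : M V) : 'I_r -> rO V :=
  sval (cid ((He h).1 s)).

Lemma bcoordE V (h : V `<=` U) (s : M V) :
  s = \sum_i bcoord h s i *: mres h (e i).
Proof. exact: svalP (cid ((He h).1 s)). Qed.

Lemma bcoord_uniq V (h : V `<=` U) (a b : 'I_r -> rO V) :
  \sum_i a i *: mres h (e i) = \sum_i b i *: mres h (e i) -> forall i, a i = b i.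
Proof.
move=> /eqP; rewrite -subr_eq0 -sumrB => /eqP ab i; apply/eqP; rewrite -subr_eq0.
apply/eqP; apply: ((He h).2 (fun i => a i - b i)).
by rewrite -[RHS]ab; apply: eq_bigr => j _; rewrite scalerBl.
Qed.

Lemma bcoord_lin V (h : V `<=` U) a (s t : M V) i :
  bcoord h (a *: s + t) i = a * bcoord h s i + bcoord h t i.
Proof.
apply: (bcoord_uniq (h := h) (b := fun i => a * bcoord h s i + bcoord h t i)).
rewrite -bcoordE {1}(bcoordE h s) {1}(bcoordE h t) scaler_sumr -big_split.
by apply: eq_bigr => j _; rewrite scalerDl scalerA.
Qed.

Lemma bcoord_res V W (h : V `<=` U) (k : W `<=` V) (h' : W `<=` U) (s : M V) i :
  bcoord h' (mres k s) i = rres k (bcoord h s i).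
Proof.
apply: (bcoord_uniq (h := h') (b := fun i => rres k (bcoord h s i))).
rewrite -bcoordE {1}(bcoordE h s) mres_comb.
by apply: eq_bigr => j _; rewrite (mres_comp h k h').
Qed.

Lemma bcoord_e V (h : V `<=` U) i j : bcoord h (mres h (e j)) i = (i == j)%:R.
Proof.
apply: (bcoord_uniq (h := h) (b := fun i => (i == j)%:R)); rewrite -bcoordE.
rewrite (bigD1 j) //= eqxx scale1r big1 ?addr0 // => l /negPf ->.
by rewrite scale0r.
Qed.
End BasisCoordinates.

Section PullbackBasis.
Variables (N : modSheaf Y) (eta : fmodMap f M N).
Hypothesis Heta : is_pullback eta.
Variables (U : opens X) (r : nat) (e : 'I_r -> M U).
Hypothesis He : is_basis e.

Let V0 := spre f U.

Lemma spre_cap W : opensI (spre f W) V0 `<=` spre f (opensI W U).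
Proof. by []. Qed.

Lemma spreS V W : V `<=` W -> spre f V `<=` spre f W.
Proof. by move=> h y; exact: h. Qed.

(** The [i]-th coordinate functional over [U]. The outer restriction only passes between two open
    sets with the same points. *)
Let theta_fun i W (s : M W) : pushforward V0 (structure_sheaf Y) (spre f W) :=
  rres (@spre_cap W) (sharp f _ (bcoord He (@opensIr _ W U)
    (mres (@opensIl _ W U) s) i)).

Fact theta_lin i W (a : rO W) (s t : M W) :
  theta_fun i (a *: s + t) = sharp f W a *: theta_fun i s + theta_fun i t.
Proof.
rewrite /theta_fun mres_lin bcoord_lin !rmorphD !rmorphM; congr (_ * _ + _).
rewrite (sharp_res _ (spreS (@opensIl _ W U))).
exact: (sheaf_comp (rO_sheaf Y)).
Qed.

Fact theta_res i V W (h : W `<=` V) (h' : spre f W `<=` spre f V) (s : M V) :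
  theta_fun i (mres h s) = mres h' (theta_fun i s).
Proof.
have k : opensI W U `<=` opensI V U by exact: opensSI.
rewrite /theta_fun (mres_comp h _ (subset_trans (@opensIl _ W U) h)).
rewrite -(mres_comp (@opensIl _ V U) k) (bcoord_res _ (@opensIr _ V U) k).
rewrite (sharp_res _ (spreS k)) /= /push_res /=.
have hk : opensI (spre f W) V0 `<=` spre f (opensI V U).
  exact: subset_trans (@spre_cap W) (spreS k).
by rewrite !(sheaf_comp (rO_sheaf Y) _ _ hk).
Qed.

Let theta i : fmodMap f M (pushforward V0 (structure_sheaf Y)) :=
  FmodMap (@theta_lin i) (@theta_res i).

Let id_fun (W : opens Y) (s : N W) : pushforward V0 N W := mres (@opensIl _ W V0) s.

Fact id_lin (W : opens Y) : W `<=` opensT Y -> forall (a : rO W) (s t : N W),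
  id_fun (a *: s + t) = a *: id_fun s + id_fun t.
Proof. by move=> _ a s t; rewrite /id_fun mres_lin. Qed.

Fact id_res (V W : opens Y) (h : W `<=` V) : V `<=` opensT Y -> forall s : N V,
  id_fun (mres h s) = mres h (id_fun s).
Proof.
move=> _ s; rewrite /= /push_res /id_fun.
have k := subset_trans (@opensIl _ W V0) h.
by rewrite (mres_comp _ _ k) (mres_comp _ _ k).
Qed.

Let to_push : mhom (opensT Y) N (pushforward V0 N) := Mhom id_lin id_res.

Section Decomposition.
Variable g : 'I_r -> mhom (opensT Y) N (pushforward V0 (structure_sheaf Y)).
Hypothesis gE : forall i W (s : M W), g i _ (eta W s) = theta i W s.

Let T (W : opens Y) : W `<=` opensT Y. Proof. by []. Qed.

Let dec_fun (W : opens Y) (s : N W) : pushforward V0 N W :=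
  \sum_i (g i W s : rO (opensI W V0)) *: mres (@opensIr _ W V0) (eta U (e i)).

Fact dec_lin (W : opens Y) : W `<=` opensT Y -> forall (a : rO W) (s t : N W),
  dec_fun (a *: s + t) = a *: dec_fun s + dec_fun t.
Proof.
move=> _ a s t; pose u i : N (opensI W V0) := mres (@opensIr _ W V0) (eta U (e i)).
pose b i (s' : N W) : rO (opensI W V0) := g i W s'.
transitivity (\sum_i (rres (@opensIl _ W V0) a * b i s + b i t) *: u i).
  by apply: eq_bigr => i _; rewrite mhom_lin.
under eq_bigr do rewrite scalerDl -scalerA.
by rewrite big_split -scaler_sumr.
Qed.

Fact dec_res (V W : opens Y) (h : W `<=` V) : V `<=` opensT Y -> forall s : N V,
  dec_fun (mres h s) = mres h (dec_fun s).
Proof.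
move=> _ s; rewrite /= /push_res /dec_fun mres_comb; apply: eq_bigr => i _.
rewrite mhom_res // (mres_comp _ (opensSI h) (@opensIr _ W V0)).
by [].
Qed.

Let dec : mhom (opensT Y) N (pushforward V0 N) := Mhom dec_lin dec_res.

Lemma dec_eta W (s : M W) : dec _ (eta W s) = to_push _ (eta W s).
Proof.
rewrite /= /dec_fun /id_fun.
pose k := @spre_cap W.
transitivity (mres k (eta _ (mres (@opensIl _ W U) s))); last first.
  rewrite (fmodMap_res eta _ (spreS (@opensIl _ W U))).
  exact: mres_comp.
rewrite [in RHS](bcoordE He (@opensIr _ W U) (mres _ s)) fmodMap_comb mres_comb.
apply: eq_bigr => i _; rewrite gE /= /theta_fun.
rewrite (fmodMap_res eta _ (spreS (@opensIr _ W U))).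
by rewrite (mres_comp _ _ (@opensIr _ (spre f W) V0)).
Qed.

(** Expansion in the [eta U (e i)] and restriction to [V0] agree on the image of [eta], so the
    uniqueness half of the universal property makes them equal on all of [N]. This yields
    generation. *)
Lemma dec_id (W : opens Y) (s : N W) : dec _ s = to_push _ s.
Proof.
have lin V a (s1 s2 : M V) : to_push _ (eta V (a *: s1 + s2)) =
    sharp f V a *: to_push _ (eta V s1) + to_push _ (eta V s2).
  by rewrite fmodMap_lin mhom_lin.
have res V V' (h : V' `<=` V) (h' : spre f V' `<=` spre f V) (s1 : M V) :
    to_push _ (eta V' (mres h s1)) = mres h' (to_push _ (eta V s1)).
  by rewrite (fmodMap_res eta h h') mhom_res.
pose th := FmodMap lin res.
have [h [_ uniq]] := Heta th.
by rewrite (uniq dec) ?(uniq to_push) // => V s1; exact: dec_eta.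
Qed.

Lemma decomposed_basis : is_basis (fun k => eta U (e k)).
Proof.
move=> W h; have k : W `<=` opensI W V0 by move=> y Wy; split=> //; exact: h.
split=> [s|a a0 j].
  exists (fun i => rres k (g i W s : rO (opensI W V0))).
  have := congr1 (fun v : N (opensI W V0) => mres k v) (dec_id s).
  rewrite /= /dec_fun /id_fun mres_comb (mres_comp _ k (@subset_refl _ _)).
  rewrite (sheaf_id (msec_sheaf N)) => sE; rewrite -[LHS]sE; apply: eq_bigr => i _.
  by rewrite (mres_comp _ k h).
have := congr1 (g j W) a0; rewrite mhom0 // mhom_comb // => sum0.
have gj i : g j W (mres h (eta U (e i))) = (j == i)%:R :> rO (opensI W V0).
  rewrite mhom_res // gE /= /push_res /theta_fun.
  have -> : mres (@opensIl _ U U) (e i) = mres (@opensIr _ U U) (e i).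
    exact: mres_irr.
  by rewrite bcoord_e /= !rmorph_nat.
have {sum0}: (rres (@opensIl _ W V0) (a j) : rO (opensI W V0)) = 0.
  rewrite -[RHS]sum0 (bigD1 j) //= big1 => [|i ij].
    by rewrite addr0 gj eqxx; exact: (esym (mulr1 _)).
  by rewrite gj eq_sym (negPf ij) scaler0.
move=> /(congr1 (rres k)); rewrite rmorph0 => <-.
rewrite (sheaf_comp (rO_sheaf Y) _ _ (@subset_refl _ _)).
by rewrite (sheaf_id (rO_sheaf Y)).
Qed.
End Decomposition.

(** The existence half of the universal property extends the coordinate functionals of [e] to [N];
    they are dual to the [eta U (e k)]. *)
Lemma pullback_basis : is_basis (fun k => eta U (e k)).
Proof.
pose ex i := Heta (theta i).
apply: (@decomposed_basis (fun i => sval (cid (ex i)))) => i W s.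
by have [h _] := svalP (cid (ex i)); exact: h.
Qed.
End PullbackBasis.
End Pullback.

(** * Recognizing an inverse image by its local bases *)

Section PullbackOfBases.
Variables (Y X : ringedSpace) (f : smorph Y X) (M : modSheaf X) (N : modSheaf Y).
Variable eta : fmodMap f M N.
Hypothesis bases : forall x : X, exists (U : opens X) r (e : 'I_r -> M U),
  [/\ oset U x, is_basis e & is_basis (fun k => eta U (e k))].
Implicit Types W Z : opens Y.

Lemma local_comb W (y : Y) (t : N W) : oset W y ->
  exists (U : opens X) r (e : 'I_r -> M U) Z (k : Z `<=` W) (l : Z `<=` spre f U)
    (a : 'I_r -> rO Z), oset Z y /\ mres k t = \sum_i a i *: mres l (eta U (e i)).
Proof.
move=> Wy; have [U [r [e [Uy He Heta]]]] := bases (f y).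
have [/(_ (mres (@opensIl _ W (spre f U)) t))[a aE] _] := Heta _ (@opensIr _ W (spre f U)).
by exists U, r, e, (opensI W (spre f U)), (@opensIl _ W (spre f U)),
  (@opensIr _ W (spre f U)), a.
Qed.

Section Extension.
Variables (P : modSheaf Y) (theta : fmodMap f M P).

(** The graph of the map to be constructed. Quantifying over all local expressions of [t] avoids
    choosing bases: [p] is unique because such expressions exist locally, and this uniqueness lets
    the local solutions glue. *)
Definition corresponds W (t : N W) (p : P W) : Prop :=
  forall (U : opens X) n (s : 'I_n -> M U) Z (k : Z `<=` W) (l : Z `<=` spre f U)
    (a : 'I_n -> rO Z),
    mres k t = \sum_i a i *: mres l (eta U (s i)) ->
    mres k p = \sum_i a i *: mres l (theta U (s i)).

Lemma corresponds_res W Z (h : Z `<=` W) t p :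
  corresponds t p -> corresponds (mres h t) (mres h p).
Proof.
move=> tp U n s Z' k l a; have kh := subset_trans k h.
by rewrite !(mres_comp h k kh); exact: tp.
Qed.

Lemma corresponds_uniq W (t : N W) p p' :
  corresponds t p -> corresponds t p' -> p = p'.
Proof.
move=> tp tp'.
pose I := {y : Y | oset W y}.
have ex (i : I) : exists Z (k : Z `<=` W), oset Z (sval i) /\ mres k p = mres k p'.
  have [U [r [e [Z [k [l [a [Zy tE]]]]]]]] := local_comb t (svalP i).
  by exists Z, k; split=> //; rewrite (tp _ _ _ _ _ _ _ tE) (tp' _ _ _ _ _ _ _ tE).
pose Z i := sval (cid (ex i)).
have HZ i : exists k : Z i `<=` W, oset (Z i) (sval i) /\ mres k p = mres k p'.
  exact: svalP (cid (ex i)).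
apply: (sheaf_sep (msec_sheaf P) (V := Z) (h := fun i => sval (cid (HZ i)))).
  by move=> y Wy; exists (exist _ y Wy); have [k []] := HZ (exist _ y Wy).
by move=> i; have [] := svalP (cid (HZ i)).
Qed.

(* The relation between two frames of M over overlapping open sets is respected
   by both eta and theta. *)
Lemma corresponds_basis (U : opens X) r (e : 'I_r -> M U) W (h : W `<=` spre f U)
    (a : 'I_r -> rO W) : is_basis e -> is_basis (fun k => eta U (e k)) ->
  corresponds (\sum_i a i *: mres h (eta U (e i)))
              (\sum_i a i *: mres h (theta U (e i))).
Proof.
move=> He Heta U' n s Z k l a' tE.
have kh := subset_trans k h.
pose D := opensI U U'.
have hD : Z `<=` spre f D.
  by move=> y Zy; split; [exact: (kh y Zy) | exact: (l y Zy)].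
pose b j i := rres hD (sharp f D (bcoord He (@opensIl _ U U')
  (mres (@opensIr _ U U') (s j)) i)).
have res (Q : modSheaf Y) (th : fmodMap f M Q) j :
    mres l (th U' (s j)) = \sum_i b j i *: mres kh (th U (e i)).
  transitivity (mres hD (th D (mres (@opensIr _ U U') (s j)))).
    rewrite (fmodMap_res th _ (spreS (@opensIr _ U U'))).
    by rewrite (mres_comp _ _ l).
  rewrite [in LHS](bcoordE He (@opensIl _ U U') (mres _ (s j))) fmodMap_comb mres_comb.
  apply: eq_bigr => i _; congr (_ *: _).
  rewrite (fmodMap_res th _ (spreS (@opensIl _ U U'))).
  exact: mres_comp.
have swap (Q : modSheaf Y) (th : fmodMap f M Q) :
    \sum_j a' j *: mres l (th U' (s j)) =
    \sum_i (\sum_j a' j * b j i) *: mres kh (th U (e i)).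
  transitivity (\sum_j \sum_i (a' j * b j i) *: mres kh (th U (e i))).
    apply: eq_bigr => j _; rewrite res scaler_sumr.
    by apply: eq_bigr => i _; rewrite scalerA.
  by rewrite exchange_big; apply: eq_bigr => i _; rewrite scaler_suml.
(* The [b j i] are coordinates in [M], hence the same for [eta] and [theta]. Independence of the
   [eta U (e i)] turns the given relation in [N] into one between coefficients, which then holds in
   [P]. *)
have aE i : rres k (a i) = \sum_j a' j * b j i.
  apply: (bcoord_uniq Heta (h := kh) (a := fun i => rres k (a i))
    (b := fun i => \sum_j a' j * b j i)).
  rewrite -swap -tE mres_comb; apply: eq_bigr => i' _.
  by rewrite (mres_comp h k kh).
rewrite swap mres_comb; apply: eq_bigr => i _.
by rewrite (mres_comp h k kh) aE.
Qed.

Lemma corresponds_ex W (t : N W) : exists p, corresponds t p.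
Proof.
pose I := {y : Y | oset W y}.
have ex (i : I) : exists Z, exists2 k : Z `<=` W, oset Z (sval i) &
    exists p, corresponds (mres k t) p.
  have [U [r [e [Uy He Heta]]]] := bases (f (sval i)).
  exists (opensI W (spre f U)), (@opensIl _ W (spre f U)).
    by split=> //; exact: svalP i.
  have [/(_ (mres (@opensIl _ W (spre f U)) t))[a ->] _] :=
    Heta _ (@opensIr _ W (spre f U)).
  by exists (\sum_i a i *: mres (@opensIr _ W (spre f U)) (theta U (e i)));
    exact: corresponds_basis.
pose Z i := sval (cid (ex i)).
have HZ i : exists2 k : Z i `<=` W, oset (Z i) (sval i) &
    exists p, corresponds (mres k t) p.
  exact: svalP (cid (ex i)).
pose k i : Z i `<=` W := s2val (cid2 (HZ i)).
have Zi i : oset (Z i) (sval i) := s2valP (cid2 (HZ i)).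
have exp i : exists p, corresponds (mres (k i) t) p := s2valP' (cid2 (HZ i)).
pose p i : P (Z i) := sval (cid (exp i)).
have Hp i : corresponds (mres (k i) t) (p i) := svalP (cid (exp i)).
have [q Hq] : exists q, forall i, mres (k i) q = p i.
  apply: (sheaf_glue (msec_sheaf P)).
    by move=> y Wy; exists (exist _ y Wy); exact: (Zi (exist _ y Wy)).
  move=> i j Z' hi hj; have kh := subset_trans hi (k i).
  apply: (@corresponds_uniq _ (mres kh t)).
    by rewrite -(mres_comp (k i) hi kh); exact: corresponds_res.
  by rewrite -(mres_comp (k j) hj kh); exact: corresponds_res.
exists q => U n s Z' k' l a tE.
pose V i := opensI Z' (Z i).
apply: (sheaf_sep (msec_sheaf P) (V := V) (h := fun i => @opensIl _ Z' (Z i))).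
  by move=> y Z'y; exists (exist _ y (k' y Z'y)).
move=> i; have kV := subset_trans (@opensIl _ Z' (Z i)) k'.
have lV := subset_trans (@opensIl _ Z' (Z i)) l.
rewrite (mres_comp _ _ kV) -(mres_comp (k i) (@opensIr _ Z' (Z i)) kV) Hq mres_comb.
rewrite (Hp i U n s _ _ lV (fun j => rres (@opensIl _ Z' (Z i)) (a j))).
  by apply: eq_bigr => j _; rewrite (mres_comp _ _ lV).
rewrite (mres_comp _ _ kV) -(mres_comp k' (@opensIl _ Z' (Z i)) kV) tE mres_comb.
by apply: eq_bigr => j _; rewrite (mres_comp _ _ lV).
Qed.

Let ext W (t : N W) : P W := sval (cid (corresponds_ex t)).
Let extP W (t : N W) : corresponds t (ext t) := svalP (cid (corresponds_ex t)).

Fact ext_lin W : W `<=` opensT Y -> forall (b : rO W) (t t' : N W),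
  ext (b *: t + t') = b *: ext t + ext t'.
Proof.
move=> _ b t t'.
pose I := {y : Y | oset W y}.
pose Bs (i : I) (U : opens X) := exists r (e : 'I_r -> M U),
  [/\ oset U (f (sval i)), is_basis e & is_basis (fun k => eta U (e k))].
have ex (i : I) : exists U, Bs i U by exact: bases.
pose U i := sval (cid (ex i)); have HU i : Bs i (U i) := svalP (cid (ex i)).
apply: (sheaf_sep (msec_sheaf P) (V := fun i => opensI W (spre f (U i)))
  (h := fun i => @opensIl _ W (spre f (U i)))).
  move=> y Wy; exists (exist _ y Wy); split=> //.
  by have [r [e []]] := HU (exist _ y Wy).
move=> i; have [r [e [Uy He Heta]]] := HU i.
set k := @opensIl _ _ _; pose l := @opensIr _ W (spre f (U i)).
have [/(_ (mres k t))[a tE] _] := Heta _ l; have [/(_ (mres k t'))[a' tE'] _] := Heta _ l.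
rewrite (@extP _ _ _ _ e _ k l (fun i => rres k b * a i + a' i)).
  rewrite mres_lin (@extP _ _ _ _ e _ k l _ tE) (@extP _ _ _ _ e _ k l _ tE').
  rewrite scaler_sumr -big_split; apply: eq_bigr => j _.
  by rewrite scalerA scalerDl.
rewrite mres_lin tE tE' scaler_sumr -big_split; apply: eq_bigr => j _.
by rewrite scalerA scalerDl.
Qed.

Fact ext_res W Z (h : Z `<=` W) : W `<=` opensT Y -> forall t : N W,
  ext (mres h t) = mres h (ext t).
Proof.
move=> _ t; apply: (@corresponds_uniq _ (mres h t)); first exact: extP.
by apply: corresponds_res; exact: extP.
Qed.

Lemma pullback_extension : exists h : mhom (opensT Y) N P,
  (forall U s, h _ (eta U s) = theta U s) /\
  forall h' : mhom (opensT Y) N P,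
    (forall U s, h' _ (eta U s) = theta U s) -> forall V t, h' V t = h V t.
Proof.
pose h : mhom (opensT Y) N P := Mhom ext_lin ext_res.
have hE U s : h _ (eta U s) = theta U s.
  have := @extP _ (eta U s) U 1 (fun=> s) _ (@subset_refl _ _) (@subset_refl _ _)
    (fun=> 1).
  rewrite !big_ord1 !scale1r (sheaf_id (msec_sheaf N)) !(sheaf_id (msec_sheaf P)).
  by apply.
exists h; split=> // h' h'E W t; apply: (@corresponds_uniq _ t); last exact: extP.
move=> U n s Z k l a tE; rewrite -mhom_res // tE mhom_comb //.
by apply: eq_bigr => i _; rewrite mhom_res // h'E.
Qed.
End Extension.

Lemma pullback_of_bases : is_pullback eta.
Proof. by move=> P theta; exact: pullback_extension. Qed.
End PullbackOfBases.

(** * Maps of rational sections *)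

Section RationalMaps.
Variable X : integralScheme.
Implicit Types (x y : X) (U V W : opens X).

(** A nonempty open set meets the domain of every rational section, so [phi] induces a map at the
    generic point. *)
Lemma mhom_rat (M L : modSheaf X) W (phi : mhom W M L) : W !=set0 ->
  exists psi : ratSections M -> ratSections L,
    (forall a v w, psi (a *: v + w) = a *: psi v + psi w) /\
    forall U (s : M U), U `<=` W -> U !=set0 -> psi (germ s) = germ (phi U s).
Proof.
move=> W0; pose psi v := germ (phi _ (mres (@opensIr _ W (rat_dom v)) (rat_sec v))).
have psiE U (s : M U) : U `<=` W -> U !=set0 -> psi (germ s) = germ (phi U s).
  move=> UW U0; have /(germ_eqP _ _ (rat_dom_ne _) U0)[V [h [h' [V0 e]]]] :=
    germ_sec (germ s).
  have k : V `<=` opensI W (rat_dom (germ s)).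
    by move=> x Vx; split; [exact: (UW x (h' x Vx)) | exact: (h x Vx)].
  rewrite /psi -[LHS](germ_res k) // -[RHS](germ_res h') // -!mhom_res //; last exact: opensIl.
  by rewrite (mres_comp _ k h) e.
exists psi; split=> // a v w; have [U [b [s [t [U0 -> -> ->]]]]] := funFieldW a v w.
have UW0 := opens_meet U0 W0; pose h := @opensIl _ U W; pose k := @opensIr _ U W.
rewrite -germZ -germD -(fgerm_res h) // -!(germ_res h) // !psiE // mres_lin.
by rewrite mhom_lin // germD germZ.
Qed.

Section Free.
Variables (r : nat) (L : modSheaf X).
Hypothesis HL : locally_free r L.

(** Locally free sheaves have no torsion here: the coordinates of [s] in a local basis vanish in the
    function field, where sections inject. *)
Lemma free_germ_eq0 U (s : L U) : U !=set0 -> germ s = 0 -> s = 0.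
Proof.
move=> U0 s0; pose I := {x | oset U x}.
have ex (i : I) : exists V, exists2 h : V `<=` U, oset V (sval i) & mres h s = 0.
  have [V [e [Vx He]]] := HL (sval i); have Ux := svalP i.
  have UVx : oset (opensI U V) (sval i) by [].
  have UV0 : opensI U V !=set0 by exists (sval i).
  have V0 : V !=set0 by exists (sval i).
  exists (opensI U V), (@opensIl _ U V) => //.
  have [/(_ (mres (@opensIl _ U V) s))[a sE] _] := He _ (@opensIr _ U V).
  have a0 : \sum_k fgerm (a k) *: germ (e k) = 0.
    rewrite -(rm_comb (germ_model L) (@opensIr _ U V)) // -sE.
    by rewrite germ_res.
  rewrite sE big1 // => k _; rewrite (_ : a k = 0) ?scale0r //.
  apply: fgerm_eq0 => //.
  exact: (rm_free (germ_model L) (a := fun k => fgerm (a k)) V0 He a0).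
pose V i := sval (cid (ex i)).
have HV i : exists2 h : V i `<=` U, oset (V i) (sval i) & mres h s = 0.
  exact: svalP (cid (ex i)).
pose h i := s2val (cid2 (HV i)).
apply: (sheaf_sep (msec_sheaf L) (V := V) (h := h)).
  by move=> x Ux; exists (exist _ x Ux); exact: s2valP (cid2 (HV (exist _ x Ux))).
by move=> i; rewrite mres0; exact: s2valP' (cid2 (HV i)).
Qed.

Lemma free_germ_inj U (s t : L U) : U !=set0 -> germ s = germ t -> s = t.
Proof.
move=> U0 st; apply/eqP; rewrite -subr_eq0; apply/eqP; apply: free_germ_eq0 => //.
by rewrite germD germN st subrr.
Qed.

Lemma free_section U v : U !=set0 -> (forall x, oset U x -> sub_full L x v) ->
  exists s : L U, germ s = v.
Proof.
move=> [x0 Ux0] Lv; pose I := {x | oset U x}.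
have ex : forall i : I, exists V (s : L V),
    [/\ oset V (sval i), V `<=` U & germ s = v].
  move=> [x Ux] /=; have [V [s [Vx ->]]] := Lv x Ux.
  exists (opensI U V), (mres (@opensIr _ U V) s).
  split=> //; first exact: opensIl.
  by rewrite germ_res //; exists x.
pose V i := sval (cid (ex i)); pose exs i := svalP (cid (ex i)).
pose s i : L (V i) := sval (cid (exs i)).
have Hs i : [/\ oset (V i) (sval i), V i `<=` U & germ (s i) = v].
  exact: svalP (cid (exs i)).
have h i : V i `<=` U by have [] := Hs i.
have [t ht] : exists t, forall i, mres (h i) t = s i.
  apply: (sheaf_glue (msec_sheaf L)).
    by move=> x Ux; exists (exist _ x Ux); have [] := Hs (exist _ x Ux).
  move=> i j Z hi hj; case: (pselect (Z !=set0)) => Z0; last exact: msec_empty.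
  apply: free_germ_inj => //; rewrite !germ_res //.
  by have [_ _ ->] := Hs i; have [_ _ ->] := Hs j.
exists t; have [Vx _ <-] := Hs (exist _ x0 Ux0).
by rewrite -ht germ_res //; exists x0.
Qed.

Lemma free_basis U (e : 'I_r -> L U) co : U !=set0 ->
  dual_basis (fun k => germ (e k)) co ->
  (forall x, oset U x -> forall v, sub_full L x v -> forall k, stalk x (co k v)) ->
  is_basis e.
Proof.
move=> U0 B Lco V h.
have [V0|V0] := pselect (V !=set0); last first.
  split=> [s|a _ i]; last exact: rO_empty.
  by exists (fun=> 0); exact: msec_empty.
have GM := germ_model L.
split=> [s|a a0 i].
  have /choice[a aE] : forall k, exists a : rO V, fgerm a = co k (germ s).
    move=> k; apply: stalk_section => // x Vx; apply: Lco; first exact: h.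
    by exists V, s.
  exists a; apply: free_germ_inj => //; rewrite (rm_comb GM h) //.
  by rewrite [LHS](coE B); apply: eq_bigr => k _; rewrite aE.
apply: fgerm_eq0 => //; rewrite -(co_sumE B i (fun i => fgerm (a i))).
by rewrite -(rm_comb GM h) // a0 germ0 (co0 B).
Qed.

Lemma lift_mhom (M : modSheaf X) (Z : lmodType (funField X))
    (rho : forall U, M U -> Z) W (psi : Z -> ratSections L) :
  rational_model rho -> (forall a v w, psi (a *: v + w) = a *: psi v + psi w) ->
  (forall U (s : M U), U `<=` W -> U !=set0 ->
    forall x, oset U x -> sub_full L x (psi (rho U s))) ->
  exists h : mhom W M L, forall U (s : M U), U `<=` W -> U !=set0 ->
    germ (h U s) = psi (rho U s).
Proof.
move=> HM psi_lin psiL.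
(* The default 0 fills the open sets not contained in [W], where the values of a [mhom] are
   irrelevant. *)
pose h U (s : M U) : L U := xget 0 [set t | germ t = psi (rho U s)].
have hE U (s : M U) : U `<=` W -> U !=set0 -> germ (h U s) = psi (rho U s).
  move=> UW U0; rewrite /h; case: xgetP => [t _ //|no].
  by have [t /no] := free_section U0 (psiL U s UW U0).
have h_lin U : U `<=` W -> forall (a : rO U) (s t : M U),
    h U (a *: s + t) = a *: h U s + h U t.
  move=> UW a s t; have [U0|U0] := pselect (U !=set0); last exact: msec_empty.
  by apply: free_germ_inj => //; rewrite germD germZ !hE // (rm_lin HM).
have h_res U V (k : V `<=` U) : U `<=` W -> forall s : M U,
    h V (mres k s) = mres k (h U s).
  move=> UW s; have [V0|V0] := pselect (V !=set0); last exact: msec_empty.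
  have U0 : U !=set0 by case: V0 => x /k; exists x.
  apply: free_germ_inj => //; rewrite germ_res // !hE //; last exact: subset_trans UW.
  by rewrite (rm_res HM).
by exists (Mhom h_lin h_res).
Qed.
End Free.

Lemma sub_mhom (M N : modSheaf X) (F : subSheaf M) (G : subSheaf N)
    (psi : ratSections M -> ratSections N) :
  (forall a v w, psi (a *: v + w) = a *: psi v + psi w) ->
  (forall x v, F x v -> G x (psi v)) ->
  exists h : mhom (opensT X) (sheaf_of_sub F) (sheaf_of_sub G),
    forall U (v : subsec F U), subsec_val (h U v) = psi (subsec_val v).
Proof.
move=> psi_lin FG.
have psi0 : psi 0 = 0.
  by have := psi_lin (-1) 0 0; rewrite scaler0 addr0 scaleN1r addNr.
have hP U (v : subsec F U) : subsec_pred G U (psi (subsec_val v)).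
  apply/asboolP; split=> [x Ux|]; first by apply/FG/subsec_stalk.
  have [U0|U0] := pselect (U !=set0); [by left | right].
  by rewrite (_ : subsec_val v = 0) //; exact: subsec_empty.
pose h U (v : sheaf_of_sub F U) : sheaf_of_sub G U := Subsec (hP U v).
have h_lin U : U `<=` opensT X -> forall (a : rO U) s t,
    h U (a *: s + t) = a *: h U s + h U t.
  by move=> _ a s t; apply: val_inj; rewrite /= psi_lin.
have h_res U V (k : V `<=` U) : U `<=` opensT X -> forall s,
    h V (mres k s) = mres k (h U s).
  by move=> _ s; apply: val_inj => /=; case: pselect.
by exists (Mhom h_lin h_res).
Qed.
End RationalMaps.

(** * Properties of the modification *)

(* The coefficients of E^i(D_i), and of a functional vanishing on E^i along D_i,
   on a basis vector of level c. *)
Lemma level_coef (K : fieldType) (R : set K) (t y : nat -> K) m c i a :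
  is_subring R -> (forall l, (0 < l <= m)%N -> t l != 0) ->
  (forall l, (0 < l <= m)%N -> y l != 0) -> (forall l, (0 < l <= m)%N -> R (y l)) ->
  (forall l, (0 < l <= m)%N -> R (t l / y l)) -> (c <= m)%N -> (i <= m)%N ->
  R ((gap t c i)^-1 * a) -> R ((gap y 0 i)^-1 * (gap y 0 c * a)).
Proof.
(* With [Y_i] for [gap y 0 i]: if [i <= c], the quotient [Y_c / Y_i] is integral. Otherwise [a] is
   divisible by [gap t c i], of which [Y_i / Y_c = gap y c i] is a divisor. *)
move=> RS t0 y0 Ry Rx cm im; have [ic|ci] := leqP i c => Ra.
  have -> : (gap y 0 i)^-1 * (gap y 0 c * a) = gap y i c * a.
    have i0 := gap_neq0 0 y0 im.
    by rewrite (gapM y (leq0n i) ic); field; rewrite i0.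
  apply: subringM => //; first exact: (gap_in RS _ Ry).
  by move: Ra; rewrite gap_geq // invr1 mul1r.
have -> : (gap y 0 i)^-1 * (gap y 0 c * a) =
    gap (fun l => t l / y l) c i * ((gap t c i)^-1 * a).
  have c0 := gap_neq0 0 y0 cm; have ci0 := gap_neq0 c y0 im.
  have tc0 := gap_neq0 c t0 im.
  rewrite gap_div (gapM y (leq0n c) (ltnW ci)).
  by field; rewrite tc0 c0 ci0.
by apply: subringM => //; exact: (gap_in RS _ Rx).
Qed.

Section EchelonMod.
Variables (X : integralScheme) (E : modSheaf X) (chi : echData E) (m : nat).
Hypothesis HE : is_echelon chi m.
Implicit Types (x z : X) (U V W : opens X).

Lemma echelon_frame : exists r, locally_free r E /\
  forall x, exists U (e : 'I_r -> ratSections E) co c t y,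
    oset U x /\ frame chi m U e co c t y.
Proof.
have pre := ech_pre HE; have [r [freeE free]] := ech_free pre.
by exists r; split=> // x; exact: frame_exists.
Qed.

Section OneFrame.
Variables (U : opens X) (r : nat) (e : 'I_r -> ratSections E).
Variables (co : 'I_r -> ratSections E -> funField X) (c : 'I_r -> nat).
Variables (t y : nat -> funField X).
Hypothesis Fr : frame chi m U e co c t y.
Variable x : X.
Hypothesis Ux : oset U x.

Lemma frame_level_coef k i a : (i <= m)%N -> stalk x ((gap t (c k) i)^-1 * a) ->
  stalk x ((gap y 0 i)^-1 * (gap y 0 (c k) * a)).
Proof.
apply: level_coef.
- exact: stalk_subring.
- exact: (frame_t_neq0 Fr Ux).
- exact: (frame_y_neq0 Fr Ux).
- exact: (frame_y_in Fr HE Ux).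
- exact: (frame_x_in Fr HE Ux).
- exact: (frame_level Fr).
Qed.

Lemma frame_gen k : ech_sub chi (c k) x (e k).
Proof.
apply/(frame_subE Fr Ux _ (frame_level Fr k)) => l.
rewrite (co_dual (frame_basis Fr)); have [->|_] := eqVneq.
  by rewrite gap_geq // invr1 mulr1; exact: stalk1.
by rewrite mulr0; exact: (subring0 (stalk_subring x)).
Qed.

Lemma frame_Mod v : Mod chi m x v <->
  forall k, stalk x (gap y 0 (c k) * co k v).
Proof.
have := Mod_coord_lattice Fr HE Ux v.
by move=> [h1 h2]; split=> [/h1 h k|h]; [| apply: h2 => k];
  have := h k; rewrite invrK.
Qed.
End OneFrame.

Lemma Mod_twist i x v : (i <= m)%N ->
  twist (ech_sub chi i) (ech_D chi i) x v -> Mod chi m x v.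
Proof.
move=> im; have [r [_ /(_ x)[U [e [co [c [t [y [Ux Fr]]]]]]]]] := echelon_frame.
rewrite (twistE _ (frame_D_eqn Fr HE Ux im)) => /(frame_subE Fr Ux _ im) h.
apply/(frame_Mod Fr Ux) => k; have := frame_level_coef Fr Ux im (h k).
have y0 := gap_neq0 0 (frame_y_neq0 Fr Ux) im.
by rewrite (coZ (frame_basis Fr)) mulrCA mulKf.
Qed.

(** The expansion of [v] in a frame, with [e k / Y_(c k)] in [E^(c k)(D_(c k))]. No frame remains in
    the conclusion, so a map that respects the [E^i] and the divisors can be followed summand by
    summand. *)
Lemma Mod_sum x v : Mod chi m x v ->
  exists r (w : 'I_r -> ratSections E) (c : 'I_r -> nat),
  [/\ v = \sum_k w k, forall k, (c k <= m)%N &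
      forall k, twist (ech_sub chi (c k)) (ech_D chi (c k)) x (w k)].
Proof.
have [r [_ /(_ x)[U [e [co [c [t [y [Ux Fr]]]]]]]]] := echelon_frame.
move=> /(frame_Mod Fr Ux) h; exists r, (fun k => co k v *: e k), c.
split=> [||k]; [exact: (coE (frame_basis Fr)) | exact: (frame_level Fr) |].
have ck := frame_level Fr k.
rewrite (twistE _ (frame_D_eqn Fr HE Ux ck)) /= scalerA.
by apply: sub_stalkZ; [exact: h | exact: (frame_gen Fr Ux)].
Qed.

Lemma Mod_locally_free : exists r, locally_free r (sheaf_of_sub (Mod chi m)).
Proof.
have [r [_ Hf]] := echelon_frame; exists r => x.
have [U [e [co [c [t [y [Ux Fr]]]]]]] := Hf x; have U0 : U !=set0 by exists x.
have w0 k : (gap y 0 (c k))^-1 != 0.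
  by rewrite invr_eq0 (gap_neq0 0 (frame_y_neq0 Fr Ux)) // (frame_level Fr).
have [b [Hb _]] := coord_lattice_basis (frame_basis Fr) w0 U0 (Mod_coord_lattice Fr HE).
by exists U, b.
Qed.

Lemma full_Mod : sub_le (sub_full E) (Mod chi m).
Proof.
move=> x v; rewrite -(ech_sub0 (ech_pre HE)) => Ev; apply: (@Mod_twist 0%N) => //.
rewrite (ech_D0 HE) (@twistE _ _ _ _ _ 1); last exact: stalk_unit1.
by rewrite /= scale1r.
Qed.

(** The denominators of one frame are all units on a nonempty open set, which is dense by
    irreducibility. *)
Lemma full_Mod_generic : generically_equal (sub_full E) (Mod chi m).
Proof.
have [x0 _] := ischeme_ne X.
have [r [_ /(_ x0)[U [e [co [c [t [y [Ux0 Fr]]]]]]]]] := echelon_frame.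
have [V [V0 HV]] : exists V, V !=set0 /\ forall x, oset V x ->
    forall k, stalk_unit x (gap y 0 (c k)).
  apply: (@finite_opens X (fun V => V !=set0)); first exact: ischeme_ne.
    by move=> V W; exact: opens_meet.
  move=> k; apply: nonzero_stalk_unit; apply: gap_neq0 (frame_level Fr k).
  exact: (frame_y_neq0 Fr Ux0).
have UV0 : opensI U V !=set0 by apply: opens_meet => //; exists x0.
exists (opensI U V); split.
  by move=> O O0 Oo; exact: (@opens_meet X (Opens Oo) (opensI U V)).
move=> x [Ux Vx]; apply/seteqP; split=> v; first exact: full_Mod.
move=> /(frame_Mod Fr Ux) h; apply/(frame_full Fr HE Ux) => k.
have [a0 _ sa'] := HV x Vx k.
by rewrite -(mulKf a0 (co k v)); exact: stalkM.
Qed.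

(** Morphisms of data and compatible maps are conditions on sections of [E] over open sets; this
    makes them applicable to elements of a stalk. *)
Lemma ech_section i x v : (i <= m)%N -> ech_sub chi i x v ->
  exists U (s : E U), [/\ oset U x, germ s = v &
    forall z, oset U z -> ech_sub chi i z (germ s)].
Proof.
move=> im Ev; have [r [_ /(_ x)[U [e [co [c [t [y [Ux Fr]]]]]]]]] := echelon_frame.
have [V [s [Vx sE]]] : sub_full E x v.
  by apply/(frame_full Fr HE Ux) => k; exact: (frame_sub_le Fr HE Ux _ im).
have [W [Wx HW]] := sub_stalk_open Ev.
have VWx : oset (opensI V W) x by [].
exists (opensI V W), (mres (@opensIl _ V W) s).
have -> : germ (mres (@opensIl _ V W) s) = v by rewrite germ_res //; exists x.
by split=> // z [_ Wz]; exact: HW.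
Qed.
End EchelonMod.

Lemma twist_mono (X : integralScheme) (M : modSheaf X) (F : subSheaf M)
    (D D' : cartier X) : cartier_le D D' -> sub_le (twist F D) (twist F D').
Proof.
move=> le x v; have [t Dt] := eqn_ex D x; have [t' Dt'] := eqn_ex D' x.
rewrite (twistE _ Dt) (twistE _ Dt') /= => Fv.
rewrite -(divfK (eqn_neq0 Dt) t') -scalerA; apply: sub_stalkZ => //.
exact: cartier_leP le Dt Dt'.
Qed.

(** * Functoriality of the modification *)

Section Functoriality.
Variables (X : integralScheme) (m : nat).
Implicit Types (x z : X) (U V W : opens X).

Lemma echHom_D (chi chi' : echelon X m) (g : echHom chi chi') i : (i <= m)%N ->
  cartier_le (ech_D chi i) (ech_D chi' i).
Proof.
elim: i => [_|i IHi im].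
  by rewrite (ech_D0 (echelonP chi)) (ech_D0 (echelonP chi')); exact: cartier_le_refl.
apply: effective_eqn => x.
have [s Ds] := eqn_ex (ech_D chi i) x; have [s' Ds'] := eqn_ex (ech_D chi' i) x.
have [d Dd] := eqn_ex (ech_dD chi i.+1) x; have [d' Dd'] := eqn_ex (ech_dD chi' i.+1) x.
exists ((d' * s') * (d * s)^-1).
  exact: cartierB_eqn (cartierB_eqnD Dd' Ds') (cartierB_eqnD Dd Ds).
rewrite invfM mulrACA; apply: stalkM.
  exact: (cartier_leP (eh_D g (i := i.+1) im) Dd Dd').
exact: cartier_leP (IHi (ltnW im)) Ds Ds'.
Qed.

(** The map on rational sections carries [E^i(D_i)] into [E'^i(D_i)], which lies in [E'^i(D'_i)]
    because the increments only grow; such subsheaves generate the modification. *)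
Lemma Mod_map (chi chi' : echelon X m) (g : echHom chi chi') :
  exists h : mhom (opensT X) (sheaf_of_sub (Mod chi m)) (sheaf_of_sub (Mod chi' m)),
    forall U (s : ech_bundle chi U) (v : subsec (Mod chi m) U),
      subsec_val v = germ s -> subsec_val (h U v) = germ (g U s).
Proof.
have [psi [psi_lin psiE]] := mhom_rat g (ischeme_ne X).
have psi0 : psi 0 = 0.
  by have := psi_lin (-1) 0 0; rewrite scaler0 addr0 scaleN1r addNr.
have psi_sum n (w : 'I_n -> ratSections (ech_bundle chi)) :
    psi (\sum_k w k) = \sum_k psi (w k).
  by apply: (big_morph psi) => // v w'; have := psi_lin 1 v w'; rewrite !scale1r.
have psiZ a v : psi (a *: v) = a *: psi v.
  by have := psi_lin a v 0; rewrite psi0 !addr0.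
have psi_sub i x v : (i <= m)%N -> ech_sub chi i x v -> ech_sub chi' i x (psi v).
  move=> im /(ech_section (echelonP chi) im)[U [s [Ux <- Us]]].
  by rewrite psiE //; [exact: (eh_sub g im Us) | exists x].
have [x v Mv|h hE] := sub_mhom (F := Mod chi m) (G := Mod chi' m) psi_lin.
  have [r [w [c [-> cm Hw]]]] := Mod_sum (echelonP chi) Mv.
  rewrite psi_sum; apply: sub_stalk_sum => k.
  apply: (Mod_twist (echelonP chi') (cm k)); apply: (twist_mono (echHom_D g (cm k))).
  have [t Dt] := eqn_ex (ech_D chi (c k)) x.
  have := Hw k; rewrite !(twistE _ Dt) /= -psiZ; exact: psi_sub.
exists h => U s v vs; have [U0|U0] := pselect (U !=set0).
  by rewrite hE vs psiE.
by rewrite germ_empty0 //; exact: subsec_empty.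
Qed.
End Functoriality.

(** * Extension of maps to line bundles, and maximality *)

Section Extension.
Variables (X : integralScheme) (E : modSheaf X) (chi : echData E) (m : nat).
Hypothesis HE : is_echelon chi m.
Implicit Types (x z : X) (U V W : opens X).

Lemma Mod_extends (L : modSheaf X) (phi : mhom (opensT X) E L) :
  line_bundle L -> ech_compatible chi m phi ->
  exists h : mhom (opensT X) (sheaf_of_sub (Mod chi m)) L, extends phi h.
Proof.
move=> HL Hphi; have [psi [psi_lin psiE]] := mhom_rat phi (ischeme_ne X).
have psi0 : psi 0 = 0.
  by have := psi_lin (-1) 0 0; rewrite scaler0 addr0 scaleN1r addNr.
have psiZ a v : psi (a *: v) = a *: psi v.
  by have := psi_lin a v 0; rewrite psi0 !addr0.
have psiL x v : Mod chi m x v -> sub_full L x (psi v).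
  move=> /(Mod_sum HE)[r [w [c [-> cm Hw]]]].
  have -> : psi (\sum_k w k) = \sum_k psi (w k).
    by apply: (big_morph psi) => // a b; have := psi_lin 1 a b; rewrite !scale1r.
  apply: sub_stalk_sum => k; have := Hw k.
  have [t Dt] := eqn_ex (ech_D chi (c k)) x; rewrite (twistE _ Dt) /=.
  move=> /(ech_section HE (cm k))[U [s [Ux sE Us]]].
  (* As [t *: w k] lies in [E^(c k)], its image is in [t L]; dividing by [t] puts the image of [w k]
     in [L]. *)
  have := Hphi _ (cm k) U s (fun _ _ => I) Us x Ux.
  rewrite (twistNE _ Dt) -psiE //; last by exists x.
  rewrite sE psiZ => Lw; have {Lw} : sub_full L x (t^-1 *: (t *: psi (w k))) := Lw.
  by rewrite scalerA mulVf ?scale1r // (eqn_neq0 Dt).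
have [|h hE] := @lift_mhom X 1 L HL _ _ _ (opensT X) psi (subsec_model (Mod chi m)) psi_lin.
  by move=> U s _ _ x Ux; apply: psiL; exact: subsec_stalk.
exists h => U s v _ vs; have [U0|U0] := pselect (U !=set0); last exact: msec_empty.
by apply: (free_germ_inj HL) => //; rewrite hE // vs psiE.
Qed.

Lemma structure_line_bundle : line_bundle (structure_sheaf X).
Proof.
move=> x; exists (opensT X), (fun=> 1 : rO (opensT X)); split=> // V h.
have e1 : mres h (1 : structure_sheaf X (opensT X)) = (1 : rO V).
  exact: rmorph1.
split=> [s|a]; last first.
  by rewrite big_ord1 e1 => a0 i; rewrite ord1 -[LHS]mulr1.
by exists (fun=> s); rewrite big_ord1 e1; exact: (esym (mulr1 _)).
Qed.

Lemma Mod_maximal (E' : subSheaf E) :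
  (forall (W : opens X) (L : modSheaf X) (phi : mhom W E L),
    line_bundle L -> ech_compatible chi m phi ->
    exists h : mhom W (sheaf_of_sub E') L, extends phi h) ->
  sub_le E' (Mod chi m).
Proof.
move=> Hext x v E'v.
have [r [freeE /(_ x)[U [e [co [c [t [y [Ux Fr]]]]]]]]] := echelon_frame HE.
have B := frame_basis Fr; apply/(frame_Mod HE Fr Ux) => k.
(* The functional is integral only over the frame neighbourhood [U], so it is tested as a map on
   [U]. Its factor [Y_(c k)] is exactly what makes it vanish along [D_i] on [E^i], and its
   regularity at [v] is the condition defining the modification. *)
pose psi (w : ratSections E) : ratSections (structure_sheaf X) :=
  (gap y 0 (c k) * co k w : funField X).
have psi_lin a w w' : psi (a *: w + w') = a *: psi w + psi w'.
  by rewrite /psi (co_lin B) mulrDr mulrCA.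
have ck := frame_level Fr k.
have [|phi phiE] := lift_mhom (W := U) structure_line_bundle (germ_model E) psi_lin.
  move=> V s VU V0 z Vz; rewrite -/(stalk z (psi (germ s))) /psi.
  have Uz := VU z Vz; apply: stalkM.
    apply: (gap_in (stalk_subring z) _ _ ck); exact: (frame_y_in Fr HE Uz).
  have : sub_full E z (germ s) by exists V, s.
  by move=> /(frame_full Fr HE Uz).
have [|h hE] := Hext U (structure_sheaf X) phi structure_line_bundle.
  move=> i im V s VU Vs z Vz; have Uz := VU z Vz.
  rewrite (twistNE _ (frame_D_eqn Fr HE Uz im)) /= phiE //; last by exists z.
  have := (frame_subE Fr Uz _ im).1 (Vs z Vz) k.
  exact: (frame_level_coef HE Fr Uz im).
have [V [Vx HV]] := sub_stalk_open E'v.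
have UV0 : opensI U V !=set0 by exists x.
have [w wE] : exists w : subsec E' (opensI U V), subsec_val w = v.
  by apply: subsec_of => // z [_ Vz]; exact: HV.
suff -> : gap y 0 (c k) * co k v = fgerm (h _ w : rO (opensI U V)).
  by exists (opensI U V), (h _ w).
(* The extension is prescribed only on sections of [E]. On a smaller open set [v] is such a section,
   and a rational function is determined there. *)
have [W [s [_ [_ [W0 vs _ _]]]]] := ratW v v v.
have UVW0 := opens_meet UV0 W0.
pose l := @opensIl _ (opensI U V) W; pose l' := @opensIr _ (opensI U V) W.
have lU : opensI (opensI U V) W `<=` U by move=> z [[]].
have UVU : opensI U V `<=` U by exact: opensIl.
have e1 : h _ (@mres _ (sheaf_of_sub E') _ _ l w) = phi _ (mres l' s).
  apply: hE => //=; rewrite germ_res // -vs -wE; by case: pselect.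
have e2 := phiE _ (mres l' s) lU UVW0.
transitivity (psi v); first by [].
rewrite vs -(germ_res l') // -e2 -e1 (mhom_res h l) //.
exact: (@germ_res _ (structure_sheaf X)).
Qed.
End Extension.

(** * Base change *)

Lemma cartier_ext (X : integralScheme) (D D' : cartier X) :
  (forall x, D x = D' x) -> D = D'.
Proof.
case: D D' => [d p1 p2 p3] [d' q1 q2 q3] /= /funext dd; subst d'.
by rewrite (Prop_irrelevance p1 q1) (Prop_irrelevance p2 q2) (Prop_irrelevance p3 q3).
Qed.

Section DominantPullback.
Variables (Y X : integralScheme) (f : smorph Y X).
Hypothesis fdom : dominant f.

Lemma fun_pull_gap t c j : fun_pull f (gap t c j) = gap (fun l => fun_pull f (t l)) c j.
Proof. by apply: (big_morph (fun_pull f)); [exact: fun_pullM | exact: fun_pull1]. Qed.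

Lemma cartier_pull_eqn (D : cartier X) y t : D (f y) t ->
  cartier_pull fdom D y (fun_pull f t).
Proof. by move=> Dt; exists t, 1; split=> //; [exact: stalk_unit1 | rewrite mul1r]. Qed.

Lemma cartier_pull_le (D D' : cartier X) : cartier_le D D' ->
  cartier_le (cartier_pull fdom D) (cartier_pull fdom D').
Proof.
move=> le; apply: effective_eqn => y.
have [t Dt] := eqn_ex D (f y); have [t' Dt'] := eqn_ex D' (f y).
exists (fun_pull f t' * (fun_pull f t)^-1).
  by apply: cartierB_eqn; exact: cartier_pull_eqn.
rewrite -(fun_pullV fdom) ?(eqn_neq0 Dt) // -(fun_pullM fdom).
by apply: stalk_pull => //; exact: cartier_leP le Dt Dt'.
Qed.

Lemma cartier_pull_B (D D' : cartier X) y t : cartierB D D' (f y) t ->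
  cartierB (cartier_pull fdom D) (cartier_pull fdom D') y (fun_pull f t).
Proof.
move=> [s [s' [Ds Ds' ->]]]; have s0 := eqn_neq0 Ds'.
exists (fun_pull f s), (fun_pull f s'); split.
- exact: cartier_pull_eqn.
- by rewrite /= -(fun_pullV fdom) //; exact: cartier_pull_eqn.
- exact: fun_pullM.
Qed.

Lemma cartier_pull0 : cartier_pull fdom (cartier0 X) = cartier0 Y.
Proof.
apply: cartier_ext => y; apply/seteqP; split=> s /=.
  by move=> [t [u [st su ->]]]; apply: stalk_unitM => //; exact: stalk_unit_pull.
move=> su; exists 1, s; split=> //; first exact: stalk_unit1.
by rewrite (fun_pull1 fdom) mulr1.
Qed.

Section RatPull.
Variables (M : modSheaf X) (N : modSheaf Y) (eta : fmodMap f M N).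

Lemma rat_pull_lin a (v w : ratSections M) :
  rat_pull eta (a *: v + w) = fun_pull f a *: rat_pull eta v + rat_pull eta w.
Proof.
have [U [b [s [t [U0 -> -> ->]]]]] := funFieldW a v w.
rewrite -germZ -germD !(rat_pull_germ fdom) // (fun_pull_fgerm fdom) //.
by rewrite fmodMap_lin germD germZ.
Qed.

Lemma rat_pull0 : rat_pull eta 0 = 0.
Proof.
by have := rat_pull_lin (-1) 0 0; rewrite scaler0 addr0 -(germ0 M (opensT X))
  (rat_pull_germ fdom) ?fmodMap0 ?germ0 //; exact: ischeme_ne.
Qed.

Lemma rat_pull_comb n (a : 'I_n -> funField X) (v : 'I_n -> ratSections M) :
  rat_pull eta (\sum_i a i *: v i) = \sum_i fun_pull f (a i) *: rat_pull eta (v i).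
Proof.
elim/big_rec2: _ => [|i w w' _ <-]; first exact: rat_pull0.
exact: rat_pull_lin.
Qed.

Lemma sub_fmodMap (F : subSheaf M) (G : subSheaf N) :
  (forall y v, F (f y) v -> G y (rat_pull eta v)) ->
  exists theta : fmodMap f (sheaf_of_sub F) (sheaf_of_sub G),
    forall U (v : subsec F U), subsec_val (theta U v) = rat_pull eta (subsec_val v).
Proof.
move=> FG.
have hP U (v : subsec F U) : subsec_pred G (spre f U) (rat_pull eta (subsec_val v)).
  apply/asboolP; split=> [y Uy|]; first exact/FG/subsec_stalk.
  have [U0|U0] := pselect (U !=set0); first by left; exact: spre_ne.
  by right; rewrite (_ : subsec_val v = 0) ?rat_pull0 //; exact: subsec_empty.
pose th U (v : sheaf_of_sub F U) : sheaf_of_sub G (spre f U) := Subsec (hP U v).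
have th_lin U (a : rO U) (s t : sheaf_of_sub F U) :
    th U (a *: s + t) = sharp f U a *: th U s + th U t.
  have [U0|U0] := pselect (U !=set0); last first.
    by apply: msec_empty => -[y Uy]; apply: U0; exists (f y).
  by apply: val_inj; rewrite /= rat_pull_lin (fun_pull_fgerm fdom).
have th_res (U V : opens X) (h : V `<=` U) (h' : spre f V `<=` spre f U)
    (s : sheaf_of_sub F U) : th V (mres h s) = mres h' (th U s).
  have [V0|V0] := pselect (V !=set0); last first.
    by apply: msec_empty => -[y Vy]; apply: V0; exists (f y).
  apply: val_inj => /=; case: pselect => // V1; case: pselect => // -[].
  exact: spre_ne.
by exists (FmodMap th_lin th_res).
Qed.
End RatPull.

Section EchelonPullback.
Variables (E : modSheaf X) (F : modSheaf Y) (eta : fmodMap f E F).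
Variables (m : nat) (chi : echData E) (chi' : echData F).
Hypothesis HE : is_echelon chi m.
Hypothesis Heta : is_pullback eta.
Hypothesis Hpull : ech_pullback fdom eta m chi chi'.
Implicit Types (x : X) (y z : Y).

Section OneFrame.
Variables (U : opens X) (r : nat) (e : 'I_r -> ratSections E).
Variables (co : 'I_r -> ratSections E -> funField X) (c : 'I_r -> nat).
Variables (t s : nat -> funField X).
Hypothesis freeE : locally_free r E.
Hypothesis Fr : frame chi m U e co c t s.
Hypothesis U0 : U !=set0.

Let e' k := rat_pull eta (e k).
Let t' l := fun_pull f (t l).
Let s' l := fun_pull f (s l).
Let B := frame_basis Fr.

Let Ux0 : exists x, oset U x. Proof. by case: U0 => x; exists x. Qed.

(** The vectors of a frame are only rational a priori; base change of a basis needs honest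
    sections. *)
Lemma frame_sections : exists b : 'I_r -> E U,
  is_basis b /\ forall k, germ (b k) = e k.
Proof.
have /choice[b bE] : forall k, exists b : E U, germ b = e k.
  move=> k; apply: (free_section freeE) => // x Ux.
  apply/(frame_full Fr HE Ux) => l; rewrite (co_dual B).
  exact: (subring_nat (stalk_subring x)).
exists b; split=> //; apply: (free_basis freeE (co := co) U0).
  by rewrite (_ : (fun k => germ (b k)) = e) //; apply/funext.
by move=> x Ux v /(frame_full Fr HE Ux).
Qed.

(** The basis of [E] and the rescaled bases of all the [E^i] pull back to bases, while their weights
    pull back with the divisors. So the same levels give a frame on [Y]. *)
Lemma frame_pullback : exists co' : 'I_r -> ratSections F -> funField Y,
  [/\ exists b : 'I_r -> F (spre f U), is_basis b,
      frame chi' m (spre f U) e' co' c t' s' &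
      forall y, oset U (f y) -> forall v, sub_full F y v <->
        forall k, stalk y (co' k v)].
Proof.
have [b [Hb bE]] := frame_sections.
have Hb' := pullback_basis Heta Hb.
have V0 : spre f U !=set0 := spre_ne fdom U0.
have [co' B'] := germ_basis V0 Hb'.
have full y (Uy : oset U (f y)) v := sub_full_coord (x := y) v Hb' B' Uy.
have eE : (fun k => germ (eta U (b k))) = e'.
  by apply/funext => k; rewrite -(rat_pull_germ fdom) // bE.
rewrite eE in B'; exists co'; split=> //; first by exists (fun k => eta U (b k)).
have [x Ux] := U0.
have gap0 i k : (i <= m)%N -> gap t (c k) i != 0.
  exact: (gap_neq0 (c k) (frame_t_neq0 Fr Ux)).
split=> //; first exact: (frame_level Fr).
- move=> i im; have [theta [thetaE Htheta]] := ech_pull_sub Hpull im.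
  have [d [Hd dE]] := coord_lattice_basis B (gap0 i ^~ im) U0 (frame_sub Fr im).
  have Hd' := pullback_basis Htheta Hd.
  apply: (basis_coord_lattice B' _ Hd') => k; rewrite -fun_pull_gap.
    by apply: (fun_pull_neq0 fdom); exact: gap0.
  rewrite thetaE dE; have := rat_pull_lin eta (gap t (c k) i) (e k) 0.
  by rewrite rat_pull0 !addr0.
- move=> i im y Uy; have /andP[i0 i_le] := im; rewrite /ech_ddelta.
  rewrite !(ech_pull_delta Hpull) ?(leq_trans (leq_pred i)) //.
  by apply: cartier_pull_B; exact: (frame_t Fr im Uy).
- move=> i im y Uy; have /andP[i0 i_le] := im; rewrite /ech_dD.
  rewrite !(ech_pull_D Hpull) ?(leq_trans (leq_pred i)) //.
  by apply: cartier_pull_B; exact: (frame_y Fr im Uy).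
Qed.
End OneFrame.

(** The absence of common components is not inherited: after blowing up the origin of the plane, the
    pullbacks of both axes contain the exceptional divisor. The other conditions are read off from
    the pulled back frames and divisors. *)
Lemma echelon_pullback :
  (forall i, (i <= m)%N -> no_common_component (ech_D chi' i) (ech_Ddag chi' i)) ->
  is_echelon chi' m.
Proof.
move=> nc; have [r [freeE Hf]] := echelon_frame HE; have pre := ech_pre HE.
have Hf' y : exists V (e : 'I_r -> ratSections F) co c t s, [/\ oset V y,
    frame chi' m V e co c t s, exists b : 'I_r -> F V, is_basis b,
    forall z, oset V z -> forall v, sub_full F z v <-> forall k, stalk z (co k v) &
    forall l, (0 < l <= m)%N -> stalk y (t l / s l)].
  have [U [e [co [c [t [s [Uy Fr]]]]]]] := Hf (f y).
  have U0 : U !=set0 by exists (f y).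
  have [co' [Hb Fr' full]] := frame_pullback freeE Fr U0.
  exists (spre f U); do 5!eexists.
  split; [exact: Uy | exact: Fr' | exact: Hb | exact: full |].
  move=> l lm; rewrite -(fun_pullV fdom) ?(frame_y_neq0 Fr Uy lm) //.
  rewrite -(fun_pullM fdom); apply: (stalk_pull fdom).
  exact: (frame_x_in Fr HE Uy lm).
have im1 i : (0 < i <= m)%N -> (i <= m)%N /\ (i.-1 <= m)%N.
  by move=> /andP[i0 im]; split=> //; exact: leq_trans (leq_pred i) im.
have eff i : (0 < i <= m)%N -> effective (ech_ddelta chi' i).
  move=> im; have [i1 i2] := im1 i im; rewrite /ech_ddelta !(ech_pull_delta Hpull) //.
  exact: (cartier_pull_le (ech_ddelta_eff pre im)).
split.
- split.
  + exists r; split=> [y|i im y].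
      by have [V [e [co [c [t [s [Vy _ [b Hb] _ _]]]]]]] := Hf' y; exists V, b.
    have [V [e [co [c [t [s [Vy Fr _ _ _]]]]]]] := Hf' y.
    have V0 : V !=set0 by exists y.
    have g0 k : gap t (c k) i != 0 := gap_neq0 (c k) (frame_t_neq0 Fr Vy) im.
    have [b [Hb _]] := coord_lattice_basis (frame_basis Fr) g0 V0 (frame_sub Fr im).
    by exists V, b.
  + move=> y; have [V [e [co [c [t [s [Vy Fr _ full _]]]]]]] := Hf' y.
    apply/seteqP; split=> v; rewrite (full y Vy) (frame_subE Fr Vy) // => h k;
      by have := h k; rewrite gap_geq // invr1 mul1r.
  + move=> i im y; have [V [e [co [c [t [s [Vy Fr _ _ _]]]]]]] := Hf' y.
    apply: (frame_chain Fr _ im Vy) => l lm z Vz.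
    by apply: (eff l lm); exact: (frame_t Fr lm Vz).
  + by rewrite (ech_pull_delta Hpull) // (ech_delta0 pre) cartier_pull0.
  + exact: eff.
  + apply: frames_persistence => // y.
    have [V [e [co [c [t [s [Vy Fr _ _ _]]]]]]] := Hf' y.
    by exists V, r, e, co, c, t, s.
- by rewrite (ech_pull_D Hpull) // (ech_D0 HE) cartier_pull0.
- move=> i im; rewrite (ech_pull_D Hpull im) (ech_pull_delta Hpull im).
  exact: cartier_pull_le (ech_D_le HE im).
- move=> i im; have [i1 i2] := im1 i im; rewrite /ech_dD !(ech_pull_D Hpull) //.
  exact: (cartier_pull_le (ech_dD_eff HE im)).
- move=> i im; apply: effective_eqn => y.
  have [V [e [co [c [t [s [Vy Fr _ _ ts]]]]]]] := Hf' y.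
  exists (t i / s i); last exact: ts.
  exact: cartierB_eqn (frame_t Fr im Vy) (frame_y Fr im Vy).
- exact: nc.
Qed.

(** Pulling back rational sections sends [e k / Y_(c k)] to the corresponding vector of the pulled
    back frame, so local bases go to local bases, which characterizes an inverse image. *)
Lemma Mod_pullback : is_echelon chi' m -> sub_pullback eta (Mod chi m) (Mod chi' m).
Proof.
move=> HE'; have [r [freeE Hf]] := echelon_frame HE.
have [y v|theta thetaE] := @sub_fmodMap _ _ eta (Mod chi m) (Mod chi' m).
  have [U [e [co [c [t [s [Uy Fr]]]]]]] := Hf (f y).
  have [|co' [_ Fr' _]] := frame_pullback freeE Fr; first by exists (f y).
  move=> /(frame_Mod HE Fr Uy) h; apply/(frame_Mod HE' Fr' Uy) => k.
  rewrite [X in rat_pull eta X](coE (frame_basis Fr) v) rat_pull_comb.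
  rewrite (co_sumE (frame_basis Fr')) -fun_pull_gap -(fun_pullM fdom).
  exact: (stalk_pull fdom).
exists theta; split=> //; apply: pullback_of_bases => x.
have [U [e [co [c [t [s [Ux Fr]]]]]]] := Hf x.
have U0 : U !=set0 by exists x.
have [co' [_ Fr' _]] := frame_pullback freeE Fr U0.
have V0 := spre_ne fdom U0; have [y Uy] := V0.
have w0 k : (gap s 0 (c k))^-1 != 0.
  by rewrite invr_eq0 (gap_neq0 0 (frame_y_neq0 Fr Ux)) // (frame_level Fr).
have w0' k : (gap (fun l => fun_pull f (s l)) 0 (c k))^-1 != 0.
  by rewrite invr_eq0 (gap_neq0 0 (frame_y_neq0 Fr' Uy)) // (frame_level Fr).
have [b [Hb bE]] := coord_lattice_basis (frame_basis Fr) w0 U0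
  (Mod_coord_lattice Fr HE).
have [b' [Hb' bE']] := coord_lattice_basis (frame_basis Fr') w0' V0
  (Mod_coord_lattice Fr' HE').
exists U, r, b; split=> //.
rewrite (_ : (fun k => _) = b') //; apply/funext => k; apply: val_inj.
have s0 : gap s 0 (c k) != 0.
  by rewrite (gap_neq0 0 (frame_y_neq0 Fr Ux)) // (frame_level Fr).
transitivity (rat_pull eta ((gap s 0 (c k))^-1 *: e k)).
  by rewrite -bE; exact: thetaE.
transitivity ((gap (fun l => fun_pull f (s l)) 0 (c k))^-1 *: rat_pull eta (e k));
  last exact: (esym (bE' k)).
rewrite -fun_pull_gap -(fun_pullV fdom s0).
by have := rat_pull_lin eta (gap s 0 (c k))^-1 (e k) 0; rewrite rat_pull0 !addr0.
Qed.
End EchelonPullback.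
End DominantPullback.

Theorem theorem2p2 (X : integralScheme) (m : nat) :
  (* (i) *)
  ((forall (E : modSheaf X) (chi : echData E), is_echelon chi m ->
      [/\ exists r, locally_free r (sheaf_of_sub (Mod chi m)),
          sub_le (sub_full E) (Mod chi m)
        & generically_equal (sub_full E) (Mod chi m)])
   /\
   (exists ModMap : forall chi chi' : echelon X m, echHom chi chi' ->
        mhom (opensT X) (sheaf_of_sub (Mod chi m)) (sheaf_of_sub (Mod chi' m)),
      [/\ forall (chi chi' : echelon X m) (g : echHom chi chi') (U : opens X)
              (s : ech_bundle chi U) (v : subsec (Mod chi m) U),
            subsec_val v = germ s ->
            subsec_val (ModMap chi chi' g U v) = germ (g U s),
          forall (chi : echelon X m) (U : opens X) (v : subsec (Mod chi m) U),
            ModMap chi chi (echHom_id chi) U v = v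
        & forall (chi1 chi2 chi3 : echelon X m)
              (h : echHom chi2 chi3) (g : echHom chi1 chi2)
              (U : opens X) (v : subsec (Mod chi1 m) U),
            ModMap chi1 chi3 (echHom_comp h g) U v =
              ModMap chi2 chi3 h U (ModMap chi1 chi2 g U v)]))
  /\
  (* (ii) *)
  (forall (E : modSheaf X) (chi : echData E), is_echelon chi m ->
    forall (Y : integralScheme) (f : smorph Y X) (fdom : dominant f)
      (F : modSheaf Y) (eta : fmodMap f E F), is_pullback eta ->
    forall chi' : echData F, ech_pullback fdom eta m chi chi' ->
      (forall i, (i <= m)%N ->
        no_common_component (ech_D chi' i) (ech_Ddag chi' i)) ->
      is_echelon chi' m /\ sub_pullback eta (Mod chi m) (Mod chi' m))
  /\
  (* (iii) *)
  (forall (E : modSheaf X) (chi : echData E), is_echelon chi m ->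
    (forall (L : modSheaf X) (phi : mhom (opensT X) E L),
      line_bundle L -> ech_compatible chi m phi ->
      exists h : mhom (opensT X) (sheaf_of_sub (Mod chi m)) L, extends phi h)
    /\
    (forall E' : subSheaf E,
      (exists r, locally_free r (sheaf_of_sub E')) ->
      sub_le (sub_full E) E' -> generically_equal (sub_full E) E' ->
      (forall (W : opens X) (L : modSheaf X) (phi : mhom W E L),
        line_bundle L -> ech_compatible chi m phi ->
        exists h : mhom W (sheaf_of_sub E') L, extends phi h) ->
      sub_le E' (Mod chi m))).
Proof.
split; [split|split].
- move=> E chi HE; split; [exact: Mod_locally_free | exact: full_Mod |].
  exact: full_Mod_generic.
- pose ModMap (chi chi' : echelon X m) (g : echHom chi chi') := sval (cid (Mod_map g)).
  have ModMapE (chi chi' : echelon X m) (g : echHom chi chi') (U : opens X)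
      (s : ech_bundle chi U) (v : subsec (Mod chi m) U) :
      subsec_val v = germ s -> subsec_val (ModMap chi chi' g U v) = germ (g U s).
    exact: (svalP (cid (Mod_map g))).
  have restr (chi : echelon X m) (U : opens X) (v : subsec (Mod chi m) U) :
      (U !=set0)%classic -> exists (V : opens X) (h : (V `<=` U)%classic)
      (s : ech_bundle chi V), (V !=set0)%classic /\ subsec_val v = germ s.
    move=> U0; have [W [s [_ [_ [W0 -> _ _]]]]] := ratW v v v.
    exists (opensI U W), (@opensIl _ U W), (mres (@opensIr _ U W) s).
    by split; [exact: opens_meet | rewrite germ_res //; exact: opens_meet].
  have res_val (chi : echelon X m) (U V : opens X) (h : (V `<=` U)%classic)
      (v : subsec (Mod chi m) U) : (V !=set0)%classic ->
      subsec_val (@mres _ (sheaf_of_sub (Mod chi m)) _ _ h v) = subsec_val v.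
    by move=> V0 /=; case: pselect.
  (* A section of the modification is, on a smaller nonempty open set, a section of [E], so the
     chosen maps are determined by [g]. The identity and composition laws are then checked
     generically. *)
  have ModMap_res (chi chi' : echelon X m) (g : echHom chi chi') (U V : opens X)
      (h : (V `<=` U)%classic) (s : ech_bundle chi V) (v : subsec (Mod chi m) U) :
      (V !=set0)%classic -> subsec_val v = germ s ->
      subsec_val (ModMap chi chi' g U v) = germ (g V s).
    move=> V0 vs; rewrite -(res_val _ _ _ h) // -(mhom_res (ModMap chi chi' g)) //.
    by apply: ModMapE; rewrite res_val.
  exists ModMap; split=> [//|chi U v|chi1 chi2 chi3 h g U v].
  + have [U0|U0] := pselect (U !=set0)%classic; last first.
      exact: (@msec_empty _ (sheaf_of_sub _)).
    have [V [k [s [V0 vs]]]] := restr chi U v U0.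
    by apply: val_inj; rewrite /= (ModMap_res _ _ _ _ _ k s).
  + have [U0|U0] := pselect (U !=set0)%classic; last first.
      exact: (@msec_empty _ (sheaf_of_sub _)).
    have [V [k [s [V0 vs]]]] := restr chi1 U v U0.
    apply: val_inj; rewrite /= (ModMap_res _ _ _ _ _ k s) //.
    by rewrite (ModMap_res _ _ h _ _ k (g V s)) // (ModMap_res _ _ g _ _ k s).
- move=> E chi HE Y f fdom F eta Heta chi' Hpull nc.
  have HE' := echelon_pullback HE Heta Hpull nc.
  by split=> //; exact: Mod_pullback.
- move=> E chi HE; split=> [L phi HL Hphi|E' _ _ _ Hext].
    exact: Mod_extends.
  exact: Mod_maximal.
Qed.
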